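(* Let $\mathcal{M}_x,\mathcal{M}_y$ be complete Riemannian manifolds, with $\mathcal{M}_y$ a Hadamard manifold whose sectional curvature is bounded below by $\tau<0$. Let $f,g:\mathcal{M}_x\times\mathcal{M}_y\to\mathbb{R}$ and constants $\mu,l_f,L_f,L_g,\rho>0$ be such that on $\mathcal{U}=\mathcal{U}_x\times\mathcal{U}_y$: $f$ is continuously differentiable and $g$ is twice continuously differentiable; $g(x,\cdot)$ is $\mu$-geodesically strongly convex on $\mathcal{U}_y$ for every $x\in\mathcal{U}_x$; $f$ is $l_f$-Lipschitz; $\mathcal{G}_xf,\mathcal{G}_yf$ are $L_f$-Lipschitz; $\mathcal{G}_xg,\mathcal{G}_yg$ are $L_g$-Lipschitz; $\mathcal{H}_yg,\mathcal{G}^2_{xy}g,\mathcal{G}^2_{yx}g$ are $\rho$-Lipschitz. Assume that the minimum $F^*$ of $F(x)=f(x,y^*(x))$ over $\mathcal{M}_x$ is bounded below ($F^*>-\infty$). Assume that for all lower-level iterates $y_t^k$ of the AdaRHD-R algorithm, $\zeta(\tau,d(y_t^k,y^*(x_t)))\le\zeta$ for a constant $\zeta$, and $d(y_t^k,y^*(x_t))\le\bar D$ for a constant $\bar D>0$ (the iterates lie in a bounded set containing the optimal solution). Assume there are constants $c_u\ge1$, $c_R\ge0$ such that for $\mathcal{M}\in\{\mathcal{M}_x,\mathcal{M}_y\}$, every $z_1$ in $\mathcal{U}_x$ (resp. $\mathcal{U}_y$) and $u\in T_{z_1}\mathcal{M}$, $z_2=\operatorname{Retr}_{z_1}(u)$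 satisfies $d^2(z_1,z_2)\le c_u\|u\|_{z_1}^2$ and $\|\operatorname{Exp}_{z_1}^{-1}(z_2)-u\|_{z_1}\le c_R\|u\|_{z_1}^2$. Then the sequence $\{x_t\}_{t=0}^T$ generated by AdaRHD-R (either variant) satisfies $$\frac1T\sum_{t=0}^{T-1}\|\mathcal{G}F(x_t)\|_{x_t}^2\le\frac{C_{\mathrm{retr}}}{T}=\mathcal{O}\!\left(\frac1T\right),$$ where $$C_{\mathrm{retr}}=\Big(F_0+\frac{2\bar L^2}{a_0\mu^2}\Big)\Big(C_a+2\Big(F_0+\frac{2\bar L^2}{a_0\mu^2}\Big)\Big),$$ with $L_F=\big(L_f+\frac{\rho l_f}{\mu}\big)\big(1+\frac{L_g}{\mu}\big)^2$, $\bar L_F=L_Fc_u+2c_R\big(l_f+\frac{l_fL_g}{\mu}\big)$, $C_a=\max\{2\bar L_F,a_0\}$, $F_0=2(F(x_0)-F^* )+\frac{\bar L_FC_a^2}{a_0^2}$, $L_1=L_f+\frac{l_f\rho}{\mu}+L_g\big(\frac{L_f}{\mu}+\frac{l_f\rho}{\mu^2}\big)$ and $\bar L=\max\{\sqrt2L_1,\sqrt2L_g\}$.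
   Context: Notation. For a Riemannian manifold, $\langle\cdot,\cdot\rangle_z,\|\cdot\|_z$ are the metric and norm on the tangent space at $z$ (the latter also denotes operator norms), $d$ is the Riemannian distance, $\operatorname{Exp}$ the exponential map, $\operatorname{Exp}_z^{-1}$ its inverse (logarithm), $\operatorname{Retr}$ a fixed retraction, $\mathcal{P}_{z}^{z'}$ parallel transport from $T_z$ to $T_{z'}$ along the minimizing geodesic. For $h(x,y)$ on $\mathcal{M}_x\times\mathcal{M}_y$: $\mathcal{G}_xh,\mathcal{G}_yh$ are the partial Riemannian gradients, $\mathcal{H}_yh(x,y):T_y\mathcal{M}_y\to T_y\mathcal{M}_y$ is the Riemannian Hessian in $y$, and $\mathcal{G}^2_{xy}h(x,y):T_y\mathcal{M}_y\to T_x\mathcal{M}_x$ (derivative of $\mathcal{G}_xh$ in $y$), $\mathcal{G}^2_{yx}h(x,y):T_x\mathcal{M}_x\to T_y\mathcal{M}_y$ are the Riemannian cross derivatives. Lipschitz conventions on $\mathcal{U}$. The gradients $\mathcal{G}_xh,\mathcal{G}_yh$ are $L$-Lipschitz if $\|\mathcal{P}_{y_1}^{y_2}\mathcal{G}_yh(x,y_1)-\mathcal{G}_yh(x,y_2)\|_{y_2}\le Ld(y_1,y_2)$, $\|\mathcal{G}_xh(x,y_1)-\mathcal{G}_xh(x,y_2)\|_x\le Ld(y_1,y_2)$, $\|\mathcal{P}_{x_1}^{x_2}\mathcal{G}_xh(x_1,y)-\mathcal{G}_xh(x_2,y)\|_{x_2}\le Ld(x_1,x_2)$, $\|\mathcal{G}_yh(x_1,y)-\mathcal{G}_yh(x_2,y)\|_y\le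 Ld(x_1,x_2)$. An operator $\mathcal{G}(x,y):T_y\mathcal{M}_y\to T_x\mathcal{M}_x$ is $\rho$-Lipschitz if $\|\mathcal{P}_{x_1}^{x_2}\mathcal{G}(x_1,y)-\mathcal{G}(x_2,y)\|_{x_2}\le\rho d(x_1,x_2)$ and $\|\mathcal{G}(x,y_1)-\mathcal{G}(x,y_2)\mathcal{P}_{y_1}^{y_2}\|_x\le\rho d(y_1,y_2)$ (similarly with the roles of $x,y$ exchanged); $\mathcal{H}(x,y):T_y\mathcal{M}_y\to T_y\mathcal{M}_y$ is $\rho$-Lipschitz if $\|\mathcal{P}_{y_1}^{y_2}\mathcal{H}(x,y_1)\mathcal{P}_{y_2}^{y_1}-\mathcal{H}(x,y_2)\|_{y_2}\le\rho d(y_1,y_2)$ and $\|\mathcal{H}(x_1,y)-\mathcal{H}(x_2,y)\|_y\le\rho d(x_1,x_2)$. Region. $\mathcal{U}_x\subseteq\mathcal{M}_x$, $\mathcal{U}_y\subseteq\mathcal{M}_y$ are geodesically convex sets (points joined by unique minimizing geodesics inside the set) in which everything takes place: $y^*(x)\in\mathcal{U}_y$ for $x\in\mathcal{U}_x$, and all iterates, geodesic segments joining points under consideration, and (gradient) steps from them lie in $\mathcal{U}_x$, resp. $\mathcal{U}_y$. Problem. $\min_{x\in\mathcal{M}_x}F(x):=f(x,y^*(x))$, with $y^*(x)=\arg\min_{y\in\mathcal{M}_y}g(x,y)$. The Riemannian gradient (hypergradient) of $F$ is $\mathcal{G}F(x)=\mathcal{G}_xf(x,y^*(x))-\mathcal{G}^2_{xy}g(x,y^*(x))\,\mathcal{H}_y^{-1}g(x,y^*(x))[\mathcal{G}_yf(x,y^*(x))]$.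 Put $R(x,y,v)=\frac12\langle v,\mathcal{H}_yg(x,y)[v]\rangle_y-\langle v,\mathcal{G}_yf(x,y)\rangle_y$ for $v\in T_y\mathcal{M}_y$, so $\nabla_vR(x,y,v)=\mathcal{H}_yg(x,y)[v]-\mathcal{G}_yf(x,y)$, and $\widehat{\mathcal{G}}F(x,y,v)=\mathcal{G}_xf(x,y)-\mathcal{G}^2_{xy}g(x,y)[v]$. Curvature constant: $\zeta(\tau,c)=\frac{\sqrt{|\tau|}c}{\tanh(\sqrt{|\tau|}c)}$ for $\tau<0$. AdaRHD-R algorithm. Inputs: $x_0\in\mathcal{M}_x$, $y_0\in\mathcal{M}_y$, $v_0\in T_{y_0}\mathcal{M}_y$, $a_0,b_0,c_0>0$, integer $T\ge1$; tolerances $\epsilon_y=\epsilon_v=1/T$. For $t=0,\dots,T-1$: (1) Set $y_t^0=y_{t-1}^{K_{t-1}}$ if $t>0$, $y_0^0=y_0$. Starting from $k=0$ (with $b_0$ the input value, for each $t$), while $\|\mathcal{G}_yg(x_t,y_t^k)\|_{y_t^k}^2>\epsilon_y$: $b_{k+1}^2=b_k^2+\|\mathcal{G}_yg(x_t,y_t^k)\|_{y_t^k}^2$, $y_t^{k+1}=\operatorname{Retr}_{y_t^k}(-\frac1{b_{k+1}}\mathcal{G}_yg(x_t,y_t^k))$, $k\leftarrow k+1$. Let $K_t$ be the final $k$. (2) Variant AdaRHD-GD: set $v_t^0=\mathcal{P}_{y_{t-1}^{K_{t-1}}}^{y_t^{K_t}}v_{t-1}^{N_{t-1}}$ if $t>0$,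 and $v_0^0=v_0$ (transported to $T_{y_0^{K_0}}\mathcal{M}_y$); starting from $n=0$ and the input $c_0$, while $\|\nabla_vR(x_t,y_t^{K_t},v_t^n)\|^2_{y_t^{K_t}}>\epsilon_v$: $c_{n+1}^2=c_n^2+\|\nabla_vR(x_t,y_t^{K_t},v_t^n)\|^2_{y_t^{K_t}}$, $v_t^{n+1}=v_t^n-\frac1{c_{n+1}}\nabla_vR(x_t,y_t^{K_t},v_t^n)$, $n\leftarrow n+1$. Variant AdaRHD-CG: run the standard conjugate gradient method in $T_{y_t^{K_t}}\mathcal{M}_y$ on $\mathcal{H}_yg(x_t,y_t^{K_t})[v]=\mathcal{G}_yf(x_t,y_t^{K_t})$ from $v_t^0=0$, until $\|\nabla_vR(x_t,y_t^{K_t},v_t^n)\|^2_{y_t^{K_t}}\le\epsilon_v$. Let $N_t$ be the final $n$. (3) $a_{t+1}^2=a_t^2+\|\widehat{\mathcal{G}}F(x_t,y_t^{K_t},v_t^{N_t})\|_{x_t}^2$ and $x_{t+1}=\operatorname{Retr}_{x_t}(-\frac1{a_{t+1}}\widehat{\mathcal{G}}F(x_t,y_t^{K_t},v_t^{N_t}))$.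
   Formalization: The regions U_x and U_y are additionally assumed to lie in the closure of their interior; for lower-dimensional regions the Hessian of g may be singular, so the hypergradient is undefined, or the bound can fail. *)

(* Defs.v *)
From HB Require Import structures.
From mathcomp Require Import all_boot all_order all_algebra.
From mathcomp Require Import all_classical all_reals all_analysis.

Set Implicit Arguments.
Unset Strict Implicit.
Unset Printing Implicit Defensive.

Import Order.TTheory GRing.Theory Num.Theory.
Import numFieldNormedType.Exports.

Local Open Scope classical_set_scope.
Local Open Scope ring_scope.

(* Riemannian geometry is set up in coordinates.  Vectors are row vectors and
   a linear map of matrix A is v |-> v *m A. *)

(* meant for open D *)
Fixpoint Ck (R : realType) (n k : nat) (D : set 'rV[R]_n) (h : 'rV[R]_n -> R)
    : Prop :=
  (forall u, D u -> {for u, continuous h}) /\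
  (if k is k'.+1 then
     forall a : 'I_n,
       (forall u, D u -> derivable h u (delta_mx 0 a)) /\
       Ck k' D ('D_(delta_mx 0 a) h)
   else True).

Definition smooth (R : realType) (n : nat) (D : set 'rV[R]_n)
  (h : 'rV[R]_n -> R) : Prop := forall k, Ck k D h.

(* [chart_inv i] is only meaningful on the image of the i-th chart, and
   [gmx i p], the Gram matrix of the coordinate frame, only when p is in the
   domain of the i-th chart.  [chart_at p] is an arbitrarily chosen chart around
   p; tangent vectors at p are represented by their components in it. *)
Record riemannian_manifold (R : realType) := RiemannianManifold {
  carrier :> topologicalType ;
  dim : nat ;
  atlas : Type ;
  chart_dom : atlas -> set carrier ;
  chart : atlas -> carrier -> 'rV[R]_dim ;
  chart_inv : atlas -> 'rV[R]_dim -> carrier ;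
  chart_at : carrier -> atlas ;
  gmx : atlas -> carrier -> 'M[R]_dim ;
  _ : hausdorff_space carrier ;
  _ : @second_countable carrier ;
  _ : connected [set: carrier] ;
  _ : forall p, chart_dom (chart_at p) p ;
  _ : forall i, open (chart_dom i) ;
  _ : forall i, open (chart i @` chart_dom i) ;
  _ : forall i p, chart_dom i p -> chart_inv i (chart i p) = p ;
  _ : forall i p, chart_dom i p -> {for p, continuous (chart i)} ;
  _ : forall i u, (chart i @` chart_dom i) u ->
        {for u, continuous (chart_inv i)} ;
  _ : forall i j k, smooth (chart i @` (chart_dom i `&` chart_dom j))
        (fun u => chart j (chart_inv i u) 0 k) ;
  _ : forall i p, chart_dom i p -> (gmx i p)^T = gmx i p ;
  _ : forall i p (v : 'rV[R]_dim), chart_dom i p -> v != 0 ->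
        0 < (v *m gmx i p *m v^T) 0 0 ;
  _ : forall i k l, smooth (chart i @` chart_dom i)
        (fun u => gmx i (chart_inv i u) k l) ;
  _ : forall i j p, chart_dom i p -> chart_dom j p ->
        let J := \matrix_(k, l) 'D_(delta_mx 0 k)
                   (fun u => chart j (chart_inv i u) 0 l) (chart i p) in
        gmx i p = J *m gmx j p *m J^T
}.

Section Geometry.
Variables (R : realType) (M : riemannian_manifold R).
Implicit Types (p q : M) (i j : atlas M) (gamma : R -> M).

Definition tangent (p : M) : Type := 'rV[R]_(dim M).

Definition inner p (v w : tangent p) : R :=
  (v *m gmx (chart_at p) p *m w^T) 0 0.

Definition norm_at p (v : tangent p) : R := Num.sqrt (inner v v).

Definition pd i (a : 'I_(dim M)) (h : M -> R) p : R :=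
  'D_(delta_mx 0 a) (h \o chart_inv i) (chart i p).

(* [v *m jac i j p] converts components in chart i into components in chart j *)
Definition jac i j p : 'M[R]_(dim M) :=
  \matrix_(a, b) pd i a (fun q => chart j q 0 b) p.

(* Gamma^k_{ab} in chart i *)
Definition christoffel i p (k a b : 'I_(dim M)) : R :=
  2^-1 * \sum_l invmx (gmx i p) k l *
    (pd i a (fun q => gmx i q b l) p + pd i b (fun q => gmx i q a l) p
     - pd i l (fun q => gmx i q a b) p).

(* R(u, v) w = nabla_u nabla_v w - nabla_v nabla_u w - nabla_[u, v] w *)
Definition curvature p (u v w : tangent p) : tangent p :=
  let i := chart_at p in
  \row_l \sum_a \sum_b \sum_c
    (pd i a (fun q => christoffel i q l b c) p
     - pd i b (fun q => christoffel i q l a c) p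
     + \sum_m (christoffel i p l a m * christoffel i p m b c
               - christoffel i p l b m * christoffel i p m a c))
    * u 0 a * v 0 b * w 0 c.

Definition area2 p (u v : tangent p) : R :=
  inner u u * inner v v - inner u v ^+ 2.

Definition sectional_curvature p (u v : tangent p) : R :=
  inner (curvature u v v) u / area2 u v.

Definition sectional_ge (tau : R) : Prop :=
  forall p (u v : tangent p), area2 u v != 0 -> tau <= sectional_curvature u v.

Definition sectional_le (tau : R) : Prop :=
  forall p (u v : tangent p), area2 u v != 0 -> sectional_curvature u v <= tau.

Definition coord i gamma (k : 'I_(dim M)) : R -> R :=
  fun t => chart i (gamma t) 0 k.

Definition velocity gamma t : tangent (gamma t) :=
  \row_k derive1 (coord (chart_at (gamma t)) gamma k) t.

Definition C1_curve gamma : Prop :=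
  continuous gamma /\
  forall i k t, chart_dom i (gamma t) ->
    derivable (coord i gamma k) t 1 /\
    {for t, continuous (derive1 (coord i gamma k))}.

Definition curve_length gamma : R :=
  Rintegral (@lebesgue_measure R) `[0, 1] (fun t => norm_at (velocity gamma t)).

Definition dist p q : R :=
  inf [set l | exists gamma,
    [/\ C1_curve gamma, gamma 0 = p, gamma 1 = q & l = curve_length gamma]].

Definition complete_manifold : Prop :=
  forall u : nat -> M,
    (forall e : R, 0 < e -> exists n0, forall m n,
      (n0 <= m)%N -> (n0 <= n)%N -> dist (u m) (u n) < e) ->
    exists p, (fun n => dist (u n) p) @ \oo --> (0 : R).

Definition simply_connected : Prop :=
  forall gamma, continuous gamma -> gamma 0 = gamma 1 ->
  exists H : R * R -> M, continuous H /\
    (forall t, 0 <= t <= 1 -> H (0, t) = gamma t /\ H (1, t) = gamma 0) /\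
    (forall s, 0 <= s <= 1 -> H (s, 0) = gamma 0 /\ H (s, 1) = gamma 0).

Definition hadamard : Prop :=
  [/\ complete_manifold, simply_connected & sectional_le 0].

(* Geodesics are parametrized by the whole line, which is no restriction on a
   complete manifold. *)
Definition geodesic gamma : Prop :=
  continuous gamma /\
  forall i k t, chart_dom i (gamma t) ->
    [/\ derivable (coord i gamma k) t 1,
        derivable (derive1 (coord i gamma k)) t 1 &
        derive1 (derive1 (coord i gamma k)) t
        + \sum_a \sum_b christoffel i (gamma t) k a b
            * derive1 (coord i gamma a) t * derive1 (coord i gamma b) t = 0].

Definition minimizing_geodesic p q gamma : Prop :=
  [/\ geodesic gamma, gamma 0 = p, gamma 1 = q & curve_length gamma = dist p q].

Definition parallel_along gamma (V : forall t, tangent (gamma t)) : Prop :=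
  let W i b := fun t => (V t *m jac (chart_at (gamma t)) i (gamma t)) 0 b in
  forall i k t, chart_dom i (gamma t) ->
    derivable (W i k) t 1 /\
    derive1 (W i k) t
    + \sum_a \sum_b christoffel i (gamma t) k a b
        * derive1 (coord i gamma a) t * W i b t = 0.

(* The tangent spaces at [gamma 0] and p (resp. [gamma 1] and q) use the same
   components since [gamma 0 = p] (resp. [gamma 1 = q]). *)
Definition parallel_transport_rel p q (v : tangent p) (w : tangent q) : Prop :=
  exists gamma (V : forall t, tangent (gamma t)),
    [/\ minimizing_geodesic p q gamma, parallel_along V,
        V 0 = v :> 'rV[R]_(dim M) & V 1 = w :> 'rV[R]_(dim M)].

Definition is_parallel_transport (U : set M)
    (P : forall p q, tangent p -> tangent q) : Prop :=
  forall p q (v : tangent p), U p -> U q -> parallel_transport_rel v (P p q v).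

(* Exp_p^{-1}(q): initial velocity of a minimizing geodesic from p to q *)
Definition Log p q : tangent p :=
  xget (0 : 'rV[R]_(dim M)) [set v : 'rV[R]_(dim M) |
    exists gamma, minimizing_geodesic p q gamma /\ velocity gamma 0 = v].

Definition geodesically_convex (U : set M) : Prop :=
  forall p q, U p -> U q -> exists gamma,
    [/\ minimizing_geodesic p q gamma,
        (forall t, 0 <= t <= 1 -> U (gamma t)) &
        forall gamma', minimizing_geodesic p q gamma' ->
          forall t, 0 <= t <= 1 -> gamma' t = gamma t].

Definition strongly_convex (mu : R) (U : set M) (h : M -> R) : Prop :=
  forall p q gamma, U p -> U q -> minimizing_geodesic p q gamma ->
  forall t, 0 <= t <= 1 ->
    h (gamma t) <= (1 - t) * h p + t * h q
                   - mu / 2 * t * (1 - t) * dist p q ^+ 2.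

Definition grad_in i (h : M -> R) p : 'rV[R]_(dim M) :=
  (\row_a pd i a h p) *m invmx (gmx i p).

Definition grad (h : M -> R) p : tangent p := grad_in (chart_at p) h p.

(* matrix of v |-> nabla_v (grad h) *)
Definition hess (h : M -> R) p : 'M[R]_(dim M) :=
  let i := chart_at p in
  \matrix_(a, k) (pd i a (fun q => grad_in i h q 0 k) p
                  + \sum_b christoffel i p k a b * grad_in i h p 0 b).

(* Smoothness is that of a map TM -> M, expressed in the charts of TM
   induced by those of M. *)
Definition is_retraction (Retr : forall p, tangent p -> M) : Prop :=
  let E i (w : 'rV[R]_(dim M + dim M)) : M :=
    let p := chart_inv i (lsubmx w) in
    Retr p (rsubmx w *m jac i (chart_at p) p) in
  [/\ forall p, Retr p (0 : 'rV[R]_(dim M)) = p,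
      forall p (v : 'rV[R]_(dim M)),
        velocity (fun t => Retr p (t *: v)) 0 = v :> 'rV[R]_(dim M) &
      forall i j k,
        let D := [set w | (chart i @` chart_dom i) (lsubmx w) /\
                          chart_dom j (E i w)] in
        open D /\ smooth D (fun w => chart j (E i w) 0 k)].

Definition retraction_bounds (U : set M) (Retr : forall p, tangent p -> M)
    (cu cR : R) : Prop :=
  forall p (u : tangent p), U p ->
    dist p (Retr p u) ^+ 2 <= cu * norm_at u ^+ 2 /\
    norm_at (Log p (Retr p u) - u : tangent p) <= cR * norm_at u ^+ 2.

End Geometry.

Section OperatorNorm.
Variables (R : realType) (M N : riemannian_manifold R).

Definition opnorm_le (p : M) (q : N) (A : tangent p -> tangent q) (c : R)
    : Prop :=
  forall v : tangent p, norm_at (A v) <= c * norm_at v.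

End OperatorNorm.

Section Bilevel.
Variables (R : realType) (Mx My : riemannian_manifold R).
Implicit Types (x : Mx) (y : My) (h : Mx -> My -> R).

(* C^k on a neighbourhood of the (not necessarily open) set U *)
Definition Ck_prod (k : nat) (U : set (Mx * My)) h : Prop :=
  exists W : set (Mx * My), [/\ open W, U `<=` W &
    forall i j,
      Ck k [set w : 'rV[R]_(dim Mx + dim My) |
              [/\ (chart i @` chart_dom i) (lsubmx w),
                  (chart j @` chart_dom j) (rsubmx w) &
                  W (chart_inv i (lsubmx w), chart_inv j (rsubmx w))]]
           (fun w => h (chart_inv i (lsubmx w)) (chart_inv j (rsubmx w)))].

Definition Gx h x y : tangent x := grad (fun x' => h x' y) x.
Definition Gy h x y : tangent y := grad (h x) y.
Definition Hy h x y (v : tangent y) : tangent y := v *m hess (h x) y.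
Definition Gxy h x y (v : tangent y) : tangent x :=
  v *m \matrix_(a, k) pd (chart_at y) a
         (fun y' => (Gx h x y' : 'rV[R]_(dim Mx)) 0 k) y.
Definition Gyx h x y (v : tangent x) : tangent y :=
  v *m \matrix_(a, k) pd (chart_at x) a
         (fun x' => (Gy h x' y : 'rV[R]_(dim My)) 0 k) x.

Section Lipschitz.
Variables (Ux : set Mx) (Uy : set My).
Variable (Px : forall p q : Mx, tangent p -> tangent q).
Variable (Py : forall p q : My, tangent p -> tangent q).

(* Implied by Lipschitz continuity for the product distance. *)
Definition lipschitz_fun (l : R) h : Prop :=
  (forall x y1 y2, Ux x -> Uy y1 -> Uy y2 ->
     `|h x y1 - h x y2| <= l * dist y1 y2) /\
  (forall x1 x2 y, Ux x1 -> Ux x2 -> Uy y ->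
     `|h x1 y - h x2 y| <= l * dist x1 x2).

Definition lipschitz_grads (L : R) h : Prop :=
  (forall x y1 y2, Ux x -> Uy y1 -> Uy y2 ->
     norm_at (Py y2 (Gy h x y1) - Gy h x y2 : tangent y2) <= L * dist y1 y2 /\
     norm_at (Gx h x y1 - Gx h x y2 : tangent x) <= L * dist y1 y2) /\
  (forall x1 x2 y, Ux x1 -> Ux x2 -> Uy y ->
     norm_at (Px x2 (Gx h x1 y) - Gx h x2 y : tangent x2) <= L * dist x1 x2 /\
     norm_at (Gy h x1 y - Gy h x2 y : tangent y) <= L * dist x1 x2).

Definition lipschitz_Gxy (rho : R) h : Prop :=
  (forall x1 x2 y, Ux x1 -> Ux x2 -> Uy y ->
     opnorm_le (fun v : tangent y =>
         Px x2 (Gxy h x1 v) - Gxy h x2 v : tangent x2)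
       (rho * dist x1 x2)) /\
  (forall x y1 y2, Ux x -> Uy y1 -> Uy y2 ->
     opnorm_le (fun v : tangent y1 =>
         Gxy h x v - Gxy h x (Py y2 v) : tangent x)
       (rho * dist y1 y2)).

Definition lipschitz_Gyx (rho : R) h : Prop :=
  (forall x y1 y2, Ux x -> Uy y1 -> Uy y2 ->
     opnorm_le (fun v : tangent x =>
         Py y2 (Gyx h y1 v) - Gyx h y2 v : tangent y2)
       (rho * dist y1 y2)) /\
  (forall x1 x2 y, Ux x1 -> Ux x2 -> Uy y ->
     opnorm_le (fun v : tangent x1 =>
         Gyx h y v - Gyx h y (Px x2 v) : tangent y)
       (rho * dist x1 x2)).

Definition lipschitz_Hy (rho : R) h : Prop :=
  (forall x y1 y2, Ux x -> Uy y1 -> Uy y2 ->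
     opnorm_le (fun v : tangent y2 =>
         Py y2 (Hy h x (Py y1 v)) - Hy h x v : tangent y2)
       (rho * dist y1 y2)) /\
  (forall x1 x2 y, Ux x1 -> Ux x2 -> Uy y ->
     opnorm_le (fun v : tangent y => Hy h x1 v - Hy h x2 v : tangent y)
       (rho * dist x1 x2)).

End Lipschitz.

Variables (f g : Mx -> My -> R).

Definition upper_objective (ystar : Mx -> My) x : R := f x (ystar x).

Definition hypergrad (ystar : Mx -> My) x : tangent x :=
  let y := ystar x in
  Gx f x y - Gxy g x (Gy f x y *m invmx (hess (g x) y) : tangent y).

Definition gradR x y (v : tangent y) : tangent y := Hy g x v - Gy f x y.

Definition approx_hypergrad x y (v : tangent y) : tangent x :=
  Gx f x y - Gxy g x v.

Variable (Retrx : forall x, tangent x -> Mx).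
Variable (Retry : forall y, tangent y -> My).
Variable (Py : forall p q : My, tangent p -> tangent q).

Definition lower_loop (eps b0 : R) x (y : nat -> My) (K : nat) : Prop :=
  exists b : nat -> R,
    [/\ b 0%N = b0,
        forall k, (k < K)%N ->
          [/\ eps < norm_at (Gy g x (y k)) ^+ 2,
              b k.+1 = Num.sqrt (b k ^+ 2 + norm_at (Gy g x (y k)) ^+ 2) &
              y k.+1 = Retry (- (b k.+1)^-1 *: Gy g x (y k) : tangent (y k))] &
        norm_at (Gy g x (y K)) ^+ 2 <= eps].

Definition gd_loop (eps c0 : R) x y (v : nat -> tangent y) (N : nat) : Prop :=
  exists c : nat -> R,
    [/\ c 0%N = c0,
        forall n, (n < N)%N ->
          [/\ eps < norm_at (gradR x (v n)) ^+ 2,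
              c n.+1 = Num.sqrt (c n ^+ 2 + norm_at (gradR x (v n)) ^+ 2) &
              v n.+1 = v n - (c n.+1)^-1 *: gradR x (v n)] &
        norm_at (gradR x (v N)) ^+ 2 <= eps].

(* r: residuals, d: search directions *)
Definition cg_loop (eps : R) x y (v : nat -> tangent y) (N : nat) : Prop :=
  exists r d : nat -> tangent y,
    [/\ v 0%N = (0 : 'rV[R]_(dim My)),
        r 0%N = Gy f x y - Hy g x (v 0%N),
        d 0%N = r 0%N,
        forall n, (n < N)%N ->
          let alpha := inner (r n) (r n) / inner (d n) (Hy g x (d n)) in
          let beta := inner (r n.+1) (r n.+1) / inner (r n) (r n) in
          [/\ eps < norm_at (gradR x (v n)) ^+ 2,
              v n.+1 = v n + alpha *: d n,
              r n.+1 = r n - alpha *: Hy g x (d n) &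
              d n.+1 = r n.+1 + beta *: d n] &
        norm_at (gradR x (v N)) ^+ 2 <= eps].

Inductive variant := AdaRHD_GD | AdaRHD_CG.

(* The values of the sequences beyond the indices produced by the algorithm
   (x t for t > T, y t k for k > K t, v t n for n > N t, ...) are irrelevant. *)
Record AdaRHD_R (var : variant) (T : nat) (x0 : Mx) (y0 : My) (v0 : tangent y0)
    (a0 b0 c0 : R) (x : nat -> Mx) (K : nat -> nat) (y : nat -> nat -> My)
    (N : nat -> nat) (v : forall t, nat -> tangent (y t (K t))) (a : nat -> R)
    : Prop := {
  x_init : x 0%N = x0 ;
  a_init : a 0%N = a0 ;
  y_init : y 0%N 0%N = y0 ;
  y_warm : forall t, (t.+1 < T)%N -> y t.+1 0%N = y t (K t) ;
  y_loop : forall t, (t < T)%N -> lower_loop T%:R^-1 b0 (x t) (y t) (K t) ;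
  v_loop : match var with
    | AdaRHD_GD =>
        [/\ v 0%N 0%N = Py (y 0%N (K 0%N)) v0,
            forall t, (t.+1 < T)%N ->
              v t.+1 0%N = Py (y t.+1 (K t.+1)) (v t (N t)) &
            forall t, (t < T)%N -> gd_loop T%:R^-1 c0 (x t) (@v t) (N t)]
    | AdaRHD_CG =>
        forall t, (t < T)%N -> cg_loop T%:R^-1 (x t) (@v t) (N t)
    end ;
  x_step : forall t, (t < T)%N ->
    let G := approx_hypergrad (x t) (v t (N t)) in
    a t.+1 = Num.sqrt (a t ^+ 2 + norm_at G ^+ 2) /\
    x t.+1 = Retrx (- (a t.+1)^-1 *: G : tangent (x t))
}.

End Bilevel.

Section Constants.
Variable R : realType.

Definition tanh (t : R) : R := (expR t - expR (- t)) / (expR t + expR (- t)).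

(* extended by continuity at c = 0 *)
Definition zeta_curv (tau c : R) : R :=
  if c == 0 then 1
  else Num.sqrt `|tau| * c / tanh (Num.sqrt `|tau| * c).

(* gap stands for F(x_0) - F^* *)
Variables (mu lf Lf Lg rho cu cR a0 gap : R).

Definition L_F : R := (Lf + rho * lf / mu) * (1 + Lg / mu) ^+ 2.
Definition Lbar_F : R := L_F * cu + 2 * cR * (lf + lf * Lg / mu).
Definition C_a : R := Num.max (2 * Lbar_F) a0.
Definition F_0 : R := 2 * gap + Lbar_F * C_a ^+ 2 / a0 ^+ 2.
Definition L_1 : R :=
  Lf + lf * rho / mu + Lg * (Lf / mu + lf * rho / mu ^+ 2).
Definition Lbar : R := Num.max (Num.sqrt 2 * L_1) (Num.sqrt 2 * Lg).
Definition C_retr : R :=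
  (F_0 + 2 * Lbar ^+ 2 / (a0 * mu ^+ 2))
  * (C_a + 2 * (F_0 + 2 * Lbar ^+ 2 / (a0 * mu ^+ 2))).

End Constants.

(* Main.v *)
From HB Require Import structures.
Require Import Defs.
From mathcomp Require Import all_boot all_order all_algebra.
From mathcomp Require Import all_classical all_reals all_analysis.
From mathcomp Require Import ring lra.
Import Order.TTheory GRing.Theory Num.Theory.
Import numFieldNormedType.Exports.
Local Open Scope classical_set_scope.
Local Open Scope ring_scope.

(* The hypergradient GF is L_F-Lipschitz up to parallel transport, F decreases along
   minimizing geodesics as predicted by GF, and the inner loops leave an error of order
   1/T on |GF|^2.  An AdaGrad-norm argument then concludes: the steps with a_(t+1) <= C_a
   are paid for by the growth of a_t^2, the others each decrease F.
   No smooth dependence of geodesics on their endpoints is needed.  Bounds on gradients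
   and Hessians at an interior point p of a convex region are obtained along minimizing
   geodesics leaving p, whose directions are dense, and extend to the closure by
   continuity; and y* is Lipschitz by strong convexity, after which the derivative of y*
   along a geodesic comes from a first-order expansion of the critical point equation. *)

(** * Calculus in R^n *)

(** [dist] is an infimum over C^1 curves parametrized by the whole line, so curves have to be joined
    without corners, and bounds on derivatives have to be extracted from inequalities between
    distances. Parallel transport is a map known only through some witness field along some
    minimizing geodesic; that it is an isometry follows from metric compatibility together with
    uniqueness of minimizing geodesics inside the region. Origin of the constants: put
    [C = Lf + rho * lf / mu]. Following the point (x, y*(x)) costs a factor [1 + Lg / mu], and
    correcting the solution of the linear system costs the same factor again, whence
    [L_F = C * (1 + Lg / mu) ^+ 2]. [Lbar_F] adds the retraction defect [cR * |u|^2] paired with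
    [|GF| <= lf + lf * Lg / mu], doubled because [Lbar_F] enters the descent inequality halved. The
    stopping tests at level 1/T leave a squared hypergradient error of at most
    [E = 2 * Lbar ^+ 2 / (mu ^+ 2 * T)]; over T steps this costs [T * E / a0 = 2 * Lbar ^+ 2 / (a0 *
    mu ^+ 2)], the summand of [C_retr] that no longer depends on T. *)

Section Calculus.
Context {R : realType}.

Lemma cvg_bigsum (T : Type) (F : set_system T) {FF : Filter F} (I : Type)
    (r : seq I) (P : pred I) (f : I -> T -> R) (l : I -> R) :
  (forall i, f i @ F --> l i) ->
  \sum_(i <- r | P i) f i x @[x --> F] --> \sum_(i <- r | P i) l i.
Proof.
move=> fl; elim: r => [|i r IH].
  under eq_fun do rewrite big_nil.
  by rewrite big_nil; exact: cvg_cst.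
under eq_fun do rewrite big_cons.
by rewrite big_cons; case: (P i) => //; apply: cvgD.
Qed.

Lemma norm_coord_le n (v : 'rV[R]_n) k : `|v 0 k| <= `|v|.
Proof.
by rewrite [leRHS]/Num.Def.normr /= mx_normrE; exact: (le_bigmax _ _ (0, k)).
Qed.

Lemma norm_rV_le n (v : 'rV[R]_n) (c : R) :
  0 <= c -> (forall k, `|v 0 k| <= c) -> `|v| <= c.
Proof.
move=> c0 vc; rewrite [leLHS]/Num.Def.normr /= mx_normrE bigmax_le // => -[i k] _ /=.
by rewrite ord1.
Qed.

Lemma derive_line n (h : 'rV[R]_n -> R) (e u : 'rV[R]_n) (t : R) :
  derivable h (t *: e + u) e ->
  is_derive t 1 (fun s => h (s *: e + u)) ('D_e h (t *: e + u)).
Proof.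
have E : (fun s : R => s^-1 *: (((fun s => h (s *: e + u)) \o shift t) (s *: 1)
      - h (t *: e + u)))
  = (fun s => s^-1 *: ((h \o shift (t *: e + u)) (s *: e) - h (t *: e + u))).
  apply/funext => s /=; have -> : s *: 1 = s :> R^o by exact: mulr1.
  by rewrite scalerDl addrA.
by move=> d; apply: DeriveDef; rewrite /derivable /derive E.
Qed.

(** The intermediate point is located only by [|s| <= |t|], which lets a single statement serve both
    signs of t. *)
Lemma mvt_dir n (h : 'rV[R]_n -> R) (e u : 'rV[R]_n) (t : R) :
  (forall s, `|s| <= `|t| -> derivable h (s *: e + u) e) ->
  exists2 s, `|s| <= `|t| & h (t *: e + u) - h u = t * 'D_e h (s *: e + u).
Proof.
move=> dh.
have cont (a b : R) : (forall s, s \in `[a, b] -> `|s| <= `|t|) ->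
    {within `[a, b], continuous (fun s => h (s *: e + u))}.
  move=> ab; apply: continuous_in_subspaceT => s /set_mem sab.
  apply: differentiable_continuous; apply/derivable1_diffP.
  by have [] := derive_line _ _ _ _ _ (dh s (ab s sab)).
have [t0|t0] := leP 0 t.
- have sub s : s \in `[0, t] -> `|s| <= `|t|.
    by rewrite in_itv /= => /andP[s0 st]; rewrite !ger0_norm.
  have [] := @MVT_segment R (fun s => h (s *: e + u))
    (fun s => 'D_e h (s *: e + u)) 0 t t0.
  + move=> s st; apply/derive_line/dh/sub.
    by move: st; rewrite !in_itv /= => /andP[/ltW -> /ltW ->].
  + exact: cont.
  + move=> s /sub st; rewrite scale0r add0r subr0 mulrC => eq.
    by exists s.
- have sub s : s \in `[t, 0] -> `|s| <= `|t|.
    by rewrite in_itv /= => /andP[s0 st]; rewrite !ler0_norm ?lerN2 // ltW.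
  have [] := @MVT_segment R (fun s => h (s *: e + u))
    (fun s => 'D_e h (s *: e + u)) t 0 (ltW t0).
  + move=> s st; apply/derive_line/dh/sub.
    by move: st; rewrite !in_itv /= => /andP[/ltW -> /ltW ->].
  + exact: cont.
  + move=> s /sub st; rewrite scale0r add0r sub0r => eq; exists s => //.
    by rewrite -opprB eq mulrN opprK mulrC.
Qed.

Lemma Ck_continuous {n k} {D : set 'rV[R]_n} {h} :
  Ck k D h -> forall u, D u -> {for u, continuous h}.
Proof. by case: k => [|k] []. Qed.

Lemma Ck_derivable {n k} {D : set 'rV[R]_n} {h} :
  Ck k.+1 D h -> forall u a, D u -> derivable h u (delta_mx 0 a).
Proof. by move=> [_ H] u a Du; have [/(_ u Du)] := H a. Qed.

Lemma Ck_D {n k} {D : set 'rV[R]_n} {h} (a : 'I_n) :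
  Ck k.+1 D h -> Ck k D ('D_(delta_mx 0 a) h).
Proof. by move=> [_ H]; have [] := H a. Qed.

Lemma Ck_le {n} {D : set 'rV[R]_n} k {h} : Ck k.+1 D h -> Ck k D h.
Proof.
elim: k h => [h [hc _]|k IH h [hc H]]; first by split.
by split=> // a; have [Ha Hk] := H a; split => //; apply: IH.
Qed.

(* Move from [u] to [u + v] one coordinate at a time. *)
Lemma Ck1_taylor n (D : set 'rV[R]_n) h u : open D -> Ck 1 D h -> D u ->
  forall e, 0 < e -> \forall v \near (0 : 'rV[R]_n),
    `|h (u + v) - h u - \sum_a v 0 a * 'D_(delta_mx 0 a) h u| <= e * `|v|.
Proof.
move=> oD hD Du e e0.
(* The tolerance is shared among the n coordinate moves; the [+ 1] keeps the divisor positive in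
   dimension 0. *)
have n0 : 0 < n%:R + 1 :> R by rewrite ltr_wpDl.
have e1 : 0 < e / (n%:R + 1) by rewrite divr_gt0.
have : \forall w \near u, forall a,
    `|'D_(delta_mx 0 a) h u - 'D_(delta_mx 0 a) h w| < e / (n%:R + 1).
  apply: (@filter_forall _ _ (fun a w => `|'D_(delta_mx 0 a) h u - 'D_(delta_mx 0 a) h w| < e / (n%:R + 1)) (nbhs u) _) => a.
  by have /cvgrPdist_lt := Ck_continuous (Ck_D a hD) _ Du; exact.
have : nbhs u D by exact: open_nbhs_nbhs.
move=> /filterI /[apply].
move=> /nbhs_ballP[r /= r0 Hr]; apply/nbhs_ballP; exists r => //= v.
rewrite -ball_normE /= sub0r normrN => vr.
pose tr (m : nat) : 'rV[R]_n := \row_k (if (k < m)%N then v 0 k else 0).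
have trn : tr n = v by apply/rowP => k; rewrite mxE ltn_ord.
have tr0 : tr 0%N = 0 by apply/rowP => k; rewrite !mxE.
have trS (a : 'I_n) : tr a.+1 = v 0 a *: delta_mx 0 a + tr a.
  apply/rowP => k; rewrite !mxE eqxx /= ltnS leq_eqVlt.
  have [->|ka] := eqVneq k a; first by rewrite eqxx ltnn mulr1 addr0.
  by rewrite -val_eqE /= in ka; rewrite (negPf ka) mulr0 add0r.
have E : h (u + v) - h u =
    \sum_(a < n) (h (u + tr a.+1) - h (u + tr a)).
  have := telescope_sumr (fun m => h (u + tr m)) (leq0n n).
  by rewrite trn tr0 addr0 big_mkord.
rewrite E -sumrB; apply: le_trans (ler_norm_sum _ _ _) _.
apply: le_trans (_ : \sum_(a < n) (e / (n%:R + 1) * `|v|) <= _); last first.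
  rewrite sumr_const card_ord -[leLHS]mulr_natr mulrAC; apply: ler_wpM2r => //.
  by rewrite -mulrA ger_pMr // mulrC ler_pdivrMr // mul1r lerDl.
apply: ler_sum => a _.
have near_pt s : `|s| <= `|v 0 a| ->
    `|s *: delta_mx 0 a + tr a| < r.
  move=> sv; apply: le_lt_trans vr; apply: norm_rV_le => // k.
  rewrite !mxE eqxx /=; have [->|ka] := eqVneq k a.
    by rewrite ltnn mulr1 addr0 (le_trans sv) // norm_coord_le.
  rewrite mulr0 add0r; case: ifP => _; first exact: norm_coord_le.
  by rewrite normr0.
have Hball s : `|s| <= `|v 0 a| ->
    ball u r (s *: delta_mx 0 a + (u + tr a)).
  move=> /near_pt; rewrite -ball_normE /= addrCA opprD addrA subrr sub0r.
  by rewrite normrN.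
rewrite trS addrCA.
have [s sv ->] := @mvt_dir n h (delta_mx 0 a) (u + tr a) (v 0 a)
  (fun s sv => Ck_derivable hD _ _ (Hr _ (Hball s sv)).1).
rewrite -mulrBr normrM mulrC.
apply: ler_pM => //; last exact: norm_coord_le.
by rewrite distrC ltW //; have [_] := Hr _ (Hball s sv); exact.
Qed.

(** [Ck] speaks of partial derivatives only. The Taylor estimate upgrades them to Fréchet
    differentiability, which the chain rule along curves requires. *)
Lemma Ck1_differentiable n (D : set 'rV[R]_n) h u : open D -> Ck 1 D h ->
  D u -> differentiable h u /\
    forall v, 'd h u v = \sum_a v 0 a * 'D_(delta_mx 0 a) h u.
Proof.
move=> oD hD Du.
pose g (v : 'rV[R]_n) := v *m \col_a 'D_(delta_mx 0 a) h u.
pose l (v : 'rV[R]_n) : R := g v 0 0.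
have lE v : l v = \sum_a v 0 a * 'D_(delta_mx 0 a) h u.
  by rewrite /l mxE; apply: eq_bigr => a _; rewrite mxE.
have llin : linear l.
  by move=> c v w; rewrite /l /g mulmxDl -scalemxAl !mxE.
pose L := GRing.isLinear.Build _ _ _ _ l llin.
pose L' : {linear 'rV[R]_n -> R} := HB.pack l L.
have lc : continuous L'.
  move=> v; have -> : L' = (fun v : 'rV[R]_n =>
      \sum_a v 0 a * 'D_(delta_mx 0 a) h u) :> ('rV[R]_n -> R) by exact/funext.
  apply: (@cvg_bigsum _ (nbhs v) _) => a.
  by apply: cvgM; [exact: coord_continuous|exact: cvg_cst].
have Ho : h \o shift u = cst (h u) + L' +o_ (0 : 'rV[R]_n) id.
  apply/eqaddoP => e e0; have := Ck1_taylor _ _ _ _ oD hD Du _ e0.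
  apply: filterS => v; rewrite -lE /=; move=> H.
  by rewrite !fctE /= opprD addrA [v + u]addrC.
have dE := diff_unique lc Ho.
split; last by move=> v; rewrite dE /= lE.
by apply/diff_locallyP; rewrite dE.
Qed.

Lemma chain_curve n (D : set 'rV[R]_n) h (c : R -> 'rV[R]_n) (dc : 'I_n -> R)
    (t : R) : open D -> Ck 1 D h -> D (c t) ->
  (forall k, is_derive t 1 (fun s => c s 0 k) (dc k)) ->
  is_derive t 1 (h \o c) (\sum_a dc a * 'D_(delta_mx 0 a) h (c t)).
Proof.
move=> oD hD Dc dcP.
have [dh dhE] := Ck1_differentiable _ _ _ _ oD hD Dc.
have cd : derivable c t 1.
  by apply/derivable_mxP => i k; rewrite ord1; have [] := dcP k.
have dfc : differentiable c t by apply/derivable1_diffP.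
have dfhc : differentiable (h \o c) t by exact: differentiable_comp.
apply: DeriveDef; first exact/derivable1_diffP.
rewrite deriveE // diff_comp //= dhE -deriveE // derive_mx //.
by apply: eq_bigr => a _; rewrite mxE; have [_ ->] := dcP a.
Qed.

Lemma derive_shift_add n (h : 'rV[R]_n -> R) (e b u : 'rV[R]_n) :
  derivable h (b + u) e -> is_derive u e (fun w => h (b + w)) ('D_e h (b + u)).
Proof.
have E : (fun s : R => s^-1 *: (((fun w => h (b + w)) \o shift u) (s *: e)
      - h (b + u))) =
  (fun s => s^-1 *: ((h \o shift (b + u)) (s *: e) - h (b + u))).
  by apply/funext => s /=; rewrite addrCA.
by move=> d; apply: DeriveDef; rewrite /derivable /derive E.
Qed.

(** The mean value theorem is applied in direction a to the increment [phi] in direction b, then in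
    direction b to the partial derivative found. The left-hand side is symmetric in a and b, which
    is what [schwarz] exploits. *)
Lemma second_difference n (D : set 'rV[R]_n) h (u : 'rV[R]_n) a b (t : R) :
  Ck 2 D h ->
  (forall s s', `|s| <= `|t| -> `|s'| <= `|t| ->
     D (s' *: delta_mx 0 b + (s *: delta_mx 0 a + u))) ->
  exists s s', [/\ `|s| <= `|t|, `|s'| <= `|t| &
    h (t *: delta_mx 0 b + (t *: delta_mx 0 a + u)) - h (t *: delta_mx 0 a + u)
    - (h (t *: delta_mx 0 b + u) - h u) =
    t * (t * 'D_(delta_mx 0 b) ('D_(delta_mx 0 a) h)
               (s' *: delta_mx 0 b + (s *: delta_mx 0 a + u)))].
Proof.
move=> hD Dbox.
set ea : 'rV[R]_n := delta_mx 0 a; set eb : 'rV[R]_n := delta_mx 0 b.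
pose phi w := h (t *: eb + w) - h w.
have D0 s : `|s| <= `|t| -> D (s *: ea + u).
  by move=> st; have := Dbox s 0 st; rewrite normr0 scale0r add0r; apply.
have dphi s : `|s| <= `|t| -> is_derive (s *: ea + u) ea phi
    ('D_ea h (t *: eb + (s *: ea + u)) - 'D_ea h (s *: ea + u)).
  move=> st; apply: is_deriveB.
    by apply: derive_shift_add; apply: (Ck_derivable hD); exact: Dbox.
  by apply: derivableP; apply: (Ck_derivable hD); exact: D0.
have [s st sE] := @mvt_dir n phi ea u t (fun s st => (dphi s st).(ex_derive)).
have [_ dphiE] := dphi s st.
rewrite dphiE in sE.
have [|s' st' s'E] := @mvt_dir n ('D_ea h) eb (s *: ea + u) t.
  by move=> s' st'; apply: (Ck_derivable (Ck_D a hD)); exact: Dbox.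
by exists s, s'; split => //; rewrite -s'E -sE.
Qed.

(** Taking the increments in either order evaluates the two mixed derivatives at two points near u
    from the same second difference; continuity of both at u closes the gap. *)
Lemma schwarz n (D : set 'rV[R]_n) h (u : 'rV[R]_n) a b :
  open D -> Ck 2 D h -> D u ->
  'D_(delta_mx 0 a) ('D_(delta_mx 0 b) h) u =
  'D_(delta_mx 0 b) ('D_(delta_mx 0 a) h) u.
Proof.
move=> oD hD Du.
set ea : 'rV[R]_n := delta_mx 0 a; set eb : 'rV[R]_n := delta_mx 0 b.
apply/eqP; rewrite -subr_eq0 -normr_le0; apply/ler_addgt0Pl => e e0.
rewrite addr0.
have e2 : 0 < e / 2 by rewrite divr_gt0.
have nD : nbhs u D by exact: open_nbhs_nbhs.
have /cvgrPdist_lt/(_ _ e2) n1 := Ck_continuous (Ck_D a (Ck_D b hD)) _ Du.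
have /cvgrPdist_lt/(_ _ e2) n2 := Ck_continuous (Ck_D b (Ck_D a hD)) _ Du.
have : nbhs u [set w | D w /\
    (`|'D_ea ('D_eb h) u - 'D_ea ('D_eb h) w| < e / 2 /\
     `|'D_eb ('D_ea h) u - 'D_eb ('D_ea h) w| < e / 2)].
  exact: (filterI nD (filterI n1 n2)).
move=> /nbhs_ballP[r /= r0 Hr].
pose t := r / 3.
have t0 : 0 < t by rewrite divr_gt0.
have box s s' a' b' : `|s| <= `|t| -> `|s'| <= `|t| ->
    ball u r (s' *: delta_mx 0 b' + (s *: delta_mx 0 a' + u)).
  move=> st st'; rewrite -ball_normE /= addrA [_ + u]addrC opprD addrA subrr.
  rewrite sub0r normrN.
  have nd c : `|delta_mx 0 c : 'rV[R]_n| <= 1.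
    apply: norm_rV_le => // k; rewrite mxE eqxx /=.
    by case: (k == c); rewrite ?normr1 ?normr0.
  apply: le_lt_trans (ler_normD _ _) _; rewrite !normrZ.
  have : `|s'| * `|delta_mx 0 b' : 'rV[R]_n| <= t.
    by rewrite -[leRHS]mulr1 ler_pM // (le_trans st') // gtr0_norm.
  have : `|s| * `|delta_mx 0 a' : 'rV[R]_n| <= t.
    by rewrite -[leRHS]mulr1 ler_pM // (le_trans st) // gtr0_norm.
  by rewrite /t in t0 *; lra.
have [s1 [s1' [h1 h1' E1]]] := @second_difference _ _ h u a b t hD
  (fun s s' st st' => (Hr _ (box s s' a b st st')).1).
have [s2 [s2' [h2 h2' E2]]] := @second_difference _ _ h u b a t hD
  (fun s s' st st' => (Hr _ (box s s' b a st st')).1).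
have alg (x y z w : R) : x - y - (z - w) = x - z - (y - w) by ring.
move: E1; rewrite alg [X in h X - _]addrCA => E1; move: (etrans (esym E1) E2).
have tn0 : t != 0 by rewrite gt_eqF.
move=> /(mulfI tn0)/(mulfI tn0) E.
have [_ [_ B1]] := Hr _ (box _ _ a b h1 h1').
have [_ [B2 _]] := Hr _ (box _ _ b a h2 h2').
rewrite /= -/ea -/eb in B1 B2; rewrite E in B1.
apply: le_trans (ler_distD ('D_ea ('D_eb h) (s2' *: ea + (s2 *: eb + u))) _ _) _.
rewrite [leRHS]splitr; apply: lerD; first exact: (ltW B2).
by rewrite distrC; exact: (ltW B1).
Qed.

(** [iota] carries coordinate lines to coordinate lines at the same speed, so difference quotients
    are literally equal. It is meant for [row_mx xi _] and [row_mx _ eta], the slices of a product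
    chart. *)
Lemma Ck_pull n N (sigma : 'I_n -> 'I_N) (iota : 'rV[R]_n -> 'rV[R]_N) :
  continuous iota ->
  (forall s a u, iota (s *: delta_mx 0 a + u) =
     s *: delta_mx 0 (sigma a) + iota u) ->
  forall k D h, Ck k D h -> Ck k (iota @^-1` D) (h \o iota).
Proof.
move=> ci iE; elim=> [|k IH] D h [hc hd].
  split => // u Du; apply: continuous_comp; [exact: ci|exact: hc].
split; first by move=> u Du; apply: continuous_comp; [exact: ci|exact: hc].
move=> a; have [hda hDa] := hd (sigma a).
have E u : (fun s : R => s^-1 *: (((h \o iota) \o shift u) (s *: delta_mx 0 a)
      - (h \o iota) u)) =
  (fun s => s^-1 *: ((h \o shift (iota u)) (s *: delta_mx 0 (sigma a)) - h (iota u))).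
  by apply/funext => s /=; rewrite iE.
split; first by move=> u Du; rewrite /derivable E; exact: hda.
have -> : 'D_(delta_mx 0 a) (h \o iota) = 'D_(delta_mx 0 (sigma a)) h \o iota.
  by apply/funext => u; rewrite /derive E.
exact: IH.
Qed.

Lemma derive_pull n N (sigma : 'I_n -> 'I_N) (iota : 'rV[R]_n -> 'rV[R]_N) a h :
  (forall s u, iota (s *: delta_mx 0 a + u) =
     s *: delta_mx 0 (sigma a) + iota u) ->
  'D_(delta_mx 0 a) (h \o iota) = 'D_(delta_mx 0 (sigma a)) h \o iota :> (_ -> R).
Proof.
move=> iE; apply/funext => u.
have E : (fun s : R => s^-1 *: (((h \o iota) \o shift u) (s *: delta_mx 0 a)
      - (h \o iota) u)) =
  (fun s => s^-1 *: ((h \o shift (iota u)) (s *: delta_mx 0 (sigma a)) - h (iota u))).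
  by apply/funext => s /=; rewrite iE.
by rewrite /derive E.
Qed.

End Calculus.

(** * Charts, velocities and parallel fields *)

Section ManifoldAxioms.
Context {R : realType}.
Variable M : riemannian_manifold R.
Implicit Types (p q : M) (i j : atlas M).

Lemma carrier_hausdorff : hausdorff_space M.
Proof. by case: M. Qed.

Lemma chart_at_dom p : chart_dom (chart_at p) p.
Proof. by case: M p. Qed.

Lemma chart_dom_open i : open (chart_dom i).
Proof. by case: M i. Qed.

Lemma chart_image_open i : open (chart i @` chart_dom i).
Proof. by case: M i. Qed.

Lemma chartK i p : chart_dom i p -> chart_inv i (chart i p) = p.
Proof. by case: M i p. Qed.

Lemma chart_continuous i p : chart_dom i p -> {for p, continuous (chart i)}.
Proof. by case: M i p. Qed.

Lemma chart_inv_continuous i u : (chart i @` chart_dom i) u ->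
  {for u, continuous (chart_inv i)}.
Proof. by case: M i u. Qed.

Lemma transition_smooth i j k :
  smooth (chart i @` (chart_dom i `&` chart_dom j))
         (fun u => chart j (chart_inv i u) 0 k).
Proof. by case: M i j k. Qed.

Lemma gmx_sym i p : chart_dom i p -> (gmx i p)^T = gmx i p.
Proof. by case: M i p. Qed.

Lemma gmx_gt0 i p (v : 'rV[R]_(Defs.dim M)) : chart_dom i p -> v != 0 ->
  0 < (v *m gmx i p *m v^T) 0 0.
Proof. by case: M i p v. Qed.

Lemma gmx_smooth i k l :
  smooth (chart i @` chart_dom i) (fun u => gmx i (chart_inv i u) k l).
Proof. by case: M i k l. Qed.

Lemma gmx_change i j p : chart_dom i p -> chart_dom j p ->
  gmx i p = jac i j p *m gmx j p *m (jac i j p)^T.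
Proof. by case: M i j p. Qed.

End ManifoldAxioms.

Section Charts.
Context {R : realType} {M : riemannian_manifold R}.
Implicit Types (p q : M) (i j : atlas M) (gamma : R -> M).

Lemma chart_invP i u : (chart i @` chart_dom i) u ->
  chart_dom i (chart_inv i u) /\ chart i (chart_inv i u) = u.
Proof. by move=> [p ip <-]; rewrite chartK. Qed.

Lemma chart_image i p : chart_dom i p -> (chart i @` chart_dom i) (chart i p).
Proof. by move=> ip; exists p. Qed.

Lemma chart_image_nbhs i p : chart_dom i p ->
  nbhs (chart i p) (chart i @` chart_dom i).
Proof.
move=> ip; apply: open_nbhs_nbhs; split; first exact: chart_image_open.
exact: chart_image.
Qed.

Lemma chart_image_openI i (A : set M) : open A ->
  open (chart i @` (chart_dom i `&` A)).
Proof.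
move=> oA; rewrite openE => u [p [ip Ap] <-].
have Eu := chart_image _ _ ip.
have n1 := chart_image_nbhs _ _ ip.
have n2 : nbhs (chart i p) (chart_inv i @^-1` A).
  apply: (chart_inv_continuous _ _ _ Eu); rewrite chartK //.
  exact: open_nbhs_nbhs.
apply: filterS2 n1 n2 => w [q iq <-] /=; rewrite chartK // => Aq.
by exists q.
Qed.

(** Unlike [velocity], which reads each point in its own chosen chart, the chart here stays fixed,
    so that the components can be differentiated in t. *)
Definition vel i gamma (t : R) : 'rV[R]_(Defs.dim M) :=
  \row_k derive1 (Defs.coord i gamma k) t.

(** The regularity common to C^1 curves and geodesics, enough for the chain rule in charts. *)
Definition dcurve gamma : Prop := continuous gamma /\
  forall i k t, chart_dom i (gamma t) -> derivable (Defs.coord i gamma k) t 1.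

Lemma C1_dcurve gamma : C1_curve gamma -> dcurve gamma.
Proof. by move=> [gc gd]; split=> // i k t /(gd i k)[]. Qed.

Lemma geodesic_dcurve gamma : geodesic gamma -> dcurve gamma.
Proof. by move=> [gc gd]; split=> // i k t /(gd i k)[]. Qed.

Lemma geodesic_C1 gamma : geodesic gamma -> C1_curve gamma.
Proof.
move=> [gc gd]; split; first exact: gc.
move=> i k t /(gd i k)[d1 d2 _]; split; first exact: d1.
by apply: differentiable_continuous; apply/derivable1_diffP; exact: d2.
Qed.

Lemma near_dom gamma i t : continuous gamma -> chart_dom i (gamma t) ->
  \forall s \near t, chart_dom i (gamma s).
Proof.
move=> gc it; apply: gc; apply: open_nbhs_nbhs; split => //.
exact: chart_dom_open.
Qed.

Lemma derive_comp_curve gamma i t (D : set 'rV[R]_(Defs.dim M)) (h : M -> R) :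
  dcurve gamma -> chart_dom i (gamma t) -> open D -> D (chart i (gamma t)) ->
  Ck 1 D (h \o chart_inv i) ->
  is_derive t 1 (h \o gamma) (\sum_a vel i gamma t 0 a * pd i a h (gamma t)).
Proof.
move=> [gc gd] it oD Dt hD.
have := @chain_curve _ _ D (h \o chart_inv i) (fun s => chart i (gamma s))
  (fun a => vel i gamma t 0 a) t oD hD Dt.
case.
  by move=> k; rewrite mxE derive1E; apply: derivableP; exact: gd.
move=> d1 d2; rewrite -d2; apply: near_eq_is_derive (derivableP d1).
by apply: filterS (near_dom _ _ _ gc it) => s /= /chartK ->.
Qed.

Lemma vel_change gamma i j t : dcurve gamma -> chart_dom i (gamma t) ->
  chart_dom j (gamma t) -> vel j gamma t = vel i gamma t *m jac i j (gamma t).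
Proof.
move=> dg it jt; apply/rowP => k; rewrite !mxE derive1E.
have Dt : (chart i @` (chart_dom i `&` chart_dom j)) (chart i (gamma t)).
  by exists (gamma t).
have [_ E] := @derive_comp_curve gamma i t _ (fun q => chart j q 0 k) dg it
  (chart_image_openI i _ (chart_dom_open _ j)) Dt (transition_smooth _ i j k 1%N).
rewrite [LHS]E; apply: eq_bigr => a _; rewrite [vel _ _ _]lock !mxE -lock.
by rewrite /vel mxE.
Qed.

(** The inner product in an arbitrary chart, the companion of [vel]: its coefficients vary smoothly
    with p as long as i is kept. *)
Definition inn i p (v w : 'rV[R]_(Defs.dim M)) : R := (v *m gmx i p *m w^T) 0 0.

Lemma innE i p v w : inn i p v w = \sum_a \sum_b v 0 a * gmx i p a b * w 0 b.
Proof.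
rewrite /inn mxE exchange_big /=; apply: eq_bigr => b _.
by rewrite !mxE mulr_suml.
Qed.

Lemma inn_change i j p v w : chart_dom i p -> chart_dom j p ->
  inn i p v w = inn j p (v *m jac i j p) (w *m jac i j p).
Proof. by move=> ip jp; rewrite /inn (gmx_change _ _ _ _ ip jp) trmx_mul !mulmxA. Qed.

Lemma inn_sym i p v w : chart_dom i p -> inn i p v w = inn i p w v.
Proof.
move=> ip; have -> : inn i p v w = (v *m gmx i p *m w^T)^T 0 0 by rewrite mxE.
by rewrite !trmx_mul trmxK gmx_sym // mulmxA.
Qed.

Lemma inner_velocity gamma i t : dcurve gamma -> chart_dom i (gamma t) ->
  inner (velocity gamma t) (velocity gamma t) =
  inn i (gamma t) (vel i gamma t) (vel i gamma t).
Proof.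
move=> dg it; rewrite (inn_change _ _ _ _ _ it (chart_at_dom _ (gamma t))).
by rewrite -vel_change //; exact: chart_at_dom.
Qed.

Lemma gmx_unit i p : chart_dom i p -> gmx i p \in unitmx.
Proof.
move=> ip; rewrite -row_free_unit -kermx_eq0; apply/eqP/row_matrixP => k.
rewrite row0; apply/eqP; apply/negPn/negP => vn0.
have := gmx_gt0 _ _ _ _ ip vn0.
have : (row k (kermx (gmx i p)) *m gmx i p) = 0 by rewrite -row_mul mulmx_ker row0.
by move=> ->; rewrite mul0mx mxE ltxx.
Qed.

(** Lowering the upper index cancels the inverse Gram matrix and leaves the Christoffel symbols of
    the first kind, which are linear in the derivatives of the metric. *)
Lemma christoffel_lower i p a b l : chart_dom i p ->
  \sum_k christoffel i p k a b * gmx i p k l =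
  2^-1 * (pd i a (fun q => gmx i q b l) p + pd i b (fun q => gmx i q a l) p
          - pd i l (fun q => gmx i q a b) p).
Proof.
move=> ip.
pose X m := pd i a (fun q => gmx i q b m) p + pd i b (fun q => gmx i q a m) p
          - pd i m (fun q => gmx i q a b) p.
transitivity (\sum_m 2^-1 * ((l == m)%:R * X m)); last first.
  rewrite (bigD1 l) //= eqxx mul1r big1 ?addr0 // => m ml.
  by rewrite eq_sym (negPf ml) mul0r mulr0.
have inv m : (l == m)%:R = \sum_k invmx (gmx i p) k m * gmx i p k l.
  have /matrixP/(_ l m) := mulmxV (gmx_unit _ _ ip).
  rewrite !mxE => <-; apply: eq_bigr => k _.
  rewrite mulrC; congr (_ * _).
  by rewrite -[in LHS](gmx_sym _ _ _ ip) mxE.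
under [RHS]eq_bigr do rewrite inv mulr_suml mulr_sumr.
rewrite exchange_big /=; apply: eq_bigr => k _.
rewrite /christoffel mulr_sumr mulr_suml; apply: eq_bigr => m _.
rewrite -/(X m); ring.
Qed.

Lemma is_derive_bigsum n (f : 'I_n -> R -> R) (df : 'I_n -> R) (t : R) :
  (forall a, is_derive t 1 (f a) (df a)) ->
  is_derive t 1 (fun s => \sum_a f a s) (\sum_a df a).
Proof.
move=> h; have -> : (fun s => \sum_a f a s) = \sum_a f a.
  by apply/funext => s; rewrite fct_sumE.
exact: is_derive_sum.
Qed.

Lemma derive_gmx gamma i t a b : dcurve gamma -> chart_dom i (gamma t) ->
  is_derive t 1 (fun s => gmx i (gamma s) a b)
    (\sum_c vel i gamma t 0 c * pd i c (fun q => gmx i q a b) (gamma t)).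
Proof.
move=> dg it; apply: (@derive_comp_curve gamma i t _ (fun q => gmx i q a b) dg it
  (chart_image_open _ i) _ (gmx_smooth _ i a b 1%N)).
exact: chart_image.
Qed.

Lemma pd_gmx_sym i p a b c : chart_dom i p ->
  pd i c (fun q => gmx i q a b) p = pd i c (fun q => gmx i q b a) p.
Proof.
move=> ip; apply: near_eq_derive.
apply: filterS (chart_image_nbhs _ _ ip) => w /chart_invP[iw _] /=.
by rewrite -[in LHS](gmx_sym _ _ _ iw) mxE.
Qed.

End Charts.

Section Parallel.
Context {R : realType} {M : riemannian_manifold R}.
Implicit Types (p q : M) (i j : atlas M) (gamma : R -> M).

Lemma vel_coord i gamma t k : vel i gamma t 0 k = derive1 (Defs.coord i gamma k) t.
Proof. by rewrite mxE. Qed.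

(** With [N] the Christoffel symbols of the first kind, the derivative of the Gram matrix in
    direction c is [N c a b + N c b a]; these two summands cancel the contributions of the
    derivatives of W1 and W2. The parallel equation is required only at the time t considered. *)
Lemma metric_compatible gamma i t (W1 W2 : R -> 'rV[R]_(Defs.dim M)) :
  dcurve gamma -> chart_dom i (gamma t) ->
  (forall k, is_derive t 1 (fun s => W1 s 0 k)
     (- \sum_a \sum_b christoffel i (gamma t) k a b * vel i gamma t 0 a * W1 t 0 b)) ->
  (forall k, is_derive t 1 (fun s => W2 s 0 k)
     (- \sum_a \sum_b christoffel i (gamma t) k a b * vel i gamma t 0 a * W2 t 0 b)) ->
  is_derive t 1 (fun s => inn i (gamma s) (W1 s) (W2 s)) 0.
Proof.
move=> dg it d1 d2.
have -> : (fun s => inn i (gamma s) (W1 s) (W2 s)) =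
  (fun s => \sum_a \sum_b (W1 s 0 a * gmx i (gamma s) a b) * W2 s 0 b).
  by apply/funext => s; rewrite innE.
move: d1 d2; set p := gamma t; set v := vel i gamma t => d1 d2.
pose N (c d l : 'I_(Defs.dim M)) := 2^-1 * (pd i c (fun q => gmx i q d l) p +
  pd i d (fun q => gmx i q c l) p - pd i l (fun q => gmx i q c d) p).
pose dW (W : R -> 'rV[R]_(Defs.dim M)) k :=
  - \sum_a \sum_b christoffel i p k a b * v 0 a * W t 0 b.
pose dG a b := \sum_c v 0 c * pd i c (fun q => gmx i q a b) p.
have lowerW W l : \sum_a dW W a * gmx i p a l =
    - \sum_c \sum_d v 0 c * W t 0 d * N c d l.
  under eq_bigr do rewrite /dW mulNr mulr_suml.
  rewrite sumrN exchange_big /=; congr (- _); apply: eq_bigr => c _.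
  under eq_bigr do rewrite mulr_suml.
  rewrite exchange_big /=; apply: eq_bigr => d _.
  rewrite /N -christoffel_lower // mulr_sumr; apply: eq_bigr => k _.
  move: (christoffel _ _ _ _ _) (gmx _ _ _ _) (v 0 c) (W t 0 d) => x y z w.
  ring.
have T1 : \sum_a \sum_b dW W1 a * gmx i p a b * W2 t 0 b =
    - \sum_a \sum_b \sum_c W1 t 0 a * W2 t 0 b * v 0 c * N c a b.
  rewrite exchange_big /=.
  under eq_bigr => b _ do rewrite -mulr_suml lowerW mulNr mulr_suml.
  rewrite sumrN; congr (- _).
  transitivity (\sum_b \sum_c \sum_a W1 t 0 a * W2 t 0 b * v 0 c * N c a b).
    apply: eq_bigr => b _; apply: eq_bigr => c _; rewrite mulr_suml.
    apply: eq_bigr => a _; move: (N c a b) (W1 t 0 a) (W2 t 0 b) (v 0 c) => x y z w.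
    ring.
  transitivity (\sum_b \sum_a \sum_c W1 t 0 a * W2 t 0 b * v 0 c * N c a b).
    by apply: eq_bigr => b _; exact: exchange_big.
  exact: exchange_big.
have T2 : \sum_a \sum_b W1 t 0 a * gmx i p a b * dW W2 b =
    - \sum_a \sum_b \sum_c W1 t 0 a * W2 t 0 b * v 0 c * N c b a.
  rewrite -sumrN; apply: eq_bigr => a _.
  rewrite (eq_bigr (fun b => W1 t 0 a * (dW W2 b * gmx i p b a))); last first.
    move=> b _; have -> : gmx i p a b = gmx i p b a.
      by rewrite -[in LHS](gmx_sym _ _ _ it) mxE.
    by rewrite -mulrA; congr (_ * _); rewrite mulrC.
  rewrite -mulr_sumr lowerW mulrN mulr_sumr; congr (- _).
  under eq_bigr do rewrite mulr_sumr.
  rewrite exchange_big /=; apply: eq_bigr => b _.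
  apply: eq_bigr => c _; move: (N c b a) (W1 t 0 a) (W2 t 0 b) (v 0 c) => x y z w.
  ring.
have T3 : \sum_a \sum_b W1 t 0 a * dG a b * W2 t 0 b =
    \sum_a \sum_b \sum_c W1 t 0 a * W2 t 0 b * v 0 c * (N c a b + N c b a).
  apply: eq_bigr => a _; apply: eq_bigr => b _; rewrite /dG mulr_sumr mulr_suml.
  apply: eq_bigr => c _; rewrite /N (pd_gmx_sym i p b a c it).
  move: (W1 t 0 a) (W2 t 0 b) (v 0 c) (pd _ _ _ _) (pd _ _ _ _) (pd _ _ _ _).
  by move=> x y z X Y Z; field.
have E : \sum_a \sum_b ((W1 t 0 a * dG a b + dW W1 a * gmx i p a b) * W2 t 0 b
    + W1 t 0 a * gmx i p a b * dW W2 b) = 0.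
  under eq_bigr => a _ do under eq_bigr => b _ do rewrite mulrDl.
  under eq_bigr => a _ do rewrite !big_split /=.
  rewrite !big_split /= T1 T2 T3.
  rewrite -!sumrN -!big_split /=; apply: big1 => a _.
  rewrite -!sumrN -!big_split /=; apply: big1 => b _.
  rewrite -!sumrN -!big_split /=; apply: big1 => c _.
  move: (N c a b) (N c b a) (W1 t 0 a) (W2 t 0 b) (v 0 c) => x y z w u; ring.
apply: is_derive_eq E.
apply: is_derive_bigsum => a; apply: is_derive_bigsum => b.
have dGab := derive_gmx gamma i t a b dg it.
have dWG : is_derive t 1 (fun s => W1 s 0 a * gmx i (gamma s) a b) _ :=
  is_deriveM (d1 a) dGab.
have := is_deriveM dWG (d2 b).
move/is_derive_eq; apply.
rewrite -/p -/(dW W1 a) -/(dW W2 b) -/(dG a b) /GRing.scale /=.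
move: (dW W1 a) (dW W2 b) (dG a b) (W1 t 0 a) (W2 t 0 b) (gmx _ _ _ _).
move=> x y z u v' w. ring.
Qed.

Lemma vel_parallel gamma i k t : geodesic gamma -> chart_dom i (gamma t) ->
  is_derive t 1 (fun s => vel i gamma s 0 k)
    (- \sum_a \sum_b christoffel i (gamma t) k a b * vel i gamma t 0 a
                      * vel i gamma t 0 b).
Proof.
move=> [gc gd] it; have [d1 d2 d3] := gd i k t it.
have -> : (fun s => vel i gamma s 0 k) = derive1 (Defs.coord i gamma k).
  by apply/funext => s; rewrite mxE.
apply: DeriveDef => //; rewrite -derive1E; apply/eqP; rewrite -addr_eq0; apply/eqP.
rewrite -[RHS]d3; congr (_ + _); apply: eq_bigr => a _; apply: eq_bigr => b _.
by rewrite !mxE.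
Qed.

Lemma velocity_parallel gamma : geodesic gamma -> parallel_along (velocity gamma).
Proof.
move=> gg; have dg := geodesic_dcurve _ gg; have [gc gd] := gg.
move=> i k t it.
pose W i b := fun t => (velocity gamma t *m jac (chart_at (gamma t)) i (gamma t)) 0 b.
have WE s : chart_dom i (gamma s) -> W i k s = vel i gamma s 0 k.
  move=> si; rewrite /W.
  by rewrite (vel_change gamma (chart_at (gamma s)) i s dg (chart_at_dom _ _) si).
have near_eq : \forall s \near t, vel i gamma s 0 k = W i k s.
  by apply: filterS (near_dom _ _ _ gc it) => s /WE.
have [dW dWE] := near_eq_is_derive near_eq (vel_parallel gamma i k t gg it).
split; first exact: dW.
rewrite derive1E [X in X + _]dWE addrC; apply/eqP; rewrite subr_eq0; apply/eqP.
apply: eq_bigr => a _; apply: eq_bigr => b _.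
rewrite -(vel_change gamma (chart_at (gamma t)) i t dg (chart_at_dom _ _) it).
by rewrite !mxE.
Qed.

(** The geodesic equation says that the velocity is parallel, so metric compatibility applies to the
    velocity paired with itself. *)
Lemma speed_const gamma t : geodesic gamma ->
  inner (velocity gamma t) (velocity gamma t) =
  inner (velocity gamma 0) (velocity gamma 0).
Proof.
move=> gg; have dg := geodesic_dcurve _ gg; have [gc gd] := gg.
apply: (@is_derive_0_is_cst R
  (fun s => inner (velocity gamma s) (velocity gamma s))) => s.
have si := chart_at_dom M (gamma s); set i := chart_at (gamma s) in si.
apply: near_eq_is_derive (metric_compatible gamma i s (vel i gamma) (vel i gamma)
  dg si (fun k => vel_parallel gamma i k s gg si)
  (fun k => vel_parallel gamma i k s gg si)).
by apply: filterS (near_dom _ _ _ gc si) => r ri; rewrite (inner_velocity _ i).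
Qed.

(** The local model [psi] may change with t and has to agree with [phi] only inside the segment.
    This suits a function computed in varying charts from curves compared only on [0, 1]. *)
Lemma continuous_within_local (a b : R) (phi : R -> R) :
  (forall t : R, a <= t <= b -> exists psi : R -> R, [/\ phi t = psi t,
     {for t, continuous psi} &
     \forall s \near t, a <= s <= b -> phi s = psi s]) ->
  {within `[a, b], continuous phi}.
Proof.
move=> h; apply/subspace_continuousP => t; rewrite /= in_itv /= => tab.
have [psi [E psic nps]] := h t tab.
have {}psic : psi s @[s --> t] --> phi t by rewrite E; exact: psic.
have H : psi x @[x --> within [set` `[a, b]] (nbhs t)] --> phi t.
  exact: cvg_within_filter.
rewrite /from_subspace; apply: cvg_trans H.
apply: near_eq_cvg; rewrite near_withinE.
by apply: filterS nps => s nps'; rewrite /= in_itv /= => /nps'.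
Qed.

(* The two curves need only agree on [0, 1]: the geodesics witnessing two parallel
   transports are not known to coincide elsewhere. *)
Lemma parallel_inner gamma1 gamma2 (V1 : forall t, tangent (gamma1 t))
    (V2 : forall t, tangent (gamma2 t)) :
  dcurve gamma1 -> dcurve gamma2 ->
  (forall t : R, 0 <= t <= 1 -> gamma1 t = gamma2 t) ->
  parallel_along V1 -> parallel_along V2 ->
  inner (V1 1) (V2 1 : tangent (gamma1 1)) =
  inner (V1 0) (V2 0 : tangent (gamma1 0)).
Proof.
move=> dg1 dg2 g12 p1 p2; have [gc1 gd1] := dg1; have [gc2 gd2] := dg2.
pose W (gamma : R -> M) (V : forall t, tangent (gamma t)) i (t : R) :=
  V t *m jac (chart_at (gamma t)) i (gamma t).
pose psi i t := inn i (gamma1 t) (W _ V1 i t) (W _ V2 i t).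
pose phi t := inner (V1 t) (V2 t : tangent (gamma1 t)).
have phiE i (t : R) : 0 <= t <= 1 -> chart_dom i (gamma1 t) -> phi t = psi i t.
  move=> t01 it; rewrite /phi /psi /W -(g12 t t01).
  by rewrite -(inn_change _ _ _ _ _ (chart_at_dom _ (gamma1 t)) it).
have psi_derivable i t : chart_dom i (gamma1 t) -> chart_dom i (gamma2 t) ->
    derivable (psi i) t 1.
  move=> it1 it2; have -> : psi i = (fun s => \sum_a \sum_b
      (W _ V1 i s 0 a * gmx i (gamma1 s) a b) * W _ V2 i s 0 b).
    by apply/funext => s; rewrite /psi innE.
  have d1 a : derivable (fun s => W _ V1 i s 0 a) t 1 by have [] := p1 i a t it1.
  have d2 b : derivable (fun s => W _ V2 i s 0 b) t 1 by have [] := p2 i b t it2.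
  have dG a b := derive_gmx gamma1 i t a b dg1 it1.
  apply: ex_derive; apply: is_derive_bigsum => a; apply: is_derive_bigsum => b.
  apply: derivableP.
  apply: (@derivableM _ _ (fun s => W _ V1 i s 0 a * gmx i (gamma1 s) a b)) => //.
  by apply: (@derivableM _ _ (fun s => W _ V1 i s 0 a)) => //; have [] := dG a b.
have phi_derive (t : R) : 0 < t < 1 -> is_derive t 1 phi 0.
  move=> /andP[t0 t1]; have t01 : 0 <= t <= 1 by rewrite !ltW.
  have it := chart_at_dom M (gamma1 t); set i := chart_at (gamma1 t) in it.
  have it2 : chart_dom i (gamma2 t) by rewrite -g12.
  have nb : \forall s \near t, 0 <= s <= 1.
    have n0 : \forall s \near t, 0 < s by exact: lt_nbhsr.
    have n1 : \forall s \near t, s < 1 by exact: lt_nbhsl.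
    by apply: filterS2 n0 n1 => s /ltW -> /ltW ->.
  (* At an interior time the curves agree on a two-sided neighbourhood, hence have the same
     derivative. Nothing of the kind is available at 0 and 1, where continuity of [phi] takes
     over. *)
  have velE : vel i gamma2 t = vel i gamma1 t.
    apply/rowP => k; rewrite !mxE !derive1E; apply: near_eq_derive.
    by apply: filterS nb => s /g12 E; rewrite /Defs.coord E.
  apply: near_eq_is_derive (metric_compatible gamma1 i t (W _ V1 i) (W _ V2 i)
    dg1 it _ _).
  - apply: filterS2 nb (near_dom _ _ _ gc1 it) => s s01 si.
    exact/esym/phiE.
  - move=> k; have [dW E] := p1 i k t it; apply: DeriveDef; first exact: dW.
    rewrite -derive1E; apply/eqP; rewrite -addr_eq0; apply/eqP.
    rewrite -[RHS]E; congr (_ + _); apply: eq_bigr => a _; apply: eq_bigr => b _.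
    by rewrite mxE.
  - move=> k; have [dW E] := p2 i k t it2; apply: DeriveDef; first exact: dW.
    rewrite -derive1E; apply/eqP; rewrite -addr_eq0; apply/eqP.
    rewrite -[RHS]E; congr (_ + _); apply: eq_bigr => a _; apply: eq_bigr => b _.
    by rewrite -velE vel_coord /W -(g12 t t01).
have phi_cont : {within `[0, 1], continuous phi}.
  apply: continuous_within_local => t t01.
  have it := chart_at_dom M (gamma1 t); set i := chart_at (gamma1 t) in it.
  have it2 : chart_dom i (gamma2 t) by rewrite -g12.
  exists (psi i); split; first exact: phiE.
    by apply: differentiable_continuous; apply/derivable1_diffP/psi_derivable.
  by apply: filterS (near_dom _ _ _ gc1 it) => s si s01; exact: phiE.
have dphi (t : R) : t \in `]0, 1[ -> is_derive t 1 phi 0.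
  by rewrite in_itv /=; exact: phi_derive.
have [c _] := @MVT R phi (fun=> 0) 0 1 ltr01 dphi phi_cont.
by move=> /eqP; rewrite mul0r subr_eq0 => /eqP.
Qed.

End Parallel.

(** * Length and distance *)

Section Norm.
Context {R : realType} {M : riemannian_manifold R}.
Variable p : M.
Implicit Types v w : 'rV[R]_(Defs.dim M).
Local Notation ip := (@inner R M p).
Local Notation nm := (@norm_at R M p).

Lemma innerDl u v w : ip (u + v) w = ip u w + ip v w.
Proof. by rewrite /inner !mulmxDl mxE. Qed.

Lemma innerZl c v w : ip (c *: v) w = c * ip v w.
Proof. by rewrite /inner -!scalemxAl mxE. Qed.

Lemma inner_sym v w : ip v w = ip w v.
Proof. exact: (inn_sym _ _ _ _ (chart_at_dom M p)). Qed.

Lemma innerDr u v w : ip u (v + w) = ip u v + ip u w.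
Proof. by rewrite inner_sym innerDl ![ip _ u]inner_sym. Qed.

Lemma innerZr c v w : ip v (c *: w) = c * ip v w.
Proof. by rewrite inner_sym innerZl inner_sym. Qed.

Lemma innerNl v w : ip (- v) w = - ip v w.
Proof. by rewrite -scaleN1r innerZl mulN1r. Qed.

Lemma innerNr v w : ip v (- w) = - ip v w.
Proof. by rewrite -scaleN1r innerZr mulN1r. Qed.

Lemma inner0l w : ip 0 w = 0.
Proof. by rewrite -(scale0r 0) innerZl mul0r. Qed.

Lemma inner_gt0 v : v != 0 -> 0 < ip v v.
Proof. exact: gmx_gt0 (chart_at_dom M p). Qed.

Lemma inner_ge0 v : 0 <= ip v v.
Proof. by have [->|/inner_gt0/ltW] := eqVneq v 0; rewrite ?inner0l. Qed.

Lemma norm_at_ge0 v : 0 <= nm v.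
Proof. exact: sqrtr_ge0. Qed.

Lemma norm_at_sqr v : nm v ^+ 2 = ip v v.
Proof. by rewrite sqr_sqrtr // inner_ge0. Qed.

Lemma norm_at0_eq0 v : nm v = 0 -> v = 0.
Proof.
move=> v0; apply/eqP; apply: contraT => /inner_gt0.
by rewrite -norm_at_sqr v0 expr0n ltxx.
Qed.

Lemma norm_atZ c v : nm (c *: v) = `|c| * nm v.
Proof.
rewrite /norm_at innerZl innerZr mulrA -expr2 sqrtrM ?sqr_ge0 //.
by rewrite sqrtr_sqr.
Qed.

Lemma norm_atN v : nm (- v) = nm v.
Proof. by rewrite -scaleN1r norm_atZ normrN1 mul1r. Qed.

Lemma norm_at0 : nm 0 = 0.
Proof. by rewrite -(scale0r 0) norm_atZ normr0 mul0r. Qed.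

Lemma cauchy_schwarz v w : ip v w <= nm v * nm w.
Proof.
have [v0|vn0] := eqVneq (nm v) 0.
  by rewrite (norm_at0_eq0 _ v0) inner0l norm_at0 mul0r.
have [w0|wn0] := eqVneq (nm w) 0.
  by rewrite (norm_at0_eq0 _ w0) inner_sym inner0l norm_at0 mulr0.
have := inner_ge0 (nm w *: v - nm v *: w).
rewrite innerDl !innerDr !innerNl !innerNr !innerZl !innerZr -!norm_at_sqr.
rewrite [ip w v]inner_sym.
have : 0 < nm v * nm w by rewrite mulr_gt0 // lt_def ?norm_at_ge0 ?andbT.
move: (nm v) (nm w) (ip v w) => a b c ab0.
have -> : b * (b * a ^+ 2) - b * (a * c) + (- (a * (b * c)) - - (a * (a * b ^+ 2)))
   = (2 * (a * b)) * (a * b - c) by ring.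
by rewrite pmulr_rge0 ?subr_ge0 // mulr_gt0.
Qed.

Lemma norm_atD v w : nm (v + w) <= nm v + nm w.
Proof.
rewrite -(@ler_pXn2r _ 2) ?nnegrE ?norm_at_ge0 ?addr_ge0 ?norm_at_ge0 //.
rewrite norm_at_sqr innerDl !innerDr sqrrD !norm_at_sqr [ip w v]inner_sym.
by have := cauchy_schwarz v w; move: (nm v * nm w) (ip v w) => a b ab; lra.
Qed.

Lemma norm_atB v w : nm (v - w) <= nm v + nm w.
Proof. by apply: le_trans (norm_atD _ _) _; rewrite norm_atN. Qed.

End Norm.

Section Length.
Context {R : realType} {M : riemannian_manifold R}.
Implicit Types (p q : M) (i j : atlas M) (gamma : R -> M).

Lemma norm_velocity_const gamma t : geodesic gamma ->
  norm_at (velocity gamma t) = norm_at (velocity gamma 0).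
Proof. by move=> gg; rewrite /norm_at speed_const. Qed.

Lemma length_const gamma (c : R) :
  (forall t : R, 0 <= t <= 1 -> norm_at (velocity gamma t) = c) ->
  curve_length gamma = c.
Proof.
move=> gc; rewrite /curve_length.
transitivity (Rintegral (@lebesgue_measure R) `[0, 1] (fun=> c)).
  apply: eq_Rintegral => t; rewrite inE /= in_itv /=; exact: gc.
rewrite Rintegral_cst //. rewrite /= lebesgue_measure_itv /= lte_fin ltr01.
by rewrite -EFinB /= subr0 mulr1.
Qed.

Lemma length_geodesic gamma : geodesic gamma ->
  curve_length gamma = norm_at (velocity gamma 0).
Proof. by move=> gg; apply: length_const => t _; exact: norm_velocity_const. Qed.

Lemma length_ge0 gamma : 0 <= curve_length gamma.
Proof. by apply: Rintegral_ge0 => t _; exact: norm_at_ge0. Qed.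

Lemma dist_le_length gamma : C1_curve gamma ->
  dist (gamma 0) (gamma 1) <= curve_length gamma.
Proof.
move=> gC; apply: ge_inf; last by exists gamma.
by exists 0 => _ [g' [_ _ _ ->]]; exact: length_ge0.
Qed.

Lemma dist_ge0 p q : 0 <= dist p q.
Proof.
(* If no C^1 curve joins p to q, the infimum is over the empty set and has the default value 0. *)
have [ne|/set0P/negP/negPn/eqP e] :=
  pselect ([set l | exists gamma, [/\ C1_curve gamma, gamma 0 = p, gamma 1 = q &
     l = curve_length gamma]] !=set0).
  by apply: lb_le_inf => // _ [g' [_ _ _ ->]]; exact: length_ge0.
by rewrite /dist e inf0.
Qed.

Lemma minimizing_speed p q gamma t : minimizing_geodesic p q gamma ->
  norm_at (velocity gamma t) = dist p q.
Proof. by move=> [gg _ _ <-]; rewrite (length_geodesic _ gg) (norm_velocity_const _ t gg). Qed.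

Lemma coord_reparam gamma i k (theta : R -> R) (t dtheta : R) :
  derivable (Defs.coord i gamma k) (theta t) 1 -> is_derive t 1 theta dtheta ->
  is_derive t 1 (Defs.coord i (gamma \o theta) k)
    (dtheta * derive1 (Defs.coord i gamma k) (theta t)).
Proof.
move=> dg dt; have := @is_derive1_comp R (Defs.coord i gamma k) theta t _ _
  (derivableP dg) dt.
by rewrite mulrC -derive1E.
Qed.

Lemma velocity_reparam gamma (theta : R -> R) (t dtheta : R) :
  dcurve gamma -> is_derive t 1 theta dtheta ->
  velocity (gamma \o theta) t = dtheta *: velocity gamma (theta t).
Proof.
move=> [gc gd] dt; apply/rowP => k; rewrite !mxE derive1E.
have [|_ ->] // := coord_reparam gamma (chart_at (gamma (theta t))) k theta t _ _ dt.
by apply: gd; exact: chart_at_dom.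
Qed.

Lemma C1_reparam gamma (theta dtheta : R -> R) :
  C1_curve gamma -> (forall t : R, is_derive t 1 theta (dtheta t)) ->
  continuous dtheta -> C1_curve (gamma \o theta).
Proof.
move=> [gc gd] dt dtc.
have tc : continuous theta.
  by move=> t; apply: differentiable_continuous; apply/derivable1_diffP; have [] := dt t.
have gtc : continuous (gamma \o theta).
  by move=> t; apply: continuous_comp; [exact: tc|exact: gc].
split; first exact: gtc.
move=> i k t it; have [d1 d2] := gd i k _ it.
have [d3 _] := coord_reparam gamma i k theta t _ d1 (dt t).
split; first exact: d3.
have E : \forall s \near t,
    dtheta s * derive1 (Defs.coord i gamma k) (theta s) =
    derive1 (Defs.coord i (gamma \o theta) k) s.
  apply: filterS (near_dom _ _ _ gtc it) => s si; rewrite [RHS]derive1E.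
  by have [_ ->] := coord_reparam gamma i k theta s _ (gd i k _ si).1 (dt s).
apply: (cvg_trans (near_eq_cvg E)).
rewrite -(nbhs_singleton E); apply: cvgM; first exact: dtc.
apply: (@continuous_comp _ _ _ theta (derive1 (Defs.coord i gamma k))); last exact: d2.
exact: tc.
Qed.

Lemma is_derive_affine (a b t : R) : is_derive t 1 (fun s => a + b * s) b.
Proof.
have := is_deriveD (is_derive_cst a t 1) (is_deriveZ b (is_derive_id t 1)).
by rewrite add0r /GRing.scale /= mulr1.
Qed.

(** Both terms of the geodesic equation scale by [b ^+ 2]. A negative b reverses the geodesic, and
    [b = t - s] cuts out the piece between two times. *)
Lemma geodesic_affine gamma (a b : R) : geodesic gamma ->
  geodesic (gamma \o (fun s => a + b * s)).
Proof.
move=> gg; have [gc gd] := gg.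
have cb : continuous (fun _ : R => b) by move=> s; exact: cvg_cst.
have [gtc _] := C1_reparam gamma (fun s => a + b * s) (fun=> b)
  (geodesic_C1 _ gg) (is_derive_affine a b) cb.
split; first exact: gtc.
move=> i k t it; have [d1 d2 d3] := gd i k _ it.
have E l : \forall s \near t,
    b * derive1 (Defs.coord i gamma l) (a + b * s) =
    derive1 (Defs.coord i (gamma \o (fun s => a + b * s)) l) s.
  apply: filterS (near_dom _ _ _ gtc it) => s si; rewrite [RHS]derive1E.
  have [ds _ _] := gd i l _ si.
  by have [_ ->] := coord_reparam gamma i l _ s _ ds (is_derive_affine a b s).
have [d4 _] := coord_reparam gamma i k _ t _ d1 (is_derive_affine a b t).
have d5 := @is_derive1_comp R (derive1 (Defs.coord i gamma k)) (fun s => a + b * s)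
  t _ _ (derivableP d2) (is_derive_affine a b t).
have [d6 d7] := near_eq_is_derive (E k) (is_deriveZ b d5).
split; [exact: d4|exact: d6|].
rewrite derive1E [X in X + _]d7.
have scal (x : R) : b *: (x * b) = b ^+ 2 * x by rewrite /GRing.scale /=; ring.
rewrite scal -derive1E.
rewrite -[RHS](mulr0 (b ^+ 2)) -[in RHS]d3 mulrDr; congr (_ + _).
rewrite mulr_sumr; apply: eq_bigr => l _; rewrite mulr_sumr; apply: eq_bigr => m _.
rewrite -!(nbhs_singleton (E _)) /=.
by move: (christoffel _ _ _ _ _) (_^`()%classic _) (_^`()%classic _) => x y z; ring.
Qed.

Lemma dist_geodesic_le gamma (s t : R) : geodesic gamma ->
  dist (gamma s) (gamma t) <= `|t - s| * norm_at (velocity gamma 0).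
Proof.
move=> gg; have ga := geodesic_affine gamma s (t - s) gg.
have E : norm_at (velocity (gamma \o (fun r => s + (t - s) * r)) 0) =
    `|t - s| * norm_at (velocity gamma 0).
  rewrite (velocity_reparam _ _ _ _ (geodesic_dcurve _ gg) (is_derive_affine _ _ _)).
  by rewrite norm_atZ; congr (_ * _); exact: norm_velocity_const.
have := dist_le_length _ (geodesic_C1 _ ga).
by rewrite (length_geodesic _ ga) E /= mulr0 addr0 mulr1 subrKC.
Qed.

End Length.

(** * Joining two geodesics by a C^1 curve *)

Section Concatenation.
Context {R : realType} {M : riemannian_manifold R}.
Implicit Types (p q : M) (i j : atlas M) (gamma : R -> M).

(** Constant on the negative side, with a continuous derivative that vanishes at 0: precomposing
    with it brings a curve to rest while keeping it C^1. *)
Definition sqpos (u : R) : R := Num.max 0 u ^+ 2.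

Lemma is_derive_sqpos (u : R) : is_derive u 1 sqpos (2 * Num.max 0 u).
Proof.
have [u0|u0|u0] := ltgtP 0 u.
- have E : \forall s \near u, s ^+ 2 = sqpos s.
    by apply: filterS (lt_nbhsr u0) => s s0; rewrite /sqpos max_r ?ltW.
  apply: near_eq_is_derive E _.
  have d : is_derive u 1 (fun s : R => s * s) _ :=
    is_deriveM (is_derive_id u 1) (is_derive_id u 1).
  by apply: is_derive_eq d _; rewrite /GRing.scale /= mulr1 mulr2n mulrDl mul1r.
- rewrite mulr0.
  have E : \forall s \near u, 0 = sqpos s.
    by apply: filterS (lt_nbhsl u0) => s s0; rewrite /sqpos max_l ?expr0n ?ltW.
  exact: near_eq_is_derive E (is_derive_cst 0 u 1).
- rewrite -u0 mulr0.
  have L : h^-1 *: (sqpos (h *: 1 + 0) - sqpos 0) @[h --> 0^'] --> (0 : R).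
    apply/cvgrPdist_le => e e0.
    have he : \forall h \near 0^', `|h : R| < e by exact: dnbhs0_lt.
    apply: filterS2 (nbhs_dnbhs_neq 0) he => h h0 he.
    rewrite sub0r normrN addr0.
    have -> : h *: 1 = h :> R^o by exact: mulr1.
    rewrite /sqpos maxxx expr0n subr0 normrZ normfV normrX.
    rewrite ler_pdivrMl ?normr_gt0 // expr2.
    have mh : `|Num.max 0 h| <= `|h|.
      by case: (leP 0 h) => // _; rewrite normr0.
    by apply: ler_pM => //; apply: le_trans mh (ltW he).
  by apply: DeriveDef; [apply/cvg_ex; exists 0|apply/cvg_lim].
Qed.

Lemma continuous_max0 (f : R -> R) : continuous f ->
  continuous (fun t => Num.max 0 (f t)).
Proof.
move=> fc t.
have -> : (fun t => Num.max 0 (f t)) = (fun t => 2^-1 * (f t + `|f t|)).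
  apply/funext => s; case: (leP 0 (f s)) => h.
    by rewrite ger0_norm //; field.
  by rewrite ltr0_norm // addrN mulr0.
apply: cvgM; first exact: cvg_cst.
by apply: cvgD; [exact: fc|apply: cvg_norm; exact: fc].
Qed.

Lemma near_cst (f : R -> R) (t a : R) : (\forall s \near t, f s = a) ->
  [/\ derivable f t 1, derive1 f t = 0 & {for t, continuous (derive1 f)}].
Proof.
move=> fa; have E : \forall s \near t, 0 = derive1 f s.
  have := near_join fa; apply: filterS => s fs.
  by rewrite derive1E (@near_eq_derive _ _ _ f (cst a) s 1 fs) derive_cst.
split.
- apply: near_eq_derivable (derivable_cst a t 1).
  by apply: filterS fa => s ->.
- by rewrite -(nbhs_singleton E).
- apply: cvg_trans (near_eq_cvg E) _.
  by rewrite -(nbhs_singleton E); exact: cvg_cst.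
Qed.

(** The source of the triangle inequality: a broken geodesic has a corner and does not compete in
    [dist]. *)
Lemma dist_concat gamma1 gamma2 : geodesic gamma1 -> geodesic gamma2 ->
  gamma1 1 = gamma2 0 ->
  dist (gamma1 0) (gamma2 1) <=
  norm_at (velocity gamma1 0) + norm_at (velocity gamma2 0).
Proof.
move=> gg1 gg2 g12.
(* Reparametrized so as to stop at the junction, the two pieces form a C^1 curve. *)
pose th1 (t : R) : R := 1 - sqpos (1 + -2 * t).
pose th2 (t : R) : R := sqpos (-1 + 2 * t).
pose dth1 (t : R) : R := 4 * Num.max 0 (1 + -2 * t).
pose dth2 (t : R) : R := 4 * Num.max 0 (-1 + 2 * t).
have d1 (t : R) : is_derive t 1 th1 (dth1 t).
  have d : is_derive t 1 (fun s : R => sqpos (1 + -2 * s)) _ :=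
    is_derive1_comp (is_derive_sqpos _) (is_derive_affine 1 (-2) t).
  apply: is_derive_eq (is_deriveB (is_derive_cst (1 : R) t 1) d) _.
  by rewrite /dth1; ring.
have d2 (t : R) : is_derive t 1 th2 (dth2 t).
  have d : is_derive t 1 (fun s : R => sqpos (-1 + 2 * s)) _ :=
    is_derive1_comp (is_derive_sqpos _) (is_derive_affine (-1) 2 t).
  by apply: is_derive_eq d _; rewrite /dth2; ring.
have affc (a b : R) : continuous (fun t => a + b * t).
  move=> t; apply: differentiable_continuous; apply/derivable1_diffP.
  by have [] := is_derive_affine a b t.
have dc1 : continuous dth1.
  move=> t; apply: cvgM; first exact: cvg_cst.
  exact: (continuous_max0 _ (affc _ _)).
have dc2 : continuous dth2.
  move=> t; apply: cvgM; first exact: cvg_cst.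
  exact: (continuous_max0 _ (affc _ _)).
have hE1 (t : R) : 2^-1 <= t -> Num.max 0 (1 + -2 * t) = 0.
  by move=> h; apply: max_l; rewrite mulNr subr_le0 -ler_pdivrMl // mulr1.
have hE2 (t : R) : t <= 2^-1 -> Num.max 0 (-1 + 2 * t) = 0.
  by move=> h; apply: max_l; rewrite addrC subr_le0 -ler_pdivlMl // mulr1.
pose c1 := gamma1 \o th1; pose c2 := gamma2 \o th2; pose m := gamma2 0.
have C1 : C1_curve c1 := C1_reparam _ _ _ (geodesic_C1 _ gg1) d1 dc1.
have C2 : C1_curve c2 := C1_reparam _ _ _ (geodesic_C1 _ gg2) d2 dc2.
have c1m (t : R) : 2^-1 <= t -> c1 t = m.
  by move=> h; rewrite /c1 /= /th1 /sqpos hE1 // expr0n subr0 g12.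
have c2m (t : R) : t <= 2^-1 -> c2 t = m.
  by move=> h; rewrite /c2 /= /th2 /sqpos hE2 // expr0n.
pose c t := if t <= 2^-1 then c1 t else c2 t.
(* At every time at least one of the two pieces sits at the junction [m], so in coordinates the
   concatenation is a sum minus a constant and can be differentiated without cases. *)
have coordE i k : Defs.coord i c k = (fun t => Defs.coord i c1 k t +
    Defs.coord i c2 k t - chart i m 0 k).
  apply/funext => t; rewrite /Defs.coord /c; case: leP => ht.
    by rewrite (c2m t) // addrK.
  by rewrite (c1m t) ?ltW // addrAC subrr add0r.
have [cc1 dd1] := C1; have [cc2 dd2] := C2.
have cpart1 i k (t : R) : chart_dom i (c t) ->
    derivable (Defs.coord i c1 k) t 1 /\
    {for t, continuous (derive1 (Defs.coord i c1 k))}.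
  rewrite /c; case: leP => ht it; first exact: dd1.
  have [] := near_cst (Defs.coord i c1 k) t (chart i m 0 k); last by [].
  by apply: filterS (lt_nbhsr ht) => s /ltW /c1m; rewrite /Defs.coord => ->.
have cpart2 i k (t : R) : chart_dom i (c t) ->
    derivable (Defs.coord i c2 k) t 1 /\
    {for t, continuous (derive1 (Defs.coord i c2 k))}.
  rewrite /c; case: (ltgtP t 2^-1) => ht it.
  - have [] := near_cst (Defs.coord i c2 k) t (chart i m 0 k); last by [].
    by apply: filterS (lt_nbhsl ht) => s /ltW /c2m; rewrite /Defs.coord => ->.
  - exact: dd2.
  - have E : c2 t = c1 t by rewrite c1m ?c2m ?ht.
    by apply: dd2; rewrite E.
have dcoord i k (t : R) : chart_dom i (c t) ->
    is_derive t 1 (Defs.coord i c k) (derive1 (Defs.coord i c1 k) t +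
      derive1 (Defs.coord i c2 k) t).
  move=> it; rewrite coordE -[X in is_derive _ _ _ X]subr0.
  have [e1 _] := cpart1 i k t it; have [e2 _] := cpart2 i k t it.
  have dd (f : R -> R) : derivable f t 1 -> is_derive t 1 f (derive1 f t).
    by move=> df; rewrite derive1E; exact: derivableP.
  exact: (is_deriveB (is_deriveD (dd _ e1) (dd _ e2))
    (is_derive_cst (chart i m 0 k : R) t 1)).
have c_cont : continuous c.
  move=> t; have [ht|ht|ht] := ltgtP t 2^-1.
  - have E : \forall s \near t, c1 s = c s.
      by apply: filterS (lt_nbhsl ht) => s hs; rewrite /c ltW.
    apply: cvg_trans (near_eq_cvg E) _.
    by rewrite -(nbhs_singleton E); exact: cc1.
  - have E : \forall s \near t, c2 s = c s.
      by apply: filterS (lt_nbhsr ht) => s hs; rewrite /c leNgt hs.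
    apply: cvg_trans (near_eq_cvg E) _.
    by rewrite -(nbhs_singleton E); exact: cc2.
  - have cm : c t = m by rewrite /c ht lexx c1m.
    move=> A mA; have {}mA : nbhs m A by rewrite -cm; exact: mA.
    have A1 : \forall s \near t, A (c1 s) by apply: cc1; rewrite c1m // ht.
    have A2 : \forall s \near t, A (c2 s) by apply: cc2; rewrite c2m // ht.
    by apply: filterS2 A1 A2 => s; rewrite /= /c; case: ifP.
have CC : C1_curve c.
  split; first exact: c_cont.
  move=> i k t it; split; first by have [] := dcoord i k t it.
  have E : \forall s \near t, derive1 (Defs.coord i c1 k) s +
      derive1 (Defs.coord i c2 k) s = derive1 (Defs.coord i c k) s.
    apply: filterS (near_dom _ _ _ c_cont it) => s si.
    by rewrite [RHS]derive1E; have [_ ->] := dcoord i k s si.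
  apply: cvg_trans (near_eq_cvg E) _; rewrite -(nbhs_singleton E).
  by apply: cvgD; [exact: (cpart1 i k t it).2|exact: (cpart2 i k t it).2].
set n1 := norm_at (velocity gamma1 0); set n2 := norm_at (velocity gamma2 0).
(* One of the two pieces is always at rest, so the speeds simply add; the resulting function is the
   derivative of [n1 * th1 + n2 * th2], whose increment over [0, 1] is [n1 + n2]. *)
have speed (t : R) : norm_at (velocity c t) = n1 * dth1 t + n2 * dth2 t.
  have E1 (s : R) : norm_at (velocity c1 s) = n1 * dth1 s.
    rewrite (velocity_reparam _ _ _ _ (C1_dcurve _ (geodesic_C1 _ gg1)) (d1 s)).
    have h0 : 0 <= dth1 s by rewrite mulr_ge0 // le_max lexx.
    rewrite norm_atZ (ger0_norm h0) [RHS]mulrC.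
    exact: (congr1 ( *%R (dth1 s)) (norm_velocity_const gamma1 (th1 s) gg1)).
  have E2 (s : R) : norm_at (velocity c2 s) = n2 * dth2 s.
    rewrite (velocity_reparam _ _ _ _ (C1_dcurve _ (geodesic_C1 _ gg2)) (d2 s)).
    have h0 : 0 <= dth2 s by rewrite mulr_ge0 // le_max lexx.
    rewrite norm_atZ (ger0_norm h0) [RHS]mulrC.
    exact: (congr1 ( *%R (dth2 s)) (norm_velocity_const gamma2 (th2 s) gg2)).
  have velE : velocity c t = \row_k (
      derive1 (Defs.coord (chart_at (c t)) c1 k) t +
      derive1 (Defs.coord (chart_at (c t)) c2 k) t).
    apply/rowP => k; rewrite !mxE derive1E.
    by have [_ ->] := dcoord _ k t (chart_at_dom M (c t)).
  have [ht|ht] := leP t 2^-1.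
  - have ct : c t = c1 t by rewrite /c ht.
    rewrite [dth2 t]/dth2 hE2 // !mulr0 addr0 -E1 /norm_at /inner velE ct.
    suff -> : \row_k (derive1 (Defs.coord (chart_at (c1 t)) c1 k) t +
      derive1 (Defs.coord (chart_at (c1 t)) c2 k) t) = velocity c1 t by [].
    apply/rowP => k; rewrite !mxE -[RHS]addr0; congr (_ + _).
    move: ht; rewrite le_eqVlt => /orP[/eqP ht|ht]; last first.
      have [] // := near_cst (Defs.coord (chart_at (c1 t)) c2 k) t
        (chart (chart_at (c1 t)) m 0 k).
      by apply: filterS (lt_nbhsl ht) => s /ltW /c2m; rewrite /Defs.coord => ->.
    have c12 : c1 t = c2 t by rewrite c1m ?c2m ?ht.
    rewrite c12.
    have := velocity_reparam _ _ _ _ (C1_dcurve _ (geodesic_C1 _ gg2)) (d2 t).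
    rewrite /dth2 hE2 ?ht // mulr0 scale0r -ht => /rowP/(_ k).
    by rewrite !mxE.
  - have ct : c t = c2 t by rewrite /c leNgt ht.
    rewrite [dth1 t]/dth1 hE1 ?ltW // !mulr0 add0r -E2 /norm_at /inner velE ct.
    suff -> : \row_k (derive1 (Defs.coord (chart_at (c2 t)) c1 k) t +
      derive1 (Defs.coord (chart_at (c2 t)) c2 k) t) = velocity c2 t by [].
    apply/rowP => k; rewrite !mxE -[RHS]add0r; congr (_ + _).
    have [] // := near_cst (Defs.coord (chart_at (c2 t)) c1 k) t
        (chart (chart_at (c2 t)) m 0 k).
    by apply: filterS (lt_nbhsr ht) => s /ltW /c1m; rewrite /Defs.coord => ->.
have <- : c 0 = gamma1 0.
  rewrite /c invr_ge0 ler0n /c1 /= /th1 /sqpos mulr0 addr0.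
  by rewrite max_r // expr1n subrr.
have <- : c 1 = gamma2 1.
  have -> : c 1 = c2 1 by rewrite /c leNgt invf_lt1 // ltr1n.
  rewrite /c2 /= /th2 /sqpos mulr1.
  have -> : -1 + 2 = 1 :> R by ring.
  by rewrite max_r // expr1n.
apply: le_trans (dist_le_length _ CC) _.
rewrite /curve_length.
pose f t := n1 * dth1 t + n2 * dth2 t; pose F t := n1 * th1 t + n2 * th2 t.
have -> : (fun t => norm_at (velocity c t)) = f by exact/funext.
have dF (t : R) : is_derive t 1 F (f t).
  exact: (is_deriveD (is_deriveZ n1 (d1 t)) (is_deriveZ n2 (d2 t))).
have Fc : continuous F.
  by move=> t; apply: differentiable_continuous; apply/derivable1_diffP; have [] := dF t.
rewrite /Rintegral (@continuous_FTC2 R f F 0 1) //.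
- rewrite -EFinB /= /F /th1 /th2 /sqpos !mulr0 !mulr1 !addr0.
  have m1 : Num.max 0 1 = 1 :> R by apply: max_r.
  have m2 : Num.max 0 (1 - 2) = 0 :> R by apply: max_l; rewrite subr_le0 ler1n.
  have m3 : Num.max 0 (-1) = 0 :> R by apply: max_l; rewrite lerN10.
  have e1 : -1 + 2 = 1 :> R by ring.
  rewrite e1 m1 m2 m3 !expr0n !expr1n /= subr0 subrr !mulr0 !mulr1 add0r subr0.
  exact: lexx.
- apply: continuous_subspaceT => t; apply: cvgD; apply: cvgM;
    (try exact: cvg_cst); [exact: dc1|exact: dc2].
- split.
  + by move=> t _; have [] := dF t.
  + exact: cvg_at_right_filter (Fc 0).
  + exact: cvg_at_left_filter (Fc 1).
- by move=> t _; rewrite derive1E; have [_ ->] := dF t.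
Qed.

End Concatenation.

(** * Geodesically convex sets *)

Section Convex.
Context {R : realType} {M : riemannian_manifold R}.
Implicit Types (p q : M) (i j : atlas M) (gamma : R -> M).
Variable U : set M.
Hypothesis U_convex : geodesically_convex U.

Lemma convex_geodesic p q : U p -> U q -> exists gamma, minimizing_geodesic p q gamma.
Proof. by move=> pU qU; have [g [gm _ _]] := U_convex _ _ pU qU; exists g. Qed.

Lemma convex_geodesic_eq p q gamma1 gamma2 (t : R) : U p -> U q ->
  minimizing_geodesic p q gamma1 -> minimizing_geodesic p q gamma2 ->
  0 <= t <= 1 -> gamma1 t = gamma2 t.
Proof.
move=> pU qU g1 g2 t01; have [g [_ _ gu]] := U_convex _ _ pU qU.
by rewrite (gu _ g1 t t01) (gu _ g2 t t01).
Qed.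

Lemma convex_geodesic_in p q gamma (t : R) : U p -> U q ->
  minimizing_geodesic p q gamma -> 0 <= t <= 1 -> U (gamma t).
Proof.
move=> pU qU g1 t01; have [g [_ gU gu]] := U_convex _ _ pU qU.
by rewrite (gu _ g1 t t01); exact: gU.
Qed.

Lemma dist_minimizing_le p q gamma (s t : R) : minimizing_geodesic p q gamma ->
  dist (gamma s) (gamma t) <= `|t - s| * dist p q.
Proof.
move=> gm; rewrite -(minimizing_speed _ _ _ 0 gm); have [gg _ _ _] := gm.
exact: dist_geodesic_le.
Qed.

Lemma convex_dist_sym p q : U p -> U q -> dist p q = dist q p.
Proof.
suff h p' q' : U p' -> U q' -> dist q' p' <= dist p' q'.
  by move=> pU qU; apply/eqP; rewrite eq_le !h.
move=> pU qU; have [g gm] := convex_geodesic p' q' pU qU.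
have := dist_minimizing_le _ _ g 1 0 gm; have [_ -> -> _] := gm.
by rewrite sub0r normrN1 mul1r.
Qed.

Lemma convex_dist_triangle p q r : U p -> U q -> U r ->
  dist p r <= dist p q + dist q r.
Proof.
move=> pU qU rU; have [g1 gm1] := convex_geodesic p q pU qU.
have [g2 gm2] := convex_geodesic q r qU rU.
have [gg1 g10 g11 _] := gm1; have [gg2 g20 g21 _] := gm2.
have := dist_concat _ _ gg1 gg2.
rewrite (minimizing_speed _ _ _ 0 gm1) (minimizing_speed _ _ _ 0 gm2).
by rewrite g10 g11 g20 g21; apply.
Qed.

(** A piece of a minimizing geodesic is minimizing, since a shortcut from p to [gamma s] would
    shorten the way from p to q by the triangle inequality. The orientation towards [gamma 0] is the
    one needed to transport vectors back to the start. *)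
Lemma minimizing_backward p q gamma (s : R) : U p -> U q ->
  minimizing_geodesic p q gamma -> 0 <= s <= 1 ->
  minimizing_geodesic (gamma s) (gamma 0) (gamma \o (fun r => s + - s * r)).
Proof.
move=> pU qU gm s01; have [gg g0 g1 gl] := gm.
have sU := convex_geodesic_in _ _ _ _ pU qU gm s01.
have /andP[s0 s1] := s01.
have ga := geodesic_affine _ s (- s) gg.
split => //=; first by rewrite mulr0 addr0.
  by rewrite mulr1 subrr.
rewrite (length_geodesic _ ga).
rewrite (velocity_reparam _ _ _ _ (geodesic_dcurve _ gg) (is_derive_affine _ _ _)).
rewrite norm_atZ normrN (ger0_norm s0) (minimizing_speed _ _ _ (s + - s * 0) gm).
apply/eqP; rewrite eq_le; apply/andP; split; last first.
  by have := dist_minimizing_le _ _ _ s 0 gm; rewrite sub0r normrN ger0_norm.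
have tri := convex_dist_triangle _ _ _ pU sU qU.
have := dist_minimizing_le _ _ _ s 1 gm.
rewrite ger0_norm ?subr_ge0 // g1 g0 (convex_dist_sym _ _ sU pU).
move: tri; move: (dist p q) (dist p (gamma s)) (dist (gamma s) q) => a b c.
by rewrite mulrBl mul1r; lra.
Qed.

Variable P : forall p q, tangent p -> tangent q.
Hypothesis P_transport : is_parallel_transport U P.

(** The two transported vectors come with unrelated witness geodesics; convexity identifies these on
    [0, 1], which is all that [parallel_inner] asks for. *)
Lemma transport_inner p q (v w : tangent p) : U p -> U q ->
  inner (P p q v) (P p q w) = inner v w.
Proof.
move=> pU qU.
have [g1 [V1 [gm1 pV1 V10 V11]]] := P_transport _ _ v pU qU.
have [g2 [V2 [gm2 pV2 V20 V21]]] := P_transport _ _ w pU qU.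
have [[gg1 g10 g11 _] [gg2 _ _ _]] := (gm1, gm2).
have := parallel_inner _ _ V1 V2 (geodesic_dcurve _ gg1) (geodesic_dcurve _ gg2)
  (fun t t01 => convex_geodesic_eq _ _ _ _ _ pU qU gm1 gm2 t01) pV1 pV2.
by rewrite /inner g10 g11 V10 V11 V20 V21.
Qed.

Lemma transport_norm p q (v : tangent p) : U p -> U q ->
  norm_at (P p q v) = norm_at v.
Proof. by move=> pU qU; rewrite /norm_at transport_inner. Qed.

(* Additivity comes for free from the preservation of inner products. *)
Lemma transportB p q (v w : 'rV[R]_(Defs.dim M)) : U p -> U q ->
  P p q (v - w) = P p q v - P p q w :> 'rV[R]_(Defs.dim M).
Proof.
move=> pU qU; apply/eqP; rewrite -subr_eq0; apply/eqP.
apply: (@norm_at0_eq0 _ _ q); apply/eqP; rewrite -sqrf_eq0 norm_at_sqr.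
pose ipq := @inner R M q.
rewrite !(innerDl, innerDr, innerNl, innerNr).
rewrite !transport_inner // !(innerDl, innerDr, innerNl, innerNr).
by move: (inner _ _) (inner _ _) (inner _ _) (inner _ _) => a b c d; apply/eqP; ring.
Qed.

(** The reversed piece from [gamma s] to [gamma 0] is a geodesic, so its velocity [- s] times that
    of gamma is parallel, and products with it are preserved. Cancelling the factor [- s] requires
    [0 < s]. *)
Lemma transport_velocity p q gamma (s : R) (w : tangent (gamma s)) :
  U p -> U q -> minimizing_geodesic p q gamma -> 0 < s <= 1 ->
  inner (P (gamma s) (gamma 0) w) (velocity gamma 0) = inner w (velocity gamma s).
Proof.
move=> pU qU gm /andP[s0 s1]; have s01 : 0 <= s <= 1 by rewrite ltW.
have [gg g0 _ _] := gm.
have bm := minimizing_backward _ _ _ _ pU qU gm s01.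
set sigma := gamma \o _ in bm; have [sg _ _ _] := bm.
have sU := convex_geodesic_in _ _ _ _ pU qU gm s01.
have U0 : U (gamma 0) by rewrite g0.
have [g1 [V1 [gm1 pV1 V10 V11]]] := P_transport _ _ w sU U0.
have [gg1 g10 g11 _] := gm1.
have := parallel_inner _ _ V1 (velocity sigma) (geodesic_dcurve _ gg1)
  (geodesic_dcurve _ sg)
  (fun t t01 => convex_geodesic_eq _ _ _ _ _ sU U0 gm1 bm t01) pV1
  (velocity_parallel _ sg).
have velE r := velocity_reparam _ _ r _ (geodesic_dcurve _ gg) (is_derive_affine s (- s) r).
rewrite !velE /inner g10 g11 V10 V11 mulr0 addr0 mulr1 subrr.
rewrite -!/(inner _ _) !innerZr => /mulfI; apply.
by rewrite oppr_eq0 gt_eqF.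
Qed.

End Convex.

(** * Local comparison of the distance with charts *)

Section InverseEntries.
Context {R : realType}.

Lemma eq_continuous_at (S T : topologicalType) (f g : S -> T) (x : S) :
  {for x, continuous f} -> f =1 g -> {for x, continuous g}.
Proof. by move=> fc /funext <-. Qed.

(** A determinant is a polynomial in the entries, so any property stable under constants, sums and
    products passes to it. The lemma is instantiated with continuity and with derivability; entries
    of an inverse matrix are then quotients of determinants. *)
Lemma det_closed (T : Type) (Q : (T -> R) -> Prop) :
  (forall c, Q (fun=> c)) ->
  (forall f g, Q f -> Q g -> Q (fun x => f x + g x)) ->
  (forall f g, Q f -> Q g -> Q (fun x => f x * g x)) ->
  forall n (A : T -> 'M[R]_n), (forall a b, Q (fun x => A x a b)) ->
  Q (fun x => \det (A x)).
Proof.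
move=> Qc QD QM n A QA; rewrite /determinant.
have Qsum (I : Type) (r : seq I) (f : I -> T -> R) : (forall i, Q (f i)) ->
    Q (fun x => \sum_(i <- r) f i x).
  move=> Qf; elim: r => [|i r IH]; first by under eq_fun do rewrite big_nil.
  by under eq_fun do rewrite big_cons; exact: QD.
have Qprod (I : Type) (r : seq I) (f : I -> T -> R) : (forall i, Q (f i)) ->
    Q (fun x => \prod_(i <- r) f i x).
  move=> Qf; elim: r => [|i r IH]; first by under eq_fun do rewrite big_nil.
  by under eq_fun do rewrite big_cons; exact: QM.
by apply: Qsum => s; apply: QM => //; exact: Qprod.
Qed.

Lemma invmx_entry n (A : 'M[R]_n) a b : A \in unitmx ->
  invmx A a b = (\det A)^-1 * ((-1) ^+ (b + a) * \det (row' b (col' a A))).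
Proof. by move=> uA; rewrite /invmx uA !mxE. Qed.

Lemma continuous_invmx (T : topologicalType) n (A : T -> 'M[R]_n) x a b :
  (forall a b, {for x, continuous (fun y => A y a b)}) ->
  (\forall y \near x, A y \in unitmx) ->
  {for x, continuous (fun y => invmx (A y) a b)}.
Proof.
move=> cA uA.
have cdet m (B : T -> 'M[R]_m) : (forall a b, {for x, continuous (fun y => B y a b)}) ->
    {for x, continuous (fun y => \det (B y))}.
  apply: (det_closed T (fun f => {for x, continuous f})).
  - by move=> c; exact: cvg_cst.
  - by move=> f g cf cg; exact: cvgD.
  - by move=> f g cf cg; exact: cvgM.
have E : \forall y \near x, (\det (A y))^-1 *
    ((-1) ^+ (b + a) * \det (row' b (col' a (A y)))) = invmx (A y) a b.
  by apply: filterS uA => y uy; rewrite invmx_entry.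
apply: cvg_trans (near_eq_cvg E) _; rewrite -(nbhs_singleton E).
apply: cvgM.
  apply: cvgV; last exact: cdet.
  by have := nbhs_singleton uA; rewrite unitmxE unitfE.
apply: cvgM; first exact: cvg_cst.
apply: cdet => c d.
by apply: (@eq_continuous_at _ _ _ _ _ (cA (lift b c) (lift a d))) => y; rewrite !mxE.
Qed.

Lemma derivable_invmx m n (A : 'rV[R]_m -> 'M[R]_n) x v a b :
  (forall a b, derivable (fun y => A y a b) x v) ->
  (\forall y \near x, A y \in unitmx) ->
  derivable (fun y => invmx (A y) a b) x v.
Proof.
move=> dA uA.
have ddet k (B : 'rV[R]_m -> 'M[R]_k) : (forall a b, derivable (fun y => B y a b) x v) ->
    derivable (fun y => \det (B y)) x v.
  apply: (det_closed _ (fun f => derivable f x v)).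
  - by move=> c; exact: derivable_cst.
  - by move=> f g cf cg; exact: derivableD.
  - by move=> f g cf cg; exact: (@derivableM _ _ f g x v cf cg).
have E : \forall y \near x, (\det (A y))^-1 *
    ((-1) ^+ (b + a) * \det (row' b (col' a (A y)))) = invmx (A y) a b.
  by apply: filterS uA => y uy; rewrite invmx_entry.
apply: near_eq_derivable E _.
apply: (@derivableM _ _ (fun y => (\det (A y))^-1)).
  apply: derivableV; last exact: ddet.
  by have := nbhs_singleton uA; rewrite unitmxE unitfE.
apply: (@derivableM _ _ (fun=> (-1) ^+ (b + a))); first exact: derivable_cst.
apply: ddet => c d.
have -> : (fun y => row' b (col' a (A y)) c d) = (fun y => A y (lift b c) (lift a d)).
  by apply/funext => y; rewrite !mxE.
exact: dA.
Qed.

End InverseEntries.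

Section ChartContinuity.
Context {R : realType} {M : riemannian_manifold R}.
Implicit Types (p q : M) (i j : atlas M) (gamma : R -> M) (u : 'rV[R]_(Defs.dim M)).

Lemma image_nbhs i u : (chart i @` chart_dom i) u -> nbhs u (chart i @` chart_dom i).
Proof. by move=> Eu; apply: open_nbhs_nbhs; split => //; exact: chart_image_open. Qed.

Lemma gmx_unit_near i u : (chart i @` chart_dom i) u ->
  \forall w \near u, gmx i (chart_inv i w) \in unitmx.
Proof. by move/image_nbhs; apply: filterS => w /chart_invP[/gmx_unit]. Qed.

Lemma continuous_gmx i u a b : (chart i @` chart_dom i) u ->
  {for u, continuous (fun w => gmx i (chart_inv i w) a b)}.
Proof. exact: (Ck_continuous (gmx_smooth M i a b 0%N)). Qed.

Lemma continuous_gmx_inv i u a b : (chart i @` chart_dom i) u ->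
  {for u, continuous (fun w => invmx (gmx i (chart_inv i w)) a b)}.
Proof.
move=> Eu; apply: (@continuous_invmx _ _ _ (fun w => gmx i (chart_inv i w))).
  by move=> c d; exact: continuous_gmx.
exact: gmx_unit_near.
Qed.

Lemma pdE i a (h : M -> R) u : (chart i @` chart_dom i) u ->
  pd i a h (chart_inv i u) = 'D_(delta_mx 0 a) (h \o chart_inv i) u.
Proof. by move=> /chart_invP[_ E]; rewrite /pd E. Qed.

Lemma continuous_pd i a (D : set 'rV[R]_(Defs.dim M)) (h : M -> R) u :
  (chart i @` chart_dom i) u -> D u -> Ck 1 D (h \o chart_inv i) ->
  {for u, continuous (fun w => pd i a h (chart_inv i w))}.
Proof.
move=> Eu Du hD.
have E : \forall w \near u, 'D_(delta_mx 0 a) (h \o chart_inv i) w =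
    pd i a h (chart_inv i w).
  by apply: filterS (image_nbhs _ _ Eu) => w /pdE.
apply: cvg_trans (near_eq_cvg E) _; rewrite -(nbhs_singleton E).
exact: (Ck_continuous (Ck_D a hD) _ Du).
Qed.

Lemma continuous_christoffel i u k a b : (chart i @` chart_dom i) u ->
  {for u, continuous (fun w => christoffel i (chart_inv i w) k a b)}.
Proof.
move=> Eu; rewrite /christoffel.
apply: (@cvgM _ _ (nbhs u) _ (fun=> 2^-1)); first exact: cvg_cst.
apply: (@cvg_bigsum _ _ (nbhs u) _) => l; apply: cvgM; first exact: continuous_gmx_inv.
have pdc c d e := continuous_pd i c _
  (fun q => gmx i q d e) u Eu Eu (gmx_smooth M i d e 1%N).
exact: (cvgB (cvgD (pdc a b l) (pdc b a l)) (pdc l a b)).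
Qed.

Lemma near_bounded (T : topologicalType) (f : T -> R) x : {for x, continuous f} ->
  \forall y \near x, `|f y| <= `|f x| + 1.
Proof.
move=> /cvgrPdist_lt/(_ _ ltr01); apply: filterS => y h.
rewrite -[f y](subKr (f x)) (le_trans (ler_normB _ _)) // lerD2l ltW //.
Qed.

Lemma continuous_speed gamma : C1_curve gamma ->
  continuous (fun t => norm_at (velocity gamma t)).
Proof.
move=> gC; have [gc gd] := gC; have dg := C1_dcurve _ gC.
move=> t; have it := chart_at_dom M (gamma t); set i := chart_at (gamma t) in it.
have E : \forall s \near t, Num.sqrt (\sum_a \sum_b
    vel i gamma s 0 a * gmx i (gamma s) a b * vel i gamma s 0 b) =
    norm_at (velocity gamma s).
  apply: filterS (near_dom _ _ _ gc it) => s si.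
  by rewrite /norm_at (inner_velocity _ i) // innE.
apply: cvg_trans (near_eq_cvg E) _; rewrite -(nbhs_singleton E).
apply: (@continuous_comp _ _ _ (fun s => \sum_a \sum_b
    vel i gamma s 0 a * gmx i (gamma s) a b * vel i gamma s 0 b) Num.sqrt);
  last exact: sqrt_continuous.
have velc a : vel i gamma s 0 a @[s --> t] --> vel i gamma t 0 a.
  have -> : (fun s => vel i gamma s 0 a) = derive1 (Defs.coord i gamma a).
    by apply/funext => s; rewrite mxE.
  by rewrite vel_coord; exact: (gd i a t it).2.
apply: (@cvg_bigsum _ _ (nbhs t) _) => a; apply: (@cvg_bigsum _ _ (nbhs t) _) => b.
apply: cvgM; last exact: velc.
apply: cvgM; first exact: velc.
have [dG _] := derive_gmx gamma i t a b dg it.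
by apply: differentiable_continuous; apply/derivable1_diffP.
Qed.

Lemma length_le gamma (c : R) : C1_curve gamma ->
  (forall t : R, 0 <= t <= 1 -> norm_at (velocity gamma t) <= c) ->
  curve_length gamma <= c.
Proof.
move=> gC hc.
have <- : Rintegral (@lebesgue_measure R) `[0, 1] (fun=> c) = c.
  rewrite Rintegral_cst // /= lebesgue_measure_itv /= lte_fin ltr01.
  by rewrite -EFinB /= subr0 mulr1.
have cI (f : R -> R) : continuous f ->
    (@lebesgue_measure R).-integrable `[0, 1] (EFin \o f).
  move=> fc; apply: continuous_compact_integrable; first exact: segment_compact.
  exact: continuous_subspaceT.
have cc : continuous (fun _ : R => c) by move=> t; exact: cvg_cst.
have hc' (t : R) : `[0, 1]%classic t -> norm_at (velocity gamma t) <= c.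
  by rewrite /= in_itv /=; exact: hc.
apply: (@le_Rintegral _ _ _ (@lebesgue_measure R) `[0, 1]%classic _ _ _
  (cI _ (continuous_speed _ gC)) (cI _ cc) hc').
exact: measurable_itv.
Qed.

(** Cauchy-Schwarz against [w], the metric dual of the k-th coordinate form: its product with v is
    [v 0 k] and its square norm is the k-th diagonal entry of the inverse Gram matrix. *)
Lemma coord_sqr_le i p (v : 'rV[R]_(Defs.dim M)) k : chart_dom i p ->
  v 0 k ^+ 2 <= inn i p v v * invmx (gmx i p) k k.
Proof.
move=> ip; have uG := gmx_unit _ _ ip.
pose w : 'rV[R]_(Defs.dim M) := delta_mx 0 k *m invmx (gmx i p).
have symI : (invmx (gmx i p))^T = invmx (gmx i p) by rewrite trmx_inv gmx_sym.
have wT : w^T = invmx (gmx i p) *m delta_mx k 0.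
  by rewrite /w trmx_mul symI trmx_delta.
have wE : w *m gmx i p = delta_mx 0 k by rewrite /w mulmxKV.
have ivw : inn i p v w = v 0 k.
  by rewrite /inn wT mulmxA mulmxK // -colE mxE.
have iww : inn i p w w = invmx (gmx i p) k k.
  by rewrite /inn wE wT -rowE -colE !mxE.
have wn0 : w != 0.
  apply/eqP => w0; have : delta_mx 0 k = 0 :> 'rV[R]_(Defs.dim M).
    by rewrite -wE w0 mul0mx.
  by move=> /rowP/(_ k); rewrite !mxE !eqxx /=; exact/eqP/oner_neq0.
have c0 := gmx_gt0 _ i p w ip wn0; rewrite -/(inn i p w w) iww in c0.
set c := invmx (gmx i p) k k in iww c0 *.
have ge0 (x : 'rV[R]_(Defs.dim M)) : 0 <= inn i p x x.
  have [->|xn0] := eqVneq x 0; first by rewrite /inn mul0mx mul0mx mxE.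
  exact/ltW/gmx_gt0.
have := ge0 (c *: v - v 0 k *: w).
have -> : inn i p (c *: v - v 0 k *: w) (c *: v - v 0 k *: w) =
    c * (inn i p v v * c - v 0 k ^+ 2).
  have iwv : inn i p w v = v 0 k by rewrite inn_sym.
  have Dl x y z : inn i p (x + y) z = inn i p x z + inn i p y z.
    by rewrite /inn !mulmxDl mxE.
  have Zl r x z : inn i p (r *: x) z = r * inn i p x z.
    by rewrite /inn -!scalemxAl mxE.
  have Dr x y z : inn i p z (x + y) = inn i p z x + inn i p z y.
    by rewrite inn_sym // Dl !(inn_sym i p z).
  have Zr r x z : inn i p z (r *: x) = r * inn i p z x.
    by rewrite inn_sym // Zl (inn_sym i p z).
  rewrite -scaleNr !Dl !Dr !Zl !Zr ivw iwv iww.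
  by move: (inn i p v v) (v 0 k) => x y; ring.
by rewrite pmulr_rge0 // subr_ge0.
Qed.

End ChartContinuity.

Section LocalControl.
Context {R : realType} {M : riemannian_manifold R}.
Implicit Types (p q : M) (i j : atlas M) (gamma : R -> M) (u : 'rV[R]_(Defs.dim M)).

(** Continuity at p of all coefficients gives one radius and one constant for everything; [1 <= C]
    allows lower powers of C to be absorbed in higher ones. *)
Lemma local_bounds i p : chart_dom i p -> exists r C : R, [/\ 0 < r, 1 <= C &
  forall u, `|u - chart i p| < r -> [/\ (chart i @` chart_dom i) u,
    forall k, \sum_a \sum_b `|christoffel i (chart_inv i u) k a b| <= C,
    forall k, invmx (gmx i (chart_inv i u)) k k <= C &
    \sum_a \sum_b `|gmx i (chart_inv i u) a b| <= C]].
Proof.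
move=> ip; have Eu := chart_image _ _ ip; set u0 := chart i p in Eu *.
pose f1 u : R := \sum_k \sum_a \sum_b `|christoffel i (chart_inv i u) k a b|.
pose f2 u : R := \sum_k `|invmx (gmx i (chart_inv i u)) k k|.
pose f3 u : R := \sum_a \sum_b `|gmx i (chart_inv i u) a b|.
have f10 u : 0 <= f1 u by do 3 (apply: sumr_ge0 => ? _).
have f20 u : 0 <= f2 u by apply: sumr_ge0 => ? _.
have f30 u : 0 <= f3 u by do 2 (apply: sumr_ge0 => ? _).
have c1 : f1 u @[u --> u0] --> f1 u0.
  do 3 (apply: (@cvg_bigsum _ _ (nbhs u0) _) => ?).
  by apply: cvg_norm; exact: continuous_christoffel.
have c2 : f2 u @[u --> u0] --> f2 u0.
  apply: (@cvg_bigsum _ _ (nbhs u0) _) => ?.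
  by apply: cvg_norm; exact: continuous_gmx_inv.
have c3 : f3 u @[u --> u0] --> f3 u0.
  do 2 (apply: (@cvg_bigsum _ _ (nbhs u0) _) => ?).
  by apply: cvg_norm; exact: continuous_gmx.
have cf : f1 u + f2 u + f3 u @[u --> u0] --> f1 u0 + f2 u0 + f3 u0.
  exact: (cvgD (cvgD c1 c2) c3).
have nb := @near_bounded _ _ (fun u => f1 u + f2 u + f3 u) u0 cf.
have : nbhs u0 [set u | `|f1 u + f2 u + f3 u| <= `|f1 u0 + f2 u0 + f3 u0| + 1 /\
    (chart i @` chart_dom i) u] by exact: (filterI nb (image_nbhs _ _ Eu)).
move=> /nbhs_ballP[r /= r0 Hr].
exists r, (`|f1 u0 + f2 u0 + f3 u0| + 1); split => //; first by rewrite lerDr.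
move=> u ur; have [|] := Hr u; first by rewrite -ball_normE /= distrC.
rewrite ger0_norm ?addr_ge0 //; set C := _ + 1 => fC Eu'; split => //.
- move=> k; apply: le_trans fC; apply: le_trans (_ : f1 u <= _); last first.
    by rewrite -addrA lerDl addr_ge0.
  rewrite /f1 [leRHS](bigD1 k) //= lerDl; apply: sumr_ge0 => ? _.
  by do 2 (apply: sumr_ge0 => ? _).
- move=> k; apply: le_trans fC; apply: le_trans (_ : f2 u <= _); last first.
    by rewrite addrAC lerDr addr_ge0.
  apply: le_trans (ler_norm _) _.
  by rewrite /f2 (bigD1 k) //= lerDl; apply: sumr_ge0 => ? _.
- by apply: le_trans fC; rewrite lerDr addr_ge0.
Qed.

Lemma mvt_le (f df : R -> R) (t c : R) : 0 <= t ->
  (forall s, 0 <= s <= t -> is_derive s 1 f (df s)) ->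
  (forall s, 0 <= s <= t -> `|df s| <= c) -> `|f t - f 0| <= c * t.
Proof.
move=> t0 d b.
have sub s : s \in `]0, t[ -> 0 <= s <= t.
  by rewrite in_itv /= => /andP[/ltW -> /ltW ->].
have fc : {within `[0, t], continuous f}.
  apply: continuous_in_subspaceT => s; rewrite inE /= in_itv /= => /d[ds _].
  by apply: differentiable_continuous; apply/derivable1_diffP.
have [s st ->] := @MVT_segment R f df 0 t t0 (fun s st => d s (sub s st)) fc.
rewrite subr0 normrM (ger0_norm t0); apply: ler_wpM2r => //; apply: b.
by move: st; rewrite in_itv.
Qed.

(* At the first exit time the point would still lie in a smaller compact chart ball. *)
Lemma slow_geodesic_in_chart gamma i (r B : R) : geodesic gamma ->
  chart_dom i (gamma 0) -> 0 < r -> 0 <= B < r / 2 ->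
  (forall u, `|u - chart i (gamma 0)| < r -> (chart i @` chart_dom i) u) ->
  (forall k (t : R), 0 <= t <= 1 -> chart_dom i (gamma t) ->
     `|chart i (gamma t) - chart i (gamma 0)| < r -> `|vel i gamma t 0 k| <= B) ->
  forall t : R, 0 <= t <= 1 -> chart_dom i (gamma t) /\
    `|chart i (gamma t) - chart i (gamma 0)| <= B * t.
Proof.
move=> gg i0 r0 /andP[B0 Br] ballE velB.
have [gc gd] := gg; set u0 := chart i (gamma 0) in ballE velB *.
pose S := [set q | chart_dom i q /\ `|chart i q - u0| < r].
have S_nbhs q : S q -> nbhs q S.
  move=> [iq qr]; apply: filterI.
    by apply: open_nbhs_nbhs; split => //; exact: chart_dom_open.
  have oB : open [set u | `|u - u0| < r].
    have -> : [set u | `|u - u0| < r] = ball u0 r.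
      by rewrite -ball_normE; apply/seteqP; split => u /=; rewrite distrC.
    exact: ball_open.
  have nB : nbhs (chart i q) [set u | `|u - u0| < r] by apply: open_nbhs_nbhs; split.
  exact: (chart_continuous _ i q iq _ nB).
have bound (t : R) : 0 <= t <= 1 -> (forall s, 0 <= s <= t -> S (gamma s)) ->
    `|chart i (gamma t) - u0| <= B * t.
  move=> /andP[t0 t1] St; apply: norm_rV_le; first exact: mulr_ge0.
  move=> k; rewrite !mxE.
  apply: (@mvt_le (Defs.coord i gamma k) (fun s => vel i gamma s 0 k)) => //.
    move=> s /St [si _]; have [d _ _] := gd i k s si.
    by rewrite vel_coord derive1E; exact: derivableP.
  move=> s /andP[s0 st]; have [|si sr] := St s; first by rewrite s0.
  by apply: velB => //; rewrite s0 (le_trans st).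
suff SI (t : R) : 0 <= t <= 1 -> S (gamma t).
  move=> t t01; have /andP[t0 t1] := t01.
  split; first by have [] := SI t t01.
  by apply: bound => // s /andP[s0 st]; apply: SI; rewrite s0 (le_trans st).
move=> t01; apply: contrapT => nSt.
pose X := [set s : R | 0 <= s <= t /\ ~ S (gamma s)].
have Xt : X t by split => //; move: t01 => /andP[-> _] /=.
have X0 : lbound X 0 by move=> s [/andP[]].
have infX : has_inf X by split; [exists t|exists 0].
set s1 := inf X.
have s10 : 0 <= s1 by apply: lb_le_inf; [exists t|].
have s1t : s1 <= t by apply: ge_inf => //; exists 0.
have below s : 0 <= s < s1 -> S (gamma s).
  move=> /andP[s0 ss1]; have st : s <= t by exact: le_trans (ltW ss1) s1t.
  apply: contrapT => nS; move: ss1; apply/negP; rewrite -leNgt.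
  apply: ge_inf; first by exists 0.
  by split => //; rewrite s0.
(* Before [s1] the bound [B * s], with [B < r / 2], keeps gamma in K. Being compact in a Hausdorff
   space K is closed, hence contains the limit at [s1] from the left; if [s1 = 0] the starting point
   itself is in S. *)
have S1 : S (gamma s1).
  have [s1_gt0|] := ltP 0 s1; last first.
    move=> s1_le0; have -> : s1 = 0 by apply/eqP; rewrite eq_le s1_le0.
    by split => //; rewrite subrr normr0.
  pose K := chart_inv i @` [set u | `|u - u0| <= r / 2].
  have Kr u : `|u - u0| <= r / 2 -> `|u - u0| < r.
    by move=> /le_lt_trans; apply; rewrite ltr_pdivrMr // ltr_pMr // ltr1n.
  have cK : closed K.
    apply: compact_closed; first exact: carrier_hausdorff.
    apply: continuous_compact.
      by apply: continuous_in_subspaceT => u /set_mem /= /Kr /ballE; exact: chart_inv_continuous.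
    have -> : [set u | `|u - u0| <= r / 2] = closed_ball u0 (r / 2).
      rewrite closed_ballE ?divr_gt0 // /closed_ball_.
      by apply/seteqP; split => u /=; rewrite distrC.
    apply: bounded_closed_compact; last exact: closed_ball_closed.
    rewrite closed_ballE ?divr_gt0 //.
    exists (`|u0| + r / 2); split; first exact: num_real.
    move=> x hx v /= hv; apply: le_trans (ltW hx).
    by rewrite -[v](subKr u0) (le_trans (ler_normB _ _)) // lerD2l.
  have KS : K `<=` S.
    by move=> _ [u ur <-]; have [] := chart_invP _ _ (ballE u (Kr u ur)) => iu E;
      split => //; rewrite E; exact: Kr.
  apply: KS; apply: (@closed_cvg _ _ (s1^'-) _ gamma K cK _ (gamma s1)); last first.
    exact/cvg_at_left_filter/gc.
  near=> s.
  have s01 : 0 <= s < s1.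
    by apply/andP; split; near: s; [exact: nbhs_left_ge|exact: nbhs_left_lt].
  have /andP[s0 ss1] := s01.
  have Sg := below s s01; exists (chart i (gamma s)); last exact: chartK Sg.1.
  have s1' : s <= 1.
    by apply: le_trans (ltW ss1) _; apply: le_trans s1t _; case/andP: t01.
  apply: le_trans (bound s _ _) _; first by rewrite s0.
    by move=> s' /andP[s'0 s's]; apply: below; rewrite s'0 (le_lt_trans s's).
  by apply: le_trans (ltW Br); exact: ler_piMr.
have /nbhs_ballP[e /= e0 He] : nbhs s1 (gamma @^-1` S) by apply: gc; exact: S_nbhs.
have [s [s01 nS] se] := inf_adherent e0 infX.
have s1s : s1 <= s by apply: ge_inf; [exists 0|split].
apply: nS; apply: He; rewrite -ball_normE /ball_ /= distrC ger0_norm ?subr_ge0 //.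
by rewrite ltrBlDl.
Unshelve. all: by end_near. Qed.

End LocalControl.

Section Directions.
Context {R : realType} {M : riemannian_manifold R}.
Implicit Types (p q : M) (i j : atlas M) (gamma : R -> M) (u : 'rV[R]_(Defs.dim M)).

Lemma norm_le_of_sqr (x b : R) : 0 <= b -> x ^+ 2 <= b ^+ 2 -> `|x| <= b.
Proof.
by move=> b0 h; rewrite -(@ler_pXn2r _ 2) ?nnegrE // real_normK ?num_real.
Qed.

(** A second-order expansion uniform over all short geodesics leaving p: it says that in the chart
    the endpoint differs from the initial velocity by a quadratic error, as a differential of the
    exponential map at 0 would. *)
Lemma geodesic_local i p : chart_dom i p -> exists C d : R, [/\ 0 < C, 0 < d &
  forall gamma, geodesic gamma -> gamma 0 = p -> norm_at (velocity gamma 0) < d ->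
  let sigma := norm_at (velocity gamma 0) in
  (forall t : R, 0 <= t <= 1 -> chart_dom i (gamma t) /\
     `|chart i (gamma t) - chart i p| <= C * sigma) /\
  `|chart i (gamma 1) - chart i p - vel i gamma 0| <= C * sigma ^+ 2].
Proof.
move=> ip; have [r [C [r0 C1 HC]]] := local_bounds i p ip.
have C0 : 0 < C by apply: lt_le_trans C1.
have C13 : C <= C ^+ 3 by rewrite -[leLHS]expr1 ler_weXn2l.
(* Coordinate speeds are at most [C * sigma] and the Christoffel symbols sum to at most C, so the
   coordinate acceleration is at most [C * (C * sigma) ^+ 2]. The bound on sigma makes
   [C * sigma < r / 2], which confines the geodesic to the chart. *)
exists (C ^+ 3), (r / 2 / C); split; [exact: exprn_gt0|by rewrite !divr_gt0|].
move=> gamma gg g0 hd sigma.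
have s0 : 0 <= sigma by exact: norm_at_ge0.
have Br : 0 <= C * sigma < r / 2.
  by rewrite mulr_ge0 ?(ltW C0) //= mulrC -ltr_pdivlMr.
have dg := geodesic_dcurve _ gg.
have velB k (t : R) : 0 <= t <= 1 -> chart_dom i (gamma t) ->
    `|chart i (gamma t) - chart i (gamma 0)| < r -> `|vel i gamma t 0 k| <= C * sigma.
  move=> t01 it; rewrite g0 => tr; have [_ _ hinv _] := HC _ tr.
  apply: norm_le_of_sqr; first by case/andP: Br.
  apply: le_trans (coord_sqr_le i _ _ k it) _.
  rewrite -(inner_velocity gamma i t dg it) (speed_const gamma t gg) -norm_at_sqr.
  rewrite exprMn mulrC; apply: ler_wpM2r; first exact: sqr_ge0.
  have := hinv k; rewrite chartK // => /le_trans; apply.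
  by rewrite -[leLHS]mulr1 expr2 ler_pM2l.
have i0 : chart_dom i (gamma 0) by rewrite g0.
have ballE u : `|u - chart i (gamma 0)| < r -> (chart i @` chart_dom i) u.
  by rewrite g0 => /HC[].
have inC := slow_geodesic_in_chart gamma i r (C * sigma) gg i0 r0 Br ballE velB.
have tr (t : R) : 0 <= t <= 1 -> `|chart i (gamma t) - chart i (gamma 0)| < r.
  move=> t01; have [_ h] := inC t t01; apply: le_lt_trans h _.
  apply: le_lt_trans (_ : C * sigma < r).
    by apply: ler_piMr; [case/andP: Br|case/andP: t01].
  case/andP: Br => _ /lt_trans; apply.
  by rewrite ltr_pdivrMr // ltr_pMr // ltr1n.
split.
  move=> t t01; have [it h] := inC t t01; split => //.
  rewrite g0 in h; apply: le_trans h _.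
  apply: le_trans (_ : C * sigma <= _); last exact: ler_wpM2r.
  by apply: ler_piMr; [case/andP: Br|case/andP: t01].
have sub (t s : R) : 0 <= t <= 1 -> 0 <= s <= t -> 0 <= s <= 1.
  by move=> /andP[_ t1] /andP[-> st]; rewrite (le_trans st).
have acc k (t : R) : 0 <= t <= 1 ->
    `|vel i gamma t 0 k - vel i gamma 0 0 k| <= C ^+ 3 * sigma ^+ 2.
  move=> t01; have /andP[t0 t1] := t01.
  apply: le_trans (_ : C ^+ 3 * sigma ^+ 2 * t <= _); last first.
    by apply: ler_piMr => //; rewrite mulr_ge0 ?sqr_ge0 // exprn_ge0 // ltW.
  apply: (mvt_le (fun s => vel i gamma s 0 k) (fun s => - \sum_a \sum_b
    christoffel i (gamma s) k a b * vel i gamma s 0 a * vel i gamma s 0 b)) => //.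
    move=> s st; have s01 := sub t s t01 st.
    by apply: vel_parallel => //; have [] := inC s s01.
  move=> s st; have s01 := sub t s t01 st; rewrite normrN.
  have [si _] := inC s s01; have srr := tr s s01.
  have [_ hG _ _] := HC _ (eq_ind _ (fun q => `|chart i (gamma s) - chart i q| < r) srr _ g0).
  apply: le_trans (_ : \sum_a \sum_b `|christoffel i (gamma s) k a b| * (C * sigma) ^+ 2 <= _).
    apply: le_trans (ler_norm_sum _ _ _) _; apply: ler_sum => a _.
    apply: le_trans (ler_norm_sum _ _ _) _; apply: ler_sum => b _.
    rewrite !normrM -mulrA expr2; apply: ler_wpM2l => //.
    by apply: ler_pM => //; exact: velB.
  under eq_bigr do rewrite -mulr_suml.
  rewrite -mulr_suml exprMn mulrA; apply: ler_wpM2r; first exact: sqr_ge0.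
  rewrite exprS; apply: ler_wpM2r; first exact: sqr_ge0.
  by have := hG k; rewrite chartK.
apply: norm_rV_le; first by rewrite mulr_ge0 ?sqr_ge0 // exprn_ge0 // ltW.
move=> k; rewrite -[leRHS]mulr1.
set v0 := vel i gamma 0 0 k.
have -> : (chart i (gamma 1) - chart i p - vel i gamma 0) 0 k =
    (Defs.coord i gamma k 1 - 1 * v0) - (Defs.coord i gamma k 0 - 0 * v0).
  rewrite /Defs.coord g0 mul1r mul0r subr0 addrAC.
  by rewrite [LHS]mxE [X in X + _]mxE [X in _ + X + _]mxE [X in _ + X]mxE.
apply: (mvt_le (fun s => Defs.coord i gamma k s - s * v0)
  (fun s => vel i gamma s 0 k - v0)) => //; last by move=> s; exact: acc.
move=> s s01; have [si _] := inC s s01; have [_ gd] := gg; have [d _ _] := gd i k s si.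
have d1 : is_derive s 1 (Defs.coord i gamma k) (vel i gamma s 0 k).
  by rewrite vel_coord derive1E; exact: derivableP.
have d2 : is_derive s 1 (fun r : R => r * v0) v0.
  have := is_deriveM (is_derive_id s 1) (is_derive_cst (v0 : R) s 1).
  by rewrite /GRing.scale /= mulr0 add0r mulr1.
exact: (is_deriveB d1 d2).
Qed.

(** The competing curve is the straight segment in the chart. As it must be defined and C^1 on the
    whole line without leaving the chart, it is run through with parameter [sin (pi / 2 * t)], which
    stays in [-1, 1]; this accounts for the factor [pi / 2] in the constant. *)
Lemma dist_chart_le i p : chart_dom i p -> exists C d : R, [/\ 0 < C, 0 < d &
  forall w, `|w| < d -> (chart i @` chart_dom i) (chart i p + w) /\
    dist p (chart_inv i (chart i p + w)) <= C * `|w|].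
Proof.
move=> ip; have [r [C [r0 C1 HC]]] := local_bounds i p ip.
have C0 : 0 < C by apply: lt_le_trans C1.
exists (pi / 2 * C), r; split; [by rewrite mulr_gt0 ?divr_gt0 ?pi_gt0|by []|].
move=> w wr; set u0 := chart i p in HC *.
pose th (t : R) : R := sin (pi / 2 * t); pose dth (t : R) : R := pi / 2 * cos (pi / 2 * t).
pose uu (t : R) := u0 + th t *: w.
have dthP (t : R) : is_derive t 1 th (dth t).
  have dl : is_derive t 1 (fun s : R => pi / 2 * s) (pi / 2).
    by have := is_derive_affine 0 (pi / 2) t; under eq_fun do rewrite add0r.
  by apply: is_derive_eq (is_derive1_comp (is_derive_sin _) dl) _; rewrite mulrC.
have uur t : `|uu t - u0| < r.
  rewrite /uu addrAC subrr add0r normrZ; apply: le_lt_trans wr.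
  by apply: ler_piMl => //; rewrite ler_norml sin_geN1 sin_le1.
have Eu t : (chart i @` chart_dom i) (uu t) by have [] := HC _ (uur t).
have thc : continuous th.
  by move=> t; apply: differentiable_continuous; apply/derivable1_diffP; have [] := dthP t.
have uc : continuous uu.
  move=> t; apply: cvgD; first exact: cvg_cst.
  by apply: cvgZ; [exact: thc|exact: cvg_cst].
pose c t := chart_inv i (uu t).
have cc : continuous c.
  move=> t; apply: (@continuous_comp _ _ _ uu (chart_inv i)); first exact: uc.
  exact/chart_inv_continuous/Eu.
have duu (t : R) k : is_derive t 1 (fun s => uu s 0 k) (dth t * w 0 k).
  have -> : (fun s => uu s 0 k) = (fun s => u0 0 k + th s * w 0 k).
    by apply/funext => s; rewrite !mxE.
  have e1 := is_deriveM (dthP t) (is_derive_cst (w 0 k : R) t 1).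
  apply: is_derive_eq (is_deriveD (is_derive_cst (u0 0 k : R) t 1) e1) _.
  by rewrite /GRing.scale /= mulr0 !add0r mulrC.
have dth_c : continuous dth.
  move=> t; apply: cvgM; first exact: cvg_cst.
  apply: (@continuous_comp _ _ _ ( *%R (pi / 2)) cos); last exact: continuous_cos.
  exact: mulrl_continuous.
have dc j k (t : R) : chart_dom j (c t) -> is_derive t 1 (Defs.coord j c k)
    (\sum_a dth t * w 0 a *
       'D_(delta_mx 0 a) (fun u => chart j (chart_inv i u) 0 k) (uu t)).
  move=> jt; apply: (@chain_curve _ _ _ (fun u => chart j (chart_inv i u) 0 k) uu
    (fun a => dth t * w 0 a) t (chart_image_openI i _ (chart_dom_open M j)) _ _ (duu t)).
    exact: (transition_smooth M i j k 1%N).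
  by exists (c t); [split => //|]; have [] := chart_invP _ _ (Eu t).
have cC1 : C1_curve c.
  split; first exact: cc.
  move=> j k t jt; split; first by have [] := dc j k t jt.
  have E : \forall s \near t, \sum_a dth s * w 0 a *
       'D_(delta_mx 0 a) (fun u => chart j (chart_inv i u) 0 k) (uu s) =
      derive1 (Defs.coord j c k) s.
    apply: filterS (near_dom _ _ _ cc jt) => s js.
    by rewrite derive1E; have [_ ->] := dc j k s js.
  apply: cvg_trans (near_eq_cvg E) _; rewrite -(nbhs_singleton E).
  apply: (@cvg_bigsum _ _ (nbhs t) _) => a; apply: cvgM.
    by apply: cvgM; [exact: dth_c|exact: cvg_cst].
  apply: (@continuous_comp _ _ _ uu
    ('D_(delta_mx 0 a) (fun u => chart j (chart_inv i u) 0 k))); first exact: uc.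
  apply: (Ck_continuous (Ck_D a (transition_smooth M i j k 1%N))).
  by exists (c t); [split => //|]; have [] := chart_invP _ _ (Eu t).
have ci t : chart_dom i (c t) by have [] := chart_invP _ _ (Eu t).
have velE t : vel i c t = dth t *: w.
  apply/rowP => k; rewrite !mxE derive1E.
  have -> : Defs.coord i c k = (fun s => uu s 0 k).
    by apply/funext => s; rewrite /Defs.coord; have [_ ->] := chart_invP _ _ (Eu s).
  by have [_ ->] := duu t k.
split.
  have := Eu 1; rewrite /uu /th mulr1 sin_pihalf scale1r; exact.
have <- : c 0 = p by rewrite /c /uu /th mulr0 sin0 scale0r addr0 chartK.
have -> : u0 + w = uu 1 by rewrite /uu /th mulr1 sin_pihalf scale1r.
apply: le_trans (dist_le_length _ cC1) _; apply: length_le => // t _.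
rewrite -[leRHS]ger0_norm ?mulr_ge0 ?divr_ge0 ?pi_ge0 ?(ltW C0) //.
rewrite -sqrtr_sqr /norm_at ler_wsqrtr // (inner_velocity c i t (C1_dcurve _ cC1)) //.
have [_ _ _ hG] := HC _ (uur t).
rewrite velE innE; apply: le_trans (ler_norm _) _.
apply: le_trans (_ : \sum_a \sum_b `|gmx i (c t) a b| * ((pi / 2) ^+ 2 * `|w| ^+ 2) <= _).
  apply: le_trans (ler_norm_sum _ _ _) _; apply: ler_sum => a _.
  apply: le_trans (ler_norm_sum _ _ _) _; apply: ler_sum => b _.
  have dw k : `|(dth t *: w) 0 k| <= pi / 2 * `|w|.
    rewrite mxE normrM; apply: ler_pM => //; last exact: norm_coord_le.
    rewrite /dth normrM ger0_norm ?divr_ge0 ?pi_ge0 //.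
    by apply: ler_piMr; rewrite ?divr_ge0 ?pi_ge0 // ler_norml cos_geN1 cos_le1.
  rewrite !normrM [`|_| * `|gmx _ _ _ _|]mulrC -mulrA; apply: ler_wpM2l => //.
  by rewrite -exprMn expr2; apply: ler_pM.
under eq_bigr do rewrite -mulr_suml.
rewrite -mulr_suml -exprMn.
have -> : (pi / 2 * C * `|w|) ^+ 2 = C ^+ 2 * (pi / 2 * `|w|) ^+ 2.
  by move: (pi / 2) `|w| => x y; ring.
apply: ler_wpM2r; first exact: sqr_ge0.
apply: le_trans hG _.
by rewrite -[leLHS]mulr1 expr2 ler_pM2l.
Qed.

(* The minimizing geodesics from p to the points of U near p leave p in a dense set
   of directions. *)
Lemma direction_dense (U : set M) i p (Phi : 'rV[R]_(Defs.dim M) -> R) w :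
  geodesically_convex U -> interior U p -> chart_dom i p ->
  {for w, continuous Phi} ->
  (forall gamma q (s : R), U q -> minimizing_geodesic p q gamma -> 0 < s ->
     0 <= Phi (s^-1 *: vel i gamma 0)) ->
  0 <= Phi w.
Proof.
move=> U_convex Up ip Phic Phi0; rewrite leNgt; apply/negP => Pw.
have [C1 [d1 [C10 d10 geo]]] := geodesic_local i p ip.
have [C2 [d2 [C20 d20 dst]]] := dist_chart_le i p ip.
have nPhi : \forall v \near w, Phi v < 0 by exact: (cvgr_lt _ Phic).
move/nbhs_ballP: nPhi => [e /= e0 He].
set u0 := chart i p in dst.
have nU : nbhs u0 (chart_inv i @^-1` U).
  have := chart_inv_continuous _ _ _ (chart_image _ _ ip).
  by apply; rewrite chartK.
move/nbhs_ballP: nU => [r /= r0 Hr].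
pose b := `|w| + 1.
have b0 : 0 < b by rewrite ltr_wpDl.
have wb : `|w| < b by rewrite ltrDl.
(* The four bounds on s ensure, in this order, that the chart point is within reach of
   [dist_chart_le], that q lies in U, that the geodesic to q is short enough for [geodesic_local],
   and that its rescaled initial velocity is e-close to w. *)
pose m := Num.min (Num.min (d2 / b) (r / b)) (Num.min (d1 / (C2 * b)) (e / (C1 * (C2 * b) ^+ 2))).
have m0 : 0 < m by rewrite !lt_min !divr_gt0 ?mulr_gt0 // exprn_gt0 // mulr_gt0.
pose s := m / 2.
have s0 : 0 < s by rewrite divr_gt0.
have : s < m by rewrite ltr_pdivrMr // ltr_pMr // ltr1n.
rewrite !lt_min => /andP[/andP[sd2 sr] /andP[sd1 se]].
rewrite !ltr_pdivlMr ?mulr_gt0 ?exprn_gt0 // in sd2 sr sd1 se.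
have nsw : `|s *: w| = s * `|w| by rewrite normrZ gtr0_norm.
have swb : s * `|w| <= s * b by rewrite ler_pM2l // ltW.
have [Eq dq] : (chart i @` chart_dom i) (u0 + s *: w) /\
    dist p (chart_inv i (u0 + s *: w)) <= C2 * `|s *: w|.
  by apply: dst; rewrite nsw (le_lt_trans swb).
set q := chart_inv i (u0 + s *: w) in dq.
have Uq : U q.
  apply: Hr; rewrite -ball_normE /ball_ /= opprD addrA subrr sub0r normrN nsw.
  exact: le_lt_trans sr.
have pU : U p by exact: interior_subset.
have [gamma gm] := convex_geodesic U U_convex p q pU Uq.
have [gg g0 g1 _] := gm; have sp := minimizing_speed p q gamma 0 gm.
have dqs : dist p q <= s * (C2 * b).
  by apply: le_trans dq _; rewrite nsw mulrCA ler_pM2l // ler_pM2l // ltW.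
have hd : norm_at (velocity gamma 0) < d1 by rewrite sp (le_lt_trans dqs).
have [_ hv] := geo gamma gg g0 hd.
have := Phi0 gamma q s Uq gm s0; rewrite leNgt => /negP; apply.
apply: He; rewrite -ball_normE /ball_ /=.
have -> : w - s^-1 *: vel i gamma 0 = s^-1 *: (chart i (gamma 1) - u0 - vel i gamma 0).
  rewrite g1 /q; have [_ ->] := chart_invP _ _ Eq.
  by rewrite [u0 + _]addrC addrK scalerBr scalerA mulVf ?scale1r // gt_eqF.
rewrite normrZ normfV gtr0_norm // ltr_pdivrMl //.
apply: le_lt_trans hv _; rewrite sp.
apply: le_lt_trans (_ : C1 * (s * (C2 * b)) ^+ 2 < _).
  by rewrite ler_pM2l // ler_pXn2r ?nnegrE ?dist_ge0 // mulr_ge0 ?mulr_ge0 ?ltW.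
have -> : C1 * (s * (C2 * b)) ^+ 2 = s * (s * (C1 * (C2 * b) ^+ 2)) by ring.
by rewrite ltr_pM2l.
Qed.

End Directions.

(** * Gradients, Hessians and strong convexity *)

Section Bounds.
Context {R : realType} {M : riemannian_manifold R}.
Implicit Types (p q : M) (i j : atlas M) (gamma : R -> M) (u : 'rV[R]_(Defs.dim M)).

Lemma derive_le_right (f : R -> R) (df c : R) : is_derive (0 : R) 1 f df ->
  (forall s : R, 0 < s <= 1 -> f s - f 0 <= c * s) -> df <= c.
Proof.
move=> [dfE dfv] h; rewrite leNgt; apply/negP => cdf.
have L : s^-1 *: (f (s *: 1 + 0) - f 0) @[s --> (0 : R)^'] --> df.
  by rewrite -dfv; exact: dfE.
have : \forall s \near (0 : R)^', c < s^-1 *: (f (s *: 1 + 0) - f 0) by exact: (cvgr_gt _ L).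
move=> /nbhs_ballP[e /= e0 He].
pose s := Num.min e 1 / 2.
have m0 : 0 < Num.min e 1 by rewrite lt_min e0 ltr01.
have s0 : 0 < s by rewrite divr_gt0.
have sm : s < Num.min e 1 by rewrite ltr_pdivrMr // ltr_pMr // ltr1n.
move: sm; rewrite lt_min => /andP[se s1].
have := He s; rewrite -ball_normE /ball_ /= sub0r normrN gtr0_norm //.
move=> /(_ se (lt0r_neq0 s0)); rewrite addr0.
have -> : s *: 1 = s :> R^o by exact: mulr1.
apply/negP; rewrite -leNgt /GRing.scale /= mulrC ler_pdivrMr //.
by apply: h; rewrite s0 ltW.
Qed.

Lemma derive_ge_right (f : R -> R) (df c : R) : is_derive (0 : R) 1 f df ->
  (forall s : R, 0 < s <= 1 -> c * s <= f s - f 0) -> c <= df.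
Proof.
move=> d h; rewrite -lerN2.
have dN : is_derive (0 : R) 1 (fun s => - f s) (- df) by exact: (is_deriveN d).
apply: (derive_le_right _ _ _ dN).
by move=> s /h; rewrite mulNr; move: (f s) (f 0) (c * s) => x y z; lra.
Qed.

Variable U : set M.
Hypothesis U_convex : geodesically_convex U.
Hypothesis U_regular : U `<=` closure (interior U).

Lemma closure_ge0 i p (D : set 'rV[R]_(Defs.dim M)) (psi : 'rV[R]_(Defs.dim M) -> R) :
  U p -> chart_dom i p -> open D -> D (chart i p) ->
  {for chart i p, continuous psi} ->
  (forall q, interior U q -> chart_dom i q -> D (chart i q) -> 0 <= psi (chart i q)) ->
  0 <= psi (chart i p).
Proof.
move=> pU ip oD Dp psic h; rewrite leNgt; apply/negP => neg.
have n1 : nbhs (chart i p) [set u | psi u < 0 /\ D u].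
  apply: filterI; first exact: (cvgr_lt _ psic).
  exact: open_nbhs_nbhs.
have n2 : nbhs p [set q | psi (chart i q) < 0 /\ D (chart i q)].
  exact: (chart_continuous M i p ip _ n1).
have n3 : nbhs p (chart_dom i).
  by apply: open_nbhs_nbhs; split => //; exact: chart_dom_open.
have [q [qU [[/= neg_q Dq] iq]]] := U_regular _ pU _ (filterI n2 n3).
by have := h q qU iq Dq; rewrite leNgt neg_q.
Qed.

Lemma inn_scale i p (c : R) (v : 'rV[R]_(Defs.dim M)) :
  inn i p (c *: v) (c *: v) = c ^+ 2 * inn i p v v.
Proof.
rewrite !innE mulr_sumr; apply: eq_bigr => a _; rewrite mulr_sumr.
by apply: eq_bigr => b _; rewrite !mxE; ring.
Qed.

Lemma continuous_inn i p : continuous (fun v : 'rV[R]_(Defs.dim M) => inn i p v v).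
Proof.
move=> v.
suff H : {for v, continuous (fun v : 'rV[R]_(Defs.dim M) =>
    \sum_a \sum_b v 0 a * gmx i p a b * v 0 b)}.
  by apply: (eq_continuous_at _ _ _ _ _ H) => w; rewrite innE.
do 2 (apply: (@cvg_bigsum _ _ (nbhs v) _) => ?).
apply: cvgM; last exact: coord_continuous.
by apply: cvgM; [exact: coord_continuous|exact: cvg_cst].
Qed.

Lemma continuous_inn_base i u (w : 'rV[R]_(Defs.dim M)) : (chart i @` chart_dom i) u ->
  {for u, continuous (fun u => inn i (chart_inv i u) w w)}.
Proof.
move=> Eu.
suff H : {for u, continuous
    (fun u : 'rV[R]_(Defs.dim M) =>
       \sum_a \sum_b w 0 a * gmx i (chart_inv i u) a b * w 0 b)}.
  by apply: (eq_continuous_at _ _ _ _ _ H) => ?; rewrite innE.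
do 2 (apply: (@cvg_bigsum _ _ (nbhs u) _) => ?).
apply: cvgM; last exact: cvg_cst.
by apply: cvgM; [exact: cvg_cst|exact: continuous_gmx].
Qed.

(** At an interior point, differentiating h along a minimizing geodesic gives the inequality for its
    initial velocity. Both sides are homogeneous of degree 1, so it holds for all positive
    multiples, then for every w by density of directions, and at points of U by closure. An
    arbitrary fixed chart is used because base points vary in the closure argument. *)
Lemma lipschitz_pd i p (D : set 'rV[R]_(Defs.dim M)) (h : M -> R) (l : R)
    (w : 'rV[R]_(Defs.dim M)) :
  0 <= l -> (forall q q', U q -> U q' -> `|h q - h q'| <= l * dist q q') ->
  U p -> chart_dom i p -> open D -> D (chart i p) -> Ck 1 D (h \o chart_inv i) ->
  \sum_a w 0 a * pd i a h p <= l * Num.sqrt (inn i p w w).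
Proof.
move=> l0 hl pU ip oD Dp hD; rewrite -subr_ge0.
pose psi u := l * Num.sqrt (inn i (chart_inv i u) w w)
  - \sum_a w 0 a * pd i a h (chart_inv i u).
suff : 0 <= psi (chart i p) by rewrite /psi chartK.
apply: (closure_ge0 i p D) => //.
  set u0 := chart i p in Dp *; have Eu : (chart i @` chart_dom i) u0 by exact: chart_image.
  have c1 : Num.sqrt (inn i (chart_inv i u) w w) @[u --> u0] -->
      Num.sqrt (inn i (chart_inv i u0) w w).
    apply: (@continuous_comp _ _ _ (fun u => inn i (chart_inv i u) w w) Num.sqrt);
      last exact: sqrt_continuous.
    exact: continuous_inn_base.
  have c2 : \sum_a w 0 a * pd i a h (chart_inv i u) @[u --> u0] -->
      \sum_a w 0 a * pd i a h (chart_inv i u0).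
    apply: (@cvg_bigsum _ _ (nbhs u0) _) => a.
    by apply: cvgM; [exact: cvg_cst|exact: (continuous_pd i a D h _ Eu)].
  exact: (cvgB (cvgM (cvg_cst (l : R)) c1) c2).
move=> q qU iq Dq; rewrite /psi chartK //.
pose Phi (v : 'rV[R]_(Defs.dim M)) := l * Num.sqrt (inn i q v v) - \sum_a v 0 a * pd i a h q.
apply: (direction_dense U i q Phi w U_convex qU iq).
  have c1 : Num.sqrt (inn i q v v) @[v --> w] --> Num.sqrt (inn i q w w).
    apply: (@continuous_comp _ _ _ (fun v => inn i q v v) Num.sqrt);
      last exact: sqrt_continuous.
    exact: continuous_inn.
  have c2 : \sum_a v 0 a * pd i a h q @[v --> w] --> \sum_a w 0 a * pd i a h q.
    apply: (@cvg_bigsum _ _ (nbhs w) _) => a.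
    by apply: cvgM; [exact: coord_continuous|exact: cvg_cst].
  exact: (cvgB (cvgM (cvg_cst (l : R)) c1) c2).
move=> gamma q' s q'U gm s0; have [gg g0 g1 _] := gm.
have qU' : U q by exact: interior_subset.
have dg := geodesic_dcurve _ gg.
have i0 : chart_dom i (gamma 0) by rewrite g0.
have D0 : D (chart i (gamma 0)) by rewrite g0.
have dh := derive_comp_curve gamma i 0 D h dg i0 oD D0 hD.
have le1 : \sum_a vel i gamma 0 0 a * pd i a h (gamma 0) <= l * dist q q'.
  apply: derive_le_right dh _ => r /andP[r0 r1] /=.
  apply: le_trans (ler_norm _) _.
  have rU : U (gamma r) by apply: (convex_geodesic_in U U_convex q q' gamma) => //; rewrite ltW.
  apply: le_trans (hl _ _ rU _) _; first by rewrite g0.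
  rewrite -mulrA; apply: ler_wpM2l => //.
  apply: le_trans (dist_minimizing_le q q' gamma r 0 gm) _.
  by rewrite sub0r normrN gtr0_norm // mulrC.
rewrite /Phi inn_scale sqrtrM ?sqr_ge0 // sqrtr_sqr gtr0_norm ?invr_gt0 //.
have -> : \sum_a (s^-1 *: vel i gamma 0) 0 a * pd i a h q =
    s^-1 * \sum_a vel i gamma 0 0 a * pd i a h q.
  by rewrite mulr_sumr; apply: eq_bigr => a _; rewrite mxE mulrA.
rewrite mulrCA -mulrBr; apply: mulr_ge0; first by rewrite invr_ge0 ltW.
have <- : dist q q' = Num.sqrt (inn i q (vel i gamma 0) (vel i gamma 0)).
  rewrite -(minimizing_speed q q' gamma 0 gm) /norm_at (inner_velocity gamma i 0) //.
  by rewrite g0.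
by rewrite g0 in le1; rewrite subr_ge0.
Qed.

Lemma inner_grad h p (w : 'rV[R]_(Defs.dim M)) :
  @inner R M p (grad h p) w = \sum_a w 0 a * pd (chart_at p) a h p.
Proof.
rewrite /inner /grad /grad_in mulmxKV; last exact/gmx_unit/chart_at_dom.
by rewrite mxE; apply: eq_bigr => a _; rewrite !mxE mulrC.
Qed.

Lemma norm_grad_le p (D : set 'rV[R]_(Defs.dim M)) (h : M -> R) (l : R) :
  0 <= l -> (forall q q', U q -> U q' -> `|h q - h q'| <= l * dist q q') ->
  U p -> open D -> D (chart (chart_at p) p) -> Ck 1 D (h \o chart_inv (chart_at p)) ->
  norm_at (grad h p) <= l.
Proof.
move=> l0 hl pU oD Dp hD.
have := lipschitz_pd _ p D h l (grad h p) l0 hl pU (chart_at_dom M p) oD Dp hD.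
rewrite -inner_grad -norm_at_sqr -/(norm_at (grad h p)) expr2.
have [->//|n0] := eqVneq (norm_at (grad h p)) 0.
by rewrite ler_pM2r // lt_def n0 norm_at_ge0.
Qed.

End Bounds.

(** * Second derivatives along geodesics *)

Section Hessian.
Context {R : realType} {M : riemannian_manifold R}.
Implicit Types (p q : M) (i j : atlas M) (gamma : R -> M) (u : 'rV[R]_(Defs.dim M)).

Lemma eq_Ck n k (D : set 'rV[R]_n) (f g : 'rV[R]_n -> R) : open D ->
  (forall w, D w -> f w = g w) -> Ck k D f -> Ck k D g.
Proof.
move=> oD; elim: k f g => [|k IH] f g fg [fc fd].
  split => // w Dw; have E : \forall v \near w, f v = g v.
    by apply: filterS fg _; exact: (open_nbhs_nbhs (conj oD Dw)).
  apply: cvg_trans (near_eq_cvg E) _; rewrite -(nbhs_singleton E); exact: fc.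
have E w : D w -> \forall v \near w, f v = g v.
  by move=> Dw; apply: filterS fg _; exact: (open_nbhs_nbhs (conj oD Dw)).
split.
  move=> u Du; apply: cvg_trans (near_eq_cvg (E u Du)) _.
  by rewrite -(nbhs_singleton (E u Du)); exact: fc.
move=> a; have [da Da] := fd a; split.
  by move=> u Du; apply: near_eq_derivable (E u Du) (da u Du).
apply: IH Da => u Du; exact: near_eq_derive (E u Du).
Qed.

Lemma Ck_pd k i l (D : set 'rV[R]_(Defs.dim M)) (h : M -> R) : open D ->
  D `<=` chart i @` chart_dom i -> Ck k.+1 D (h \o chart_inv i) ->
  Ck k D (pd i l h \o chart_inv i).
Proof.
move=> oD DE hD; apply: eq_Ck (Ck_D l hD) => // u /DE Eu.
by rewrite /= pdE.
Qed.

(** The two first-order forms of strong convexity. They are expressed through derivatives at the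
    ends of the geodesic and thus do not refer to gradients. *)
Lemma strong_convexity_endpoints (U : set M) (mu : R) h p q gamma (d0 d1 : R) :
  strongly_convex mu U h -> U p -> U q -> minimizing_geodesic p q gamma ->
  is_derive (0 : R) 1 (h \o gamma) d0 -> is_derive (1 : R) 1 (h \o gamma) d1 ->
  d0 <= h q - h p - mu / 2 * dist p q ^+ 2 /\
  h q - h p <= d1 - mu / 2 * dist p q ^+ 2.
Proof.
move=> hsc pU qU gm e0 e1; have [_ g0 g1 _] := gm.
have sc := hsc p q gamma pU qU gm; set d := dist p q in sc *.
have dsq (c : R) : is_derive (0 : R) 1 (fun s : R => c * (s * s)) 0.
  have e := is_deriveM (is_derive_id (0 : R) 1) (is_derive_id (0 : R) 1).
  apply: is_derive_eq (is_deriveZ c e) _.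
  by rewrite /GRing.scale /= mul0r addr0 mulr0.
split.
  (* Moving the square part of [s * (1 - s)] to the left leaves a right-hand side affine in s, while
     the added term has derivative 0 at 0. *)
  have e : is_derive (0 : R) 1 (fun s => h (gamma s) - mu / 2 * d ^+ 2 * (s * s)) d0.
    by apply: is_derive_eq (is_deriveB e0 (dsq (mu / 2 * d ^+ 2))) _; rewrite subr0.
  apply: (derive_le_right _ _ _ e) => s /andP[s0 s1].
  have := sc s; rewrite s1 ltW // => /(_ isT); rewrite g0.
  by move: (h (gamma s)) (h p) (h q) (d ^+ 2) => x y z w; lra.
have e : is_derive (0 : R) 1 (fun s => h (gamma (1 + -1 * s)) - mu / 2 * d ^+ 2 * (s * s)) (- d1).
  have a := is_derive_affine (1 : R) (-1) 0.
  have e1' : is_derive (1 + -1 * 0 : R) 1 (h \o gamma) d1 by rewrite mulr0 addr0.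
  have e2 : is_derive (0 : R) 1 (fun s : R => h (gamma (1 + -1 * s))) (d1 * -1).
    exact: (@is_derive1_comp R (h \o gamma) (fun s => 1 + -1 * s) 0 d1 (-1) e1' a).
  apply: is_derive_eq (is_deriveB e2 (dsq (mu / 2 * d ^+ 2))) _.
  by rewrite subr0 mulrN1.
suff : - d1 <= h p - h q - mu / 2 * d ^+ 2.
  by move: (h p) (h q) (d ^+ 2) => y z w; lra.
apply: (derive_le_right _ _ _ e) => s /andP[s0 s1].
have := sc (1 + -1 * s); rewrite mulN1r subr_ge0 s1 lerBlDr lerDl ltW //= => /(_ isT).
rewrite mulr0 addr0 g1.
by move: (h (gamma _)) (h p) (h q) (d ^+ 2) => x y z w; lra.
Qed.

Definition hessform i (h : M -> R) p (w : 'rV[R]_(Defs.dim M)) : R :=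
  \sum_a \sum_l w 0 a * w 0 l *
    (pd i a (pd i l h) p - \sum_c christoffel i p c a l * pd i c h p).

Lemma second_derive_geodesic i h gamma (t : R) (D : set 'rV[R]_(Defs.dim M)) :
  geodesic gamma -> chart_dom i (gamma t) -> open D ->
  D `<=` chart i @` chart_dom i -> D (chart i (gamma t)) ->
  Ck 2 D (h \o chart_inv i) ->
  is_derive t 1 (fun s => \sum_l vel i gamma s 0 l * pd i l h (gamma s))
    (hessform i h (gamma t) (vel i gamma t)).
Proof.
move=> gg it oD DE Dt hD; have dg := geodesic_dcurve _ gg.
set p := gamma t; set v := vel i gamma t.
have dl l := is_deriveM (vel_parallel gamma i l t gg it)
  (derive_comp_curve gamma i t D (pd i l h) dg it oD Dt (Ck_pd 1 i l D h oD DE hD)).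
apply: is_derive_eq (is_derive_bigsum _ _ _ _ dl) _.
rewrite -/p -/v /hessform.
transitivity (\sum_l \sum_a (v 0 a * v 0 l * pd i a (pd i l h) p) -
   \sum_l \sum_a \sum_b christoffel i p l a b * v 0 a * v 0 b * pd i l h p).
  rewrite -sumrB; apply: eq_bigr => l _; rewrite /GRing.scale /= mulrN; congr (_ - _).
    by rewrite mulr_sumr; apply: eq_bigr => a _; rewrite mulrCA mulrA.
  rewrite mulr_sumr; apply: eq_bigr => a _; rewrite mulr_sumr.
  by apply: eq_bigr => b _; rewrite mulrC.
have -> : \sum_l \sum_a \sum_b christoffel i p l a b * v 0 a * v 0 b * pd i l h p =
   \sum_a \sum_b \sum_l christoffel i p l a b * v 0 a * v 0 b * pd i l h p.
  rewrite exchange_big /=; apply: eq_bigr => a _; exact: exchange_big.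
rewrite exchange_big /= -sumrB; apply: eq_bigr => a _.
rewrite -sumrB; apply: eq_bigr => l _; rewrite mulrBr; congr (_ - _).
rewrite mulr_sumr; apply: eq_bigr => c _.
by move: (christoffel _ _ _ _ _) (pd _ _ _ _) (v 0 a) (v 0 l) => x y z w; ring.
Qed.

Lemma continuous_hessform i h u (D : set 'rV[R]_(Defs.dim M)) w :
  open D -> D `<=` chart i @` chart_dom i -> D u -> Ck 2 D (h \o chart_inv i) ->
  hessform i h (chart_inv i u') w @[u' --> u] --> hessform i h (chart_inv i u) w.
Proof.
move=> oD DE Du hD; have Eu := DE _ Du.
apply: (@cvg_bigsum _ _ (nbhs u) _) => a; apply: (@cvg_bigsum _ _ (nbhs u) _) => l.
have c1 := continuous_pd i a D (pd i l h) u Eu Du (Ck_pd 1 i l D h oD DE hD).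
have c2 : \sum_c christoffel i (chart_inv i u') c a l * pd i c h (chart_inv i u') @[u' --> u]
    --> \sum_c christoffel i (chart_inv i u) c a l * pd i c h (chart_inv i u).
  apply: (@cvg_bigsum _ _ (nbhs u) _) => c.
  apply: cvgM; first exact: continuous_christoffel.
  exact: (continuous_pd i c D h u Eu Du (Ck_le _ hD)).
exact: (cvgM (cvg_cst (w 0 a * w 0 l : R)) (cvgB c1 c2)).
Qed.

(** The scheme of [lipschitz_pd], for forms homogeneous of degree 2: first geodesic directions at
    interior points, then all directions, then the closure. *)
Lemma hessform_ge (U : set M) (mu : R) i h p (D : set 'rV[R]_(Defs.dim M)) w :
  geodesically_convex U -> U `<=` closure (interior U) ->
  strongly_convex mu U h -> U p -> chart_dom i p -> open D ->
  D `<=` chart i @` chart_dom i -> D (chart i p) -> Ck 2 D (h \o chart_inv i) ->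
  mu * inn i p w w <= hessform i h p w.
Proof.
move=> U_convex U_regular hsc pU ip oD DE Dp hD; rewrite -subr_ge0.
pose psi u := hessform i h (chart_inv i u) w - mu * inn i (chart_inv i u) w w.
suff : 0 <= psi (chart i p) by rewrite /psi chartK.
apply: (closure_ge0 U U_regular i p D) => //.
  have c1 := continuous_hessform i h (chart i p) D w oD DE Dp hD.
  have c2 := continuous_inn_base i (chart i p) w (chart_image _ _ ip).
  exact: (cvgB c1 (cvgM (cvg_cst (mu : R)) c2)).
move=> q qU iq Dq; rewrite /psi chartK //.
pose Phi (v : 'rV[R]_(Defs.dim M)) := hessform i h q v - mu * inn i q v v.
apply: (direction_dense U i q Phi w U_convex qU iq).
  have c1 : hessform i h q v @[v --> w] --> hessform i h q w.
    do 2 (apply: (@cvg_bigsum _ _ (nbhs w) _) => ?).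
    apply: cvgM; last exact: cvg_cst.
    by apply: cvgM; exact: coord_continuous.
  exact: (cvgB c1 (cvgM (cvg_cst (mu : R)) (continuous_inn i q w))).
move=> gamma q' s q'U gm s0; have [gg g0 g1 _] := gm.
have qU' : U q by exact: interior_subset.
have dg := geodesic_dcurve _ gg; have [gc _] := gg.
rewrite /Phi inn_scale.
have -> : hessform i h q (s^-1 *: vel i gamma 0) =
    s^-1 ^+ 2 * hessform i h q (vel i gamma 0).
  rewrite /hessform mulr_sumr; apply: eq_bigr => a _; rewrite mulr_sumr.
  by apply: eq_bigr => l _; rewrite !mxE; ring.
rewrite mulrCA -mulrBr; apply: mulr_ge0; first exact: sqr_ge0.
rewrite subr_ge0.
have i0 : chart_dom i (gamma 0) by rewrite g0.
have D0 : D (chart i (gamma 0)) by rewrite g0.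
have -> : inn i q (vel i gamma 0) (vel i gamma 0) = dist q q' ^+ 2.
  rewrite -(minimizing_speed q q' gamma 0 gm) norm_at_sqr (inner_velocity gamma i 0) //.
  by rewrite g0.
have d2 := second_derive_geodesic i h gamma 0 D gg i0 oD DE D0 hD.
have -> : hessform i h q (vel i gamma 0) = hessform i h (gamma 0) (vel i gamma 0).
  by rewrite g0.
(* phi' (r) - phi' (0) >= mu d^2 r for small r, by strong convexity on [gamma 0, gamma r]. *)
pose dphi (r : R) := \sum_l vel i gamma r 0 l * pd i l h (gamma r).
have dphiP (r : R) : chart_dom i (gamma r) -> D (chart i (gamma r)) ->
    is_derive r 1 (h \o gamma) (dphi r).
  by move=> ir Dr; exact: (derive_comp_curve gamma i r D h dg ir oD Dr (Ck_le _ hD)).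
have grow (r : R) : 0 < r <= 1 -> chart_dom i (gamma r) -> D (chart i (gamma r)) ->
    mu * dist q q' ^+ 2 * r <= dphi r - dphi 0.
  move=> /andP[r0 r1] ir Dr; have r01 : 0 <= r <= 1 by rewrite ltW.
  have bm := minimizing_backward U U_convex q q' gamma r qU' q'U gm r01.
  have rU : U (gamma r) by exact: (convex_geodesic_in U U_convex q q' gamma).
  have U0 : U (gamma 0) by rewrite g0.
  have e1 : is_derive (1 : R) 1 (h \o (gamma \o (fun s => r + - r * s))) (dphi 0 * - r).
    have e : is_derive (r + - r * 1) 1 (h \o gamma) (dphi 0).
      by rewrite mulr1 subrr; exact: dphiP.
    exact: (@is_derive1_comp R (h \o gamma) (fun s => r + - r * s) 1 _ _ e
      (is_derive_affine r (- r) 1)).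
  have e0 : is_derive (0 : R) 1 (h \o (gamma \o (fun s => r + - r * s))) (dphi r * - r).
    have e : is_derive (r + - r * 0) 1 (h \o gamma) (dphi r).
      by rewrite mulr0 addr0; exact: dphiP.
    exact: (@is_derive1_comp R (h \o gamma) (fun s => r + - r * s) 0 _ _ e
      (is_derive_affine r (- r) 0)).
  have [h0 h1] := strong_convexity_endpoints U mu h _ _ _ _ _ hsc rU U0 bm e0 e1.
  have dr : dist (gamma r) (gamma 0) = r * dist q q'.
    rewrite -(minimizing_speed _ _ _ 0 bm).
    rewrite (velocity_reparam _ _ _ _ dg (is_derive_affine r (- r) 0)).
    by rewrite norm_atZ normrN gtr0_norm // (minimizing_speed _ _ _ (r + - r * 0) gm).
  rewrite -(@ler_pM2l _ r) //; move: h0 h1; rewrite dr exprMn.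
  move: (h (gamma 0)) (h (gamma r)) (dist q q' ^+ 2) (dphi r) (dphi 0) => x y z X Y.
  move=> h0 h1; have : mu * (r ^+ 2 * z) <= r * X - r * Y by lra.
  by rewrite mulrBr; congr (_ <= _); ring.
have nearD : \forall r \near (0 : R), chart_dom i (gamma r) /\ D (chart i (gamma r)).
  apply: filterI; first exact: near_dom.
  have nD : nbhs (chart i (gamma 0)) D by exact: open_nbhs_nbhs.
  have n1 : nbhs (gamma 0) (chart i @^-1` D) := chart_continuous M i _ i0 _ nD.
  exact: (gc 0 _ n1).
move/nbhs_ballP: nearD => [e /= e0 He].
(* [derive_ge_right] asks for an inequality on all of (0, 1], while [grow] is available only near 0
   and up to time 1; slowing time by k reconciles the two. *)
pose k := Num.min (e / 2) 1.
have k0 : 0 < k by rewrite lt_min divr_gt0 // ltr01.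
have e' : is_derive (0 : R) 1 (fun r => dphi (0 + k * r)) (k * hessform i h (gamma 0) (vel i gamma 0)).
  have d2' : is_derive (0 + k * 0 : R) 1 dphi (hessform i h (gamma 0) (vel i gamma 0)).
    by rewrite mulr0 addr0.
  by apply: is_derive_eq (@is_derive1_comp R dphi (fun r => 0 + k * r) 0 _ _ d2'
    (is_derive_affine 0 k 0)) _; rewrite mulrC.
rewrite -(@ler_pM2l _ k) //; apply: (derive_ge_right _ _ _ e') => r /andP[r0 r1].
rewrite !add0r mulr0.
have kr1 : k * r <= k by apply: ler_piMr => //; exact: ltW.
have ke : k < e.
  apply: le_lt_trans (_ : e / 2 < e); first by rewrite ge_min lexx.
  by rewrite ltr_pdivrMr // ltr_pMr // ltr1n.
have [|ikr Dkr] := He (k * r).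
  rewrite -ball_normE /ball_ /= sub0r normrN gtr0_norm ?mulr_gt0 //.
  exact: le_lt_trans ke.
have krI : 0 < k * r <= 1.
  by rewrite mulr_gt0 //= (le_trans kr1) // ge_min lexx orbT.
have := grow (k * r) krI ikr Dkr; congr (_ <= _).
by move: (dist q q' ^+ 2) => z; ring.
Qed.

End Hessian.

Section HessianMatrix.
Context {R : realType} {M : riemannian_manifold R}.
Implicit Types (p q : M) (i j : atlas M).

Lemma is_derive_bigsum_rV m n (f : 'I_n -> 'rV[R]_m -> R) (df : 'I_n -> R) (x v : 'rV[R]_m) :
  (forall a, is_derive x v (f a) (df a)) ->
  is_derive x v (fun s => \sum_a f a s) (\sum_a df a).
Proof.
move=> h; have -> : (fun s => \sum_a f a s) = \sum_a f a.
  by apply/funext => s; rewrite fct_sumE.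
exact: is_derive_sum.
Qed.

(** Differentiating the identity between [grad_in] times the Gram matrix and the partial derivatives
    of h expresses the derivative of the gradient. What remains is an identity between Christoffel
    symbols of the first kind: those of (a, b; l) and (a, l; b) add up to the derivative in
    direction a of the (b, l) Gram entry. *)
Lemma hess_gmx h p (D : set 'rV[R]_(Defs.dim M)) (i := chart_at p) a l :
  open D -> D `<=` chart i @` chart_dom i -> D (chart i p) ->
  Ck 2 D (h \o chart_inv i) ->
  \sum_k hess h p a k * gmx i p k l =
  pd i a (pd i l h) p - \sum_c christoffel i p c a l * pd i c h p.
Proof.
move=> oD DE Dp hD; have ip : chart_dom i p := chart_at_dom M p.
set u0 := chart i p in Dp; have Eu : (chart i @` chart_dom i) u0 by exact: DE.
pose gr k q := grad_in i h q 0 k.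
have gradE q c : chart_dom i q -> pd i c h q = \sum_k gr k q * gmx i q k c.
  move=> iq; have : grad_in i h q *m gmx i q = \row_a pd i a h q.
    by rewrite /grad_in mulmxKV // gmx_unit.
  by move/rowP/(_ c); rewrite !mxE.
have dgr k : is_derive u0 (delta_mx 0 a) (gr k \o chart_inv i) (pd i a (gr k) p).
  apply: derivableP.
  have -> : gr k \o chart_inv i = (fun u => \sum_b (pd i b h \o chart_inv i) u *
      invmx (gmx i (chart_inv i u)) b k).
    apply/funext => u; rewrite /gr /grad_in /= mxE.
    by apply: eq_bigr => b _; rewrite mxE.
  apply: ex_derive; apply: is_derive_bigsum_rV => b.
  apply: derivableP; apply: (@derivableM _ _ (pd i b h \o chart_inv i)).
    exact: (Ck_derivable (Ck_pd 1 i b D h oD DE hD)).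
  apply: (derivable_invmx _ _ (fun u => gmx i (chart_inv i u))).
    by move=> c d; exact: (Ck_derivable (gmx_smooth M i c d 1%N)).
  exact: gmx_unit_near.
have dG k : is_derive u0 (delta_mx 0 a) (fun u => gmx i (chart_inv i u) k l)
    (pd i a (fun q => gmx i q k l) p).
  by apply: derivableP; exact: (Ck_derivable (gmx_smooth M i k l 1%N)).
have E : pd i a (pd i l h) p =
    \sum_k (gr k p * pd i a (fun q => gmx i q k l) p + gmx i p k l * pd i a (gr k) p).
  have n : \forall u \near u0, \sum_k (gr k \o chart_inv i) u * gmx i (chart_inv i u) k l =
      (pd i l h \o chart_inv i) u.
    by apply: filterS (image_nbhs _ _ Eu) => u /chart_invP[iu _] /=; rewrite gradE.
  have dk k : is_derive u0 (delta_mx 0 a)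
      (fun u => (gr k \o chart_inv i) u * gmx i (chart_inv i u) k l) _ :=
    is_deriveM (dgr k) (dG k).
  have [_ dv] := near_eq_is_derive n (is_derive_bigsum_rV _ _ _ _ _ _ dk).
  rewrite [LHS]dv.
  by apply: eq_bigr => k _; rewrite /GRing.scale /= /u0 chartK.
have -> : \sum_k hess h p a k * gmx i p k l =
    \sum_k (pd i a (gr k) p * gmx i p k l +
            \sum_b christoffel i p k a b * gr b p * gmx i p k l).
  by apply: eq_bigr => k _; rewrite mxE mulrDl mulr_suml.
rewrite E !big_split /=.
have -> : \sum_k gmx i p k l * pd i a (gr k) p = \sum_k pd i a (gr k) p * gmx i p k l.
  by apply: eq_bigr => k _; rewrite mulrC.
rewrite [X in _ = X - _]addrC -addrA; congr (_ + _).
pose dg x y z := pd i x (fun q => gmx i q y z) p.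
have -> : \sum_k \sum_b christoffel i p k a b * gr b p * gmx i p k l =
    \sum_b gr b p * (2^-1 * (dg a b l + dg b a l - dg l a b)).
  rewrite exchange_big /=; apply: eq_bigr => b _.
  rewrite /dg -christoffel_lower // mulr_sumr; apply: eq_bigr => k _.
  by rewrite mulrAC mulrC.
have -> : \sum_c christoffel i p c a l * pd i c h p =
    \sum_b gr b p * (2^-1 * (dg a l b + dg l a b - dg b a l)).
  under eq_bigr => c _ do rewrite gradE // mulr_sumr.
  rewrite exchange_big /=; apply: eq_bigr => b _.
  rewrite /dg -christoffel_lower // mulr_sumr; apply: eq_bigr => c _.
  rewrite mulrCA; congr (_ * (_ * _)).
  by rewrite -[in LHS](gmx_sym M i p ip) mxE.
rewrite -sumrB; apply: eq_bigr => b _; rewrite -mulrBr; congr (_ * _).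
have -> : dg a l b = dg a b l by exact: pd_gmx_sym.
by rewrite -/(dg a b l); move: (dg a b l) (dg b a l) (dg l a b) => x y z; field.
Qed.

Lemma inner_hess h p (D : set 'rV[R]_(Defs.dim M)) (i := chart_at p)
    (w : 'rV[R]_(Defs.dim M)) :
  open D -> D `<=` chart i @` chart_dom i -> D (chart i p) ->
  Ck 2 D (h \o chart_inv i) ->
  @inner R M p (w *m hess h p) w = hessform i h p w.
Proof.
move=> oD DE Dp hD.
rewrite /inner -[w *m hess h p *m _]mulmxA /hessform.
have -> : (w *m (hess h p *m gmx (chart_at p) p) *m w^T) 0 0 =
    \sum_a \sum_l w 0 a * (hess h p *m gmx i p) a l * w 0 l.
  rewrite mxE exchange_big /=; apply: eq_bigr => l _.
  by rewrite !mxE mulr_suml; apply: eq_bigr => a _; rewrite mxE.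
apply: eq_bigr => a _; apply: eq_bigr => l _.
by rewrite mxE (hess_gmx h p D a l oD DE Dp hD) mulrAC.
Qed.

Lemma norm_hess_ge (U : set M) (mu : R) h p (D : set 'rV[R]_(Defs.dim M)) w :
  geodesically_convex U -> U `<=` closure (interior U) ->
  strongly_convex mu U h -> U p -> open D ->
  D `<=` chart (chart_at p) @` chart_dom (chart_at p) -> D (chart (chart_at p) p) ->
  Ck 2 D (h \o chart_inv (chart_at p)) ->
  mu * @norm_at R M p w <= @norm_at R M p (w *m hess h p).
Proof.
move=> U_convex U_regular hsc pU oD DE Dp hD.
have := hessform_ge U mu _ h p D w U_convex U_regular hsc pU (chart_at_dom M p) oD DE Dp hD.
rewrite -(inner_hess h p D w oD DE Dp hD) -[inn _ _ _ _]/(@inner R M p w w) -norm_at_sqr.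
have [->|n0] := eqVneq (@norm_at R M p w) 0; first by rewrite mulr0 norm_at_ge0.
move=> /le_trans/(_ (cauchy_schwarz _ _ _)); rewrite expr2 mulrA ler_pM2r //.
by rewrite lt_def n0 norm_at_ge0.
Qed.

Lemma hess_unit (U : set M) (mu : R) h p (D : set 'rV[R]_(Defs.dim M)) :
  0 < mu -> geodesically_convex U -> U `<=` closure (interior U) ->
  strongly_convex mu U h -> U p -> open D ->
  D `<=` chart (chart_at p) @` chart_dom (chart_at p) -> D (chart (chart_at p) p) ->
  Ck 2 D (h \o chart_inv (chart_at p)) ->
  hess h p \in unitmx.
Proof.
move=> mu0 U_convex U_regular hsc pU oD DE Dp hD.
rewrite -row_free_unit -kermx_eq0; apply/eqP/row_matrixP => k; rewrite row0.
apply: (@norm_at0_eq0 R M p); apply/eqP; rewrite eq_le norm_at_ge0 andbT.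
rewrite -(pmulr_rle0 _ mu0).
apply: le_trans (norm_hess_ge U mu h p D _ U_convex U_regular hsc pU oD DE Dp hD) _.
by rewrite -row_mul mulmx_ker row0 norm_at0.
Qed.

End HessianMatrix.

(** * Partial derivatives of the bilevel data *)

Section ProductCharts.
Context {R : realType} {Mx My : riemannian_manifold R}.
Implicit Types (x : Mx) (y : My) (h : Mx -> My -> R).
Local Notation m := (Defs.dim Mx).
Local Notation n := (Defs.dim My).

Definition prod_dom (i : atlas Mx) (j : atlas My) (W : set (Mx * My)) : set 'rV[R]_(m + n) :=
  [set w | [/\ (chart i @` chart_dom i) (lsubmx w), (chart j @` chart_dom j) (rsubmx w) &
     W (chart_inv i (lsubmx w), chart_inv j (rsubmx w))]].

Definition prod_rep (i : atlas Mx) (j : atlas My) h (w : 'rV[R]_(m + n)) : R :=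
  h (chart_inv i (lsubmx w)) (chart_inv j (rsubmx w)).

Lemma prod_dom_open i j W : open W -> open (prod_dom i j W).
Proof.
move=> oW; rewrite openE => w [Ei Ej Ww].
have cl : {for w, continuous (fun w : 'rV[R]_(m + n) => chart_inv i (lsubmx w))}.
  apply: continuous_comp; first exact: continuous_lsubmx.
  exact: chart_inv_continuous.
have cr : {for w, continuous (fun w : 'rV[R]_(m + n) => chart_inv j (rsubmx w))}.
  apply: continuous_comp; first exact: continuous_rsubmx.
  exact: chart_inv_continuous.
have n1 : nbhs w [set w | (chart i @` chart_dom i) (lsubmx w)].
  by apply: continuous_lsubmx; exact: image_nbhs.
have n2 : nbhs w [set w | (chart j @` chart_dom j) (rsubmx w)].
  by apply: continuous_rsubmx; exact: image_nbhs.
have n3 : nbhs w [set w | W (chart_inv i (lsubmx w), chart_inv j (rsubmx w))].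
  by apply: (cvg_pair cl cr); exact: (open_nbhs_nbhs (conj oW Ww)).
by apply: filterS3 n1 n2 n3 => w'.
Qed.

Lemma row_mx_deltar (s : R) (a : 'I_n) (xi : 'rV[R]_m) (eta : 'rV[R]_n) :
  row_mx xi (s *: delta_mx 0 a + eta) =
  s *: delta_mx 0 (rshift m a) + row_mx xi eta :> 'rV[R]_(m + n).
Proof.
have -> : delta_mx 0 (rshift m a) = row_mx 0 (delta_mx 0 a) :> 'rV[R]_(m + n).
  apply/rowP => k; rewrite !mxE; case: splitP => k' E; rewrite !mxE.
    have -> : (k == rshift m a) = false; last by rewrite andbF.
    by rewrite -val_eqE /= E ltn_eqF // ltn_addr.
  by congr (((_ && _) : nat)%:R); rewrite -val_eqE /= E eqn_add2l.
by rewrite scale_row_mx add_row_mx scaler0 add0r.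
Qed.

Lemma row_mx_deltal (s : R) (a : 'I_m) (xi : 'rV[R]_m) (eta : 'rV[R]_n) :
  row_mx (s *: delta_mx 0 a + xi) eta =
  s *: delta_mx 0 (lshift n a) + row_mx xi eta :> 'rV[R]_(m + n).
Proof.
have -> : delta_mx 0 (lshift n a) = row_mx (delta_mx 0 a) 0 :> 'rV[R]_(m + n).
  apply/rowP => k; rewrite !mxE; case: splitP => k' E; rewrite !mxE.
    by congr (((_ && _) : nat)%:R); rewrite -val_eqE /= E.
  have -> : (k == lshift n a) = false; last by rewrite andbF.
  by rewrite -val_eqE /= E gtn_eqF // ltn_addr.
by rewrite scale_row_mx add_row_mx scaler0 add0r.
Qed.

Lemma continuous_row_mx (T : topologicalType) (f : T -> 'rV[R]_m) (g : T -> 'rV[R]_n) t :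
  {for t, continuous f} -> {for t, continuous g} ->
  {for t, continuous (fun s => row_mx (f s) (g s))}.
Proof.
move=> fc gc; apply/cvgrPdist_lt => e e0.
have /cvgrPdist_lt/(_ _ e0) nf := fc; have /cvgrPdist_lt/(_ _ e0) ng := gc.
apply: filterS2 nf ng => s fs gs.
rewrite opp_row_mx add_row_mx /Num.Def.normr /= mx_normrE.
apply/bigmax_ltP; split => // -[k l] _ /=; rewrite ord1 mxE.
case: splitP => l' _; [apply: le_lt_trans fs|apply: le_lt_trans gs];
  exact: norm_coord_le.
Qed.

Lemma prod_repl i j h x y : chart_dom i x -> chart_dom j y ->
  prod_rep i j h (row_mx (chart i x) (chart j y)) = h x y.
Proof. by move=> ix jy; rewrite /prod_rep row_mxKl row_mxKr !chartK. Qed.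

Lemma slice_yE i j h x : chart_dom i x ->
  h x \o chart_inv j = prod_rep i j h \o (fun eta => row_mx (chart i x) eta).
Proof. by move=> ix; apply/funext => eta; rewrite /= /prod_rep row_mxKl row_mxKr chartK. Qed.

Lemma slice_xE i j h y : chart_dom j y ->
  (h^~ y) \o chart_inv i = prod_rep i j h \o (fun xi => row_mx xi (chart j y)).
Proof. by move=> jy; apply/funext => xi; rewrite /= /prod_rep row_mxKl row_mxKr chartK. Qed.

Lemma pd_yE i j a h x y : chart_dom i x -> 
  pd j a (h x) y = 'D_(delta_mx 0 (rshift m a)) (prod_rep i j h)
                     (row_mx (chart i x) (chart j y)).
Proof.
move=> ix; rewrite /pd (slice_yE i) //.
have E := derive_pull n (m + n) (@rshift m n) (fun eta => row_mx (chart i x) eta) a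
  (prod_rep i j h) (fun s u => row_mx_deltar s a _ u).
exact: (congr1 (fun F => F (chart j y)) E).
Qed.

Lemma pd_xE i j a h x y : chart_dom j y ->
  pd i a (h^~ y) x = 'D_(delta_mx 0 (lshift n a)) (prod_rep i j h)
                     (row_mx (chart i x) (chart j y)).
Proof.
move=> jy; rewrite /pd (slice_xE i j) //.
have E := derive_pull m (m + n) (@lshift m n) (fun xi => row_mx xi (chart j y)) a
  (prod_rep i j h) (fun s u => row_mx_deltal s a u _).
exact: (congr1 (fun F => F (chart i x)) E).
Qed.

Lemma row_mxr_cont (xi : 'rV[R]_m) : continuous (fun eta : 'rV[R]_n => row_mx xi eta).
Proof. move=> eta; apply: (continuous_row_mx _ (fun=> xi) id).
  exact: cst_continuous.
by move=> A. Qed.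

Lemma row_mxl_cont (eta : 'rV[R]_n) : continuous (fun xi : 'rV[R]_m => row_mx xi eta).
Proof. move=> xi; apply: (continuous_row_mx _ id (fun=> eta)).
  by move=> A.
exact: cst_continuous. Qed.

Variables (U : set (Mx * My)).

Lemma prod_chart k h : Ck_prod k U h -> exists W, [/\ open W, U `<=` W &
  forall i j, Ck k (prod_dom i j W) (prod_rep i j h)].
Proof. by move=> [W [oW UW hW]]; exists W; split => // i j; exact: hW. Qed.

Lemma prod_dom_pt i j W x y : W (x, y) -> chart_dom i x -> chart_dom j y ->
  prod_dom i j W (row_mx (chart i x) (chart j y)).
Proof.
move=> Wxy ix jy; split; rewrite ?row_mxKl ?row_mxKr; [exact: chart_image|exact: chart_image|].
by rewrite !chartK.
Qed.

(** A single open set serves both the partial function of y and the x-partials of h as functions of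
    y; the latter are what the cross derivative differentiates, at the cost of one order of
    regularity. *)
Lemma slice_y k h x y (i := chart_at x) j : Ck_prod k U h -> U (x, y) -> chart_dom j y ->
  exists D, [/\ open D, D `<=` chart j @` chart_dom j, D (chart j y),
    Ck k D (h x \o chart_inv j) &
    forall k', k = k'.+1 -> forall b,
      Ck k' D ((fun y' => pd i b (h^~ y') x) \o chart_inv j)].
Proof.
move=> /prod_chart[W [oW UW hW]] Uxy jy; have ix : chart_dom i x := chart_at_dom Mx x.
pose D := (fun eta : 'rV[R]_n => row_mx (chart i x) eta) @^-1` prod_dom i j W.
have oD : open D.
  by apply: open_comp (prod_dom_open i j W oW) => eta _; exact: row_mxr_cont.
have DE : D `<=` chart j @` chart_dom j by move=> eta [_]; rewrite row_mxKr.
have pull k' f : Ck k' (prod_dom i j W) f ->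
    Ck k' D (f \o (fun eta : 'rV[R]_n => row_mx (chart i x) eta)).
  apply: (Ck_pull _ _ (@rshift m n)); first exact: row_mxr_cont.
  by move=> s a u; exact: row_mx_deltar.
exists D; split => //.
- by apply: prod_dom_pt => //; exact: UW.
- by rewrite (slice_yE i) //; exact: pull.
- move=> k' kE b; have hij := hW i j; rewrite kE in hij.
  have := pull k' _ (Ck_D (lshift n b) hij); apply: eq_Ck oD _ => eta /DE /chart_invP[je E].
  by rewrite /= (pd_xE i j) // E.
Qed.

Lemma slice_x k h x y i : Ck_prod k U h -> U (x, y) -> chart_dom i x ->
  exists D, [/\ open D, D `<=` chart i @` chart_dom i, D (chart i x) &
    Ck k D ((h^~ y) \o chart_inv i)].
Proof.
move=> /prod_chart[W [oW UW hW]] Uxy ix; set j := chart_at y.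
have jy : chart_dom j y := chart_at_dom My y.
pose D := (fun xi : 'rV[R]_m => row_mx xi (chart j y)) @^-1` prod_dom i j W.
have oD : open D.
  by apply: open_comp (prod_dom_open i j W oW) => xi _; exact: row_mxl_cont.
exists D; split => //.
- by move=> xi []; rewrite row_mxKl.
- by apply: prod_dom_pt => //; exact: UW.
- rewrite (slice_xE i j) //; apply: (Ck_pull _ _ (@lshift m n)); last exact: hW.
    exact: row_mxl_cont.
  by move=> s a u; exact: row_mx_deltal.
Qed.

End ProductCharts.

Section BilevelBounds.
Context {R : realType} {Mx My : riemannian_manifold R}.
Implicit Types (x : Mx) (y : My).
Variables (Ux : set Mx) (Uy : set My).
Hypothesis Ux_convex : geodesically_convex Ux.
Hypothesis Uy_convex : geodesically_convex Uy.
Hypothesis Ux_regular : Ux `<=` closure (interior Ux).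
Hypothesis Uy_regular : Uy `<=` closure (interior Uy).
Variables (Px : forall p q : Mx, tangent p -> tangent q).
Variables (Py : forall p q : My, tangent p -> tangent q).

Section Upper.
Variables (f : Mx -> My -> R) (lf : R).
Hypothesis lf_gt0 : 0 < lf.
Hypothesis f_C1 : Ck_prod 1 (Ux `*` Uy) f.
Hypothesis f_lip : lipschitz_fun Ux Uy lf f.

Lemma norm_Gy_le x y : Ux x -> Uy y -> norm_at (Gy f x y) <= lf.
Proof.
move=> xU yU; have [D [oD DE Dy hD _]] := slice_y _ 1 f x y (chart_at y) f_C1 (conj xU yU) (chart_at_dom My y).
apply: (norm_grad_le Uy Uy_convex Uy_regular y D (f x) lf) => //; first exact: ltW.
by move=> q q' qU q'U; exact: f_lip.1.
Qed.

Lemma norm_Gx_le x y : Ux x -> Uy y -> norm_at (Gx f x y) <= lf.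
Proof.
move=> xU yU; have [D [oD DE Dx hD]] := slice_x _ 1 f x y (chart_at x) f_C1 (conj xU yU) (chart_at_dom Mx x).
apply: (norm_grad_le Ux Ux_convex Ux_regular x D (f^~ y) lf) => //; first exact: ltW.
by move=> q q' qU q'U; exact: f_lip.2.
Qed.

End Upper.

Variables (g : Mx -> My -> R) (ystar : Mx -> My) (mu Lg : R).
Hypothesis ystar_argmin : forall x y, g x (ystar x) <= g x y.
Hypothesis ystar_region : forall x, Ux x -> Uy (ystar x).
Hypothesis mu_gt0 : 0 < mu.
Hypothesis Lg_gt0 : 0 < Lg.
Hypothesis g_C2 : Ck_prod 2 (Ux `*` Uy) g.
Hypothesis g_convex : forall x, Ux x -> strongly_convex mu Uy (g x).
Hypothesis Gg_lip : lipschitz_grads Ux Uy Px Py Lg g.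

(** The inverse Gram matrix at x does not depend on y: it comes out of the derivative and is
    cancelled by the Gram matrix of the inner product, leaving plain mixed partials. *)
Lemma inner_Gxy x y (v z : 'rV[R]_(Defs.dim _)) : Ux x -> Uy y ->
  @inner R Mx x (@Gxy R Mx My g x y v) z =
  \sum_a v 0 a * \sum_b z 0 b *
    pd (chart_at y) a (fun y' => pd (chart_at x) b (g^~ y') x) y.
Proof.
move=> xU yU; have jy := chart_at_dom My y; set j := chart_at y in jy *.
have [D [oD DE Dy hD hDx]] := slice_y _ 2 g x y j g_C2 (conj xU yU) jy.
set i := chart_at x in hDx *; have {}hDx b := hDx 1%N erefl b.
pose B := \matrix_(a, b) pd j a (fun y' => pd i b (g^~ y') x) y.
have GE : \matrix_(a, k) pd j a (fun y' => (Gx g x y' : 'rV[R]_(Defs.dim Mx)) 0 k) y =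
    B *m invmx (gmx i x).
  apply/matrixP => a k; rewrite !mxE /pd.
  have -> : (fun y' => (Gx g x y' : 'rV[R]_(Defs.dim Mx)) 0 k) \o chart_inv j =
      (fun u => \sum_b ((fun y' => pd i b (g^~ y') x) \o chart_inv j) u *
        invmx (gmx i x) b k).
    apply/funext => u; rewrite /= /Gx /grad /grad_in mxE.
    by apply: eq_bigr => b _; rewrite mxE.
  have dk b : is_derive (chart j y) (delta_mx 0 a)
      (fun u => ((fun y' => pd i b (g^~ y') x) \o chart_inv j) u * invmx (gmx i x) b k) _ :=
    is_deriveM (derivableP (Ck_derivable (hDx b) _ a Dy))
      (is_derive_cst (invmx (gmx i x) b k : R) _ _).
  have [_ ->] := is_derive_bigsum_rV _ _ _ _ _ _ dk.
  by apply: eq_bigr => b _; rewrite /GRing.scale /= mulr0 add0r mulrC mxE.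
rewrite /inner /Gxy GE mulmxA mulmxKV; last exact/gmx_unit/chart_at_dom.
rewrite -mulmxA mxE; apply: eq_bigr => a _; congr (_ * _).
by rewrite mxE; apply: eq_bigr => b _; rewrite !mxE mulrC.
Qed.

(* Pairing with a fixed tangent vector at x reduces the operator bound to the scalar one. *)
Lemma norm_Gxy_le x y (v : tangent y) : Ux x -> Uy y ->
  norm_at (Gxy g x v) <= Lg * norm_at v.
Proof.
move=> xU yU; have jy := chart_at_dom My y; set j := chart_at y in jy.
have [D [oD DE Dy hD hDx]] := slice_y _ 2 g x y j g_C2 (conj xU yU) jy.
set i := chart_at x in hDx.
have {}hDx b := hDx 1%N erefl b.
(* The fixed vector is the image itself, so the derivative of [H] along v is the square norm of z,
   and one factor [norm_at z] cancels at the end. *)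
set z := Gxy g x v.
pose H y' : R := @inner R Mx x (Gx g x y') z.
have HE y' : H y' = \sum_b z 0 b * pd i b (g^~ y') x by rewrite /H inner_grad.
have dH a u : D u -> is_derive u (delta_mx 0 a) (H \o chart_inv j)
    (\sum_b z 0 b * 'D_(delta_mx 0 a) ((fun y' => pd i b (g^~ y') x) \o chart_inv j) u).
  move=> Du; have -> : H \o chart_inv j = (fun u => \sum_b z 0 b *
      ((fun y' => pd i b (g^~ y') x) \o chart_inv j) u).
    by apply/funext => u'; rewrite /= HE.
  apply: is_derive_bigsum_rV => b.
  exact: (is_deriveZ (z 0 b : R) (derivableP (Ck_derivable (hDx b) u a Du))).
have HD : Ck 1 D (H \o chart_inv j).
  split.
    move=> u Du; have c : \sum_b z 0 b * ((fun y' => pd i b (g^~ y') x) \o chart_inv j) u' @[u' --> u]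
        --> \sum_b z 0 b * ((fun y' => pd i b (g^~ y') x) \o chart_inv j) u.
      apply: (@cvg_bigsum _ _ (nbhs u) _) => b.
      by apply: cvgM; [exact: cvg_cst|exact: (Ck_continuous (hDx b))].
    by apply: (eq_continuous_at _ _ _ _ _ c) => u'; rewrite /= HE.
  move=> a; split; first by move=> u /dH - /(_ a) [].
  split=> // u Du.
  have E : \forall u' \near u, \sum_b z 0 b *
      'D_(delta_mx 0 a) ((fun y' => pd i b (g^~ y') x) \o chart_inv j) u' =
      'D_(delta_mx 0 a) (H \o chart_inv j) u'.
    by apply: filterS (open_nbhs_nbhs (conj oD Du)) => u' /dH - /(_ a) [_ ->].
  apply: cvg_trans (near_eq_cvg E) _; rewrite -(nbhs_singleton E).
  apply: (@cvg_bigsum _ _ (nbhs u) _) => b.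
  by apply: cvgM; [exact: cvg_cst|exact: (Ck_continuous (Ck_D a (hDx b)))].
have HL q q' : Uy q -> Uy q' -> `|H q - H q'| <= Lg * norm_at z * dist q q'.
  move=> qU q'U; have [_ le1] := Gg_lip.1 x q q' xU qU q'U.
  have cs (s : 'rV[R]_(Defs.dim Mx)) : `|@inner R Mx x s z| <= @norm_at R Mx x s * norm_at z.
    rewrite ler_norml cauchy_schwarz andbT -lerN2 opprK -innerNl.
    by rewrite -[X in X * _](norm_atN x); exact: cauchy_schwarz.
  have -> : H q - H q' = @inner R Mx x (Gx g x q - Gx g x q') z.
    by rewrite innerDl innerNl.
  apply: le_trans (cs _) _; rewrite mulrAC; apply: ler_wpM2r => //.
  exact: norm_at_ge0.
have key := lipschitz_pd Uy Uy_convex Uy_regular j y D H (Lg * norm_at z) v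
  (mulr_ge0 (ltW Lg_gt0) (norm_at_ge0 x z)) HL yU jy oD Dy HD.
have zz : @inner R Mx x z z = \sum_a v 0 a * pd j a H y.
  rewrite [LHS]inner_Gxy //; apply: eq_bigr => a _; congr (_ * _).
  by have [_ <-] := dH a _ Dy.
move: key; rewrite -zz -norm_at_sqr -[inn _ _ _ _]/(inner v v) -/(norm_at v).
have [->|n0] := eqVneq (norm_at z) 0.
  by rewrite mulr_ge0 ?norm_at_ge0 // ltW.
rewrite expr2 mulrAC ler_pM2r //.
by rewrite lt_def n0 norm_at_ge0.
Qed.

Lemma norm_Hy_ge x y (v : tangent y) : Ux x -> Uy y ->
  mu * norm_at v <= norm_at (Hy g x v).
Proof.
move=> xU yU; have jy := chart_at_dom My y.
have [D [oD DE Dy hD _]] := slice_y _ 2 g x y _ g_C2 (conj xU yU) jy.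
exact: (norm_hess_ge Uy mu (g x) y D v Uy_convex Uy_regular (g_convex x xU)).
Qed.

Lemma Hy_unit x y : Ux x -> Uy y -> hess (g x) y \in unitmx.
Proof.
move=> xU yU; have jy := chart_at_dom My y.
have [D [oD DE Dy hD _]] := slice_y _ 2 g x y _ g_C2 (conj xU yU) jy.
exact: (hess_unit Uy mu (g x) y D mu_gt0 Uy_convex Uy_regular (g_convex x xU)).
Qed.

Lemma derive_min (phi : R -> R) (t d : R) : is_derive t 1 phi d ->
  (forall s, phi t <= phi s) -> d = 0.
Proof.
move=> dphi pmin.
have shift (b : R) : is_derive (0 : R) 1 (fun s => phi (t + b * s)) (d * b).
  have dt : is_derive (t + b * 0 : R) 1 phi d by rewrite mulr0 addr0.
  exact: (@is_derive1_comp R phi (fun s => t + b * s) 0 d b dt (is_derive_affine t b 0)).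
have ge0 (b : R) : 0 <= d * b.
  apply: (derive_ge_right _ _ _ (shift b)) => s _.
  by rewrite mul0r mulr0 addr0 subr_ge0.
by apply/eqP; rewrite eq_le; have := ge0 1; have := ge0 (-1); rewrite mulrN1 mulr1 oppr_ge0 => -> ->.
Qed.

(** Minimality is over the whole of My, so the coordinate line through y*(x) may be followed for
    every s, even beyond the image of the chart. *)
Lemma pd_ystar x j l : Ux x -> chart_dom j (ystar x) -> pd j l (g x) (ystar x) = 0.
Proof.
move=> xU jy; have yU := ystar_region x xU.
have [D [oD DE Dy hD _]] := slice_y _ 2 g x (ystar x) j g_C2 (conj xU yU) jy.
have dl : derivable (g x \o chart_inv j) (0 *: delta_mx 0 l + chart j (ystar x)) (delta_mx 0 l).
  by rewrite scale0r add0r; exact: (Ck_derivable hD).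
have d := derive_line _ _ _ _ _ dl.
have := derive_min _ _ _ d; rewrite scale0r add0r; apply => s.
by rewrite /= chartK.
Qed.

Lemma Gy_ystar x : Ux x -> Gy g x (ystar x) = 0 :> 'rV[R]_(Defs.dim My).
Proof.
move=> xU; rewrite /Gy /grad /grad_in.
have -> : \row_a pd (chart_at (ystar x)) a (g x) (ystar x) = 0.
  by apply/rowP => a; rewrite !mxE pd_ystar //; exact: chart_at_dom.
by rewrite mul0mx.
Qed.

(** On the geodesic from y to y*(x) the two first-order inequalities add up, the derivative at y*(x)
    being 0, to [mu * d ^+ 2] bounded by minus the product of gradient and velocity; Cauchy-Schwarz
    concludes. This is how a stopping test on the gradient becomes a bound on the distance. *)
Lemma error_bound x y : Ux x -> Uy y ->
  mu * dist y (ystar x) <= norm_at (Gy g x y).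
Proof.
move=> xU yU; have yU' := ystar_region x xU.
have [gamma gm] := convex_geodesic Uy Uy_convex y (ystar x) yU yU'.
have [gg g0 g1 _] := gm; have dg := geodesic_dcurve _ gg.
have der (t : R) : Uy (gamma t) -> is_derive t 1 (g x \o gamma)
    (inner (Gy g x (gamma t)) (velocity gamma t)).
  move=> tU; have jy := chart_at_dom My (gamma t).
  have [D [oD DE Dy hD _]] := slice_y _ 2 g x (gamma t) _ g_C2 (conj xU tU) jy.
  rewrite inner_grad.
  exact: (derive_comp_curve gamma _ t D (g x) dg jy oD Dy (Ck_le _ hD)).
have U0 : Uy (gamma 0) by rewrite g0.
have U1 : Uy (gamma 1) by rewrite g1.
have e1 : inner (Gy g x (gamma 1)) (velocity gamma 1) = 0.
  by apply: (derive_min _ _ _ (der 1 U1)) => s /=; rewrite g1.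
have [h0 h1] := strong_convexity_endpoints Uy mu (g x) _ _ _ _ _ (g_convex x xU) yU yU' gm
  (der 0 U0) (der 1 U1).
rewrite e1 in h1; set d := dist y (ystar x) in h0 h1 *.
have cs := cauchy_schwarz (gamma 0) (- (Gy g x (gamma 0) : 'rV[R]_(Defs.dim My))) (velocity gamma 0).
rewrite innerNl norm_atN (minimizing_speed _ _ _ 0 gm) -/d in cs.
have key : mu * d ^+ 2 <= norm_at (Gy g x (gamma 0)) * d.
  apply: le_trans cs; move: h0 h1.
  by move: (inner _ _) (g x y) (g x (ystar x)) (d ^+ 2) => a b c e; lra.
rewrite -[in leRHS]g0.
have [->|d0] := eqVneq d 0; first by rewrite mulr0 norm_at_ge0.
by move: key; rewrite expr2 mulrA ler_pM2r // lt_def d0 dist_ge0.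
Qed.

(** The error bound for x2 is taken at y*(x1), where the gradient for x1 vanishes, so that only the
    variation of the gradient in x is left. *)
Lemma ystar_lipschitz x1 x2 : Ux x1 -> Ux x2 ->
  dist (ystar x1) (ystar x2) <= Lg / mu * dist x1 x2.
Proof.
move=> x1U x2U; have yU := ystar_region x1 x1U.
rewrite mulrAC ler_pdivlMr // mulrC.
apply: le_trans (error_bound x2 (ystar x1) x2U yU) _.
have [_] := Gg_lip.2 x1 x2 (ystar x1) x1U x2U yU.
by rewrite (Gy_ystar x1 x1U) sub0r norm_atN.
Qed.

End BilevelBounds.

(** * The hypergradient *)

Section Quotients.
Context {R : realType}.

Lemma is_derive_quotient (f : R -> R) (t d : R) :
  is_derive t 1 f d <-> h^-1 * (f (h + t) - f t) @[h --> (0 : R)^'] --> d.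
Proof.
have E : (fun h : R => h^-1 *: (f (h *: 1 + t) - f t)) =
    (fun h : R => h^-1 * (f (h + t) - f t)).
  by apply/funext => h; have -> : h *: 1 = h :> R^o by exact: mulr1.
split=> [[d1 d2]|L].
  by move: d1 d2; rewrite /derivable /derive E => d1 <-.
by apply: DeriveDef; rewrite /derivable /derive E; [apply/cvg_ex; exists d|exact/cvg_lim].
Qed.

Lemma near_translate (t : R) (P : R -> Prop) :
  (\forall s \near t, P s) -> \forall h \near (0 : R), P (h + t).
Proof.
move=> /nbhs_ballP[e /= e0 He]; apply/nbhs_ballP; exists e => //= h.
rewrite -ball_normE /ball_ /= sub0r normrN => he; apply: He.
by rewrite -ball_normE /ball_ /= opprD addrCA subrr addr0 normrN.
Qed.

End Quotients.

Section ImplicitDerivative.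
Context {R : realType} {Mx My : riemannian_manifold R}.
Implicit Types (x : Mx) (y : My).
Variables (Ux : set Mx) (Uy : set My).
Hypothesis Ux_convex : geodesically_convex Ux.
Hypothesis Uy_convex : geodesically_convex Uy.
Hypothesis Uy_regular : Uy `<=` closure (interior Uy).
Variables (Px : forall p q : Mx, tangent p -> tangent q).
Variables (Py : forall p q : My, tangent p -> tangent q).
Variables (f g : Mx -> My -> R) (ystar : Mx -> My) (mu Lg : R).
Hypothesis ystar_argmin : forall x y, g x (ystar x) <= g x y.
Hypothesis ystar_region : forall x, Ux x -> Uy (ystar x).
Hypothesis mu_gt0 : 0 < mu.
Hypothesis Lg_gt0 : 0 < Lg.
Hypothesis f_C1 : Ck_prod 1 (Ux `*` Uy) f.
Hypothesis g_C2 : Ck_prod 2 (Ux `*` Uy) g.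
Hypothesis g_convex : forall x, Ux x -> strongly_convex mu Uy (g x).
Hypothesis Gg_lip : lipschitz_grads Ux Uy Px Py Lg g.
Local Notation m := (Defs.dim Mx).
Local Notation n := (Defs.dim My).

(** Converts the Lipschitz bound on y* from distances to coordinates: the geodesic between two
    values of y* is short, so [geodesic_local] keeps it in the chart and bounds the displacement. *)
Lemma ystar_local (gamma : R -> Mx) (p q : Mx) (t : R) j : Ux p -> Ux q ->
  minimizing_geodesic p q gamma -> 0 < t < 1 -> chart_dom j (ystar (gamma t)) ->
  exists2 C : R, 0 < C & \forall s \near t, [/\ Ux (gamma s), chart_dom j (ystar (gamma s)) &
    `|chart j (ystar (gamma s)) - chart j (ystar (gamma t))| <= C * `|s - t|].
Proof.
move=> pU qU gm /andP[t0 t1] jy.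
have [C [d [C0 d0 geo]]] := geodesic_local j _ jy.
(* The constant used below is [c + 1], positive even when p and q are at distance 0. *)
pose c := Lg / mu * dist p q.
have c0 : 0 <= c by rewrite mulr_ge0 ?divr_ge0 ?dist_ge0 // ltW.
exists (C * (c + 1)); first by rewrite mulr_gt0 // ltr_wpDl.
have tU : Ux (gamma t) by apply: (convex_geodesic_in Ux Ux_convex p q gamma) => //; rewrite !ltW.
have near_d : \forall s \near t, (c + 1) * `|s - t| < d.
  have e0 : 0 < d / (c + 1) by rewrite divr_gt0 // ltr_wpDl.
  apply/nbhs_ballP; exists (d / (c + 1)) => //= s; rewrite -ball_normE /ball_ /= distrC.
  by rewrite ltr_pdivlMr ?ltr_wpDl // mulrC.
apply: filterS3 near_d (lt_nbhsr t0) (lt_nbhsl t1) => s sd s0 s1.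
have sU : Ux (gamma s) by apply: (convex_geodesic_in Ux Ux_convex p q gamma) => //; rewrite !ltW.
have [beta bm] := convex_geodesic Uy Uy_convex _ _ (ystar_region _ tU) (ystar_region _ sU).
have [bg b0 b1 _] := bm; have sp := minimizing_speed _ _ _ 0 bm.
have dle : dist (ystar (gamma t)) (ystar (gamma s)) <= (c + 1) * `|s - t|.
  apply: le_trans (ystar_lipschitz Ux Uy Uy_convex Px Py g ystar mu Lg ystar_argmin
    ystar_region mu_gt0 g_C2 g_convex Gg_lip _ _ tU sU) _.
  apply: le_trans (_ : c * `|s - t| <= _); last by rewrite ler_wpM2r // lerDl.
  have -> : c * `|s - t| = Lg / mu * (`|s - t| * dist p q) by rewrite /c -!mulrA [X in _ * (_ * X)]mulrC.
  apply: ler_wpM2l; first by rewrite divr_ge0 // ltW.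
  exact: dist_minimizing_le.
have [hC _] := geo beta bg b0 (eq_ind_r (fun z => z < d) (le_lt_trans dle sd) sp).
have [] := hC 1; first by rewrite ler01 lexx.
rewrite b1 sp => jb hb; split => //.
by apply: le_trans hb _; rewrite -mulrA ler_pM2l.
Qed.

(* Expanding the critical point equation G l = 0 to first order at Z t, the difference
   quotients Q h of y* satisfy Q h *m Dm --> - v *m Cm, which gives the derivative of y*
   since Dm is invertible. *)
Lemma derive_upper_objective (gamma : R -> Mx) (p q : Mx) (t : R) : Ux p -> Ux q ->
  minimizing_geodesic p q gamma -> 0 < t < 1 ->
  is_derive t 1 (fun s => upper_objective f ystar (gamma s))
    (inner (hypergrad f g ystar (gamma t)) (velocity gamma t)).
Proof.
move=> pU qU gm t01; have [gg g0 g1 _] := gm; have dg := geodesic_dcurve _ gg.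
have [gc gd] := dg.
set x := gamma t; pose i := chart_at x; pose y0 := ystar x; pose j := chart_at y0.
have ix : chart_dom i x := chart_at_dom Mx x.
have jy : chart_dom j y0 := chart_at_dom My y0.
have [C C0 nearY] := ystar_local gamma p q t j pU qU gm t01 jy.
have [xU _ _] := nbhs_singleton nearY; rewrite -/x in xU.
have yU : Uy y0 := ystar_region x xU.
have [Wf [oWf UWf hWf]] := prod_chart _ _ _ f_C1.
have [Wg [oWg UWg hWg]] := prod_chart _ _ _ g_C2.
pose X s := chart i (gamma s); pose Y s := chart j (ystar (gamma s)).
pose Z s : 'rV[R]_(m + n) := row_mx (X s) (Y s).
pose fw := prod_rep i j f; pose gw := prod_rep i j g.
have Df : prod_dom i j Wf (Z t) by apply: prod_dom_pt => //; exact: UWf.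
have Dg : prod_dom i j Wg (Z t) by apply: prod_dom_pt => //; exact: UWg.
have oDf := prod_dom_open i j Wf oWf; have oDg := prod_dom_open i j Wg oWg.
pose v := vel i gamma t.
have dX k : is_derive t 1 (fun s => X s 0 k) (v 0 k).
  by rewrite /v vel_coord derive1E; apply: derivableP; exact: gd.
pose G l : 'rV[R]_(m + n) -> R := 'D_(delta_mx 0 (rshift m l)) gw.
have hG l : Ck 1 (prod_dom i j Wg) (G l) := Ck_D (rshift m l) (hWg i j).
pose Cm := \matrix_(k, l) 'D_(delta_mx 0 (lshift n k)) (G l) (Z t) : 'M[R]_(m, n).
pose Dm := \matrix_(b, l) 'D_(delta_mx 0 (rshift m b)) (G l) (Z t) : 'M[R]_n.
have symD : Dm^T = Dm.
  by apply/matrixP => a b; rewrite !mxE; exact: (schwarz _ _ _ _ _ _ oDg (hWg i j) Dg).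
have nearx : \forall s \near t, chart_dom i (gamma s) := near_dom gamma i t gc ix.
have G0 l : \forall s \near t, G l (Z s) = 0.
  apply: filterS2 nearx nearY => s si [sU sj _].
  rewrite /G /Z /X /Y -pd_yE //.
  exact: (pd_ystar Ux Uy g ystar ystar_argmin ystar_region g_C2).
have gradyE l : pd j l (g x) y0 = 0.
  exact: (pd_ystar Ux Uy g ystar ystar_argmin ystar_region g_C2).
have pdyyE a l : pd j a (pd j l (g x)) y0 = Dm a l.
  rewrite mxE /G /gw /Z -[X t]/(chart i x) -[Y t]/(chart j y0).
  rewrite {1}/pd.
  have E : \forall eta \near chart j y0, (pd j l (g x) \o chart_inv j) eta =
      (G l \o (fun eta => row_mx (chart i x) eta)) eta.
    apply: filterS (image_nbhs j _ (chart_image j y0 jy)) => eta /chart_invP[je eE].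
    by rewrite /= (pd_yE i j l g x _ ix) eE.
  rewrite (near_eq_derive _ E).
  have P := derive_pull n (m + n) (@rshift m n) (fun eta => row_mx (chart i x) eta) a
    (G l) (fun s u => row_mx_deltar s a _ u).
  exact: (congr1 (fun F => F (chart j y0)) P).
have pdxyE a b : pd j a (fun y' => pd i b (g^~ y') x) y0 = Cm b a.
  rewrite mxE /G -(schwarz _ _ _ _ _ _ oDg (hWg i j) Dg).
  rewrite {1}/pd.
  have E : \forall eta \near chart j y0, ((fun y' => pd i b (g^~ y') x) \o chart_inv j) eta =
      ('D_(delta_mx 0 (lshift n b)) gw \o (fun eta => row_mx (chart i x) eta)) eta.
    apply: filterS (image_nbhs j _ (chart_image j y0 jy)) => eta /chart_invP[je eE].
    by rewrite /= (pd_xE i j b g x _ je) eE.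
  rewrite (near_eq_derive _ E).
  have P := derive_pull n (m + n) (@rshift m n) (fun eta => row_mx (chart i x) eta) a
    ('D_(delta_mx 0 (lshift n b)) gw) (fun s u => row_mx_deltar s a _ u).
  exact: (congr1 (fun F => F (chart j y0)) P).
(* At a critical point of [g x] the Christoffel terms drop out, and the Hessian with lowered index
   is the matrix of ordinary second partials. *)
have hessE : hess (g x) y0 *m gmx j y0 = Dm.
  have [D [oD DE Dy hD _]] := slice_y _ 2 g x y0 j g_C2 (conj xU yU) jy.
  apply/matrixP => a l; rewrite mxE (hess_gmx (g x) y0 D a l oD DE Dy hD) pdyyE.
  by rewrite big1 ?subr0 // => c _; rewrite gradyE mulr0.
have uH : hess (g x) y0 \in unitmx.
  exact: (Hy_unit Ux Uy Uy_convex Uy_regular g mu mu_gt0 g_C2 g_convex).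
have uD : Dm \in unitmx by rewrite -hessE unitmx_mul uH gmx_unit.
pose dY := - (v *m Cm *m invmx Dm).
(* The increment of Z is O(h), so a Taylor remainder small relative to it is small relative to h.
   For the Y part this is where the Lipschitz bound on y* enters. *)
have [K K0 nearZ] : exists2 K : R, 0 < K &
    \forall h \near (0 : R)^', `|Z (h + t) - Z t| <= K * `|h|.
  have hX k : \forall h \near (0 : R)^', `|X (h + t) 0 k - X t 0 k| <= (`|v 0 k| + 1) * `|h|.
    have /is_derive_quotient/cvgrPdist_lt/(_ _ ltr01) := dX k.
    apply: filterS2 (nbhs_dnbhs_neq (0 : R)) => h h0 hq.
    have -> : X (h + t) 0 k - X t 0 k = h * (h^-1 * (X (h + t) 0 k - X t 0 k)).
      by rewrite mulrA mulfV // mul1r.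
    rewrite normrM mulrC ler_wpM2r //.
    by rewrite -[X in `|X|](subKr (v 0 k)) (le_trans (ler_normB _ _)) // lerD2l ltW.
  pose B := \sum_k (`|v 0 k| + 1).
  have B0 : 0 <= B by apply: sumr_ge0 => k _; rewrite addr_ge0.
  exists (B + C); first by rewrite ltr_wpDl.
  have nX : \forall h \near (0 : R)^', forall k,
      `|X (h + t) 0 k - X t 0 k| <= (`|v 0 k| + 1) * `|h|.
    exact: (@filter_forall _ _ (fun k h => `|X (h + t) 0 k - X t 0 k| <= (`|v 0 k| + 1) * `|h|)
      _ _ hX).
  have nY : \forall h \near (0 : R)^', `|Y (h + t) - Y t| <= C * `|h|.
    apply: nbhs_dnbhs; apply: filterS (near_translate _ _ nearY) => h [_ _].
    by rewrite addrK.
  apply: filterS2 nX nY => h hx hy.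
  apply: norm_rV_le; first by rewrite mulr_ge0 // addr_ge0 // ltW.
  move=> k; rewrite opp_row_mx add_row_mx mxE; case: splitP => k' _.
    rewrite !mxE; apply: le_trans (hx k') _; apply: ler_wpM2r => //.
    rewrite /B (bigD1 k') //= -addrA lerDl addr_ge0 ?(ltW C0) //.
    by apply: sumr_ge0 => ? _; rewrite addr_ge0.
  apply: le_trans (norm_coord_le _ _ k') _; apply: le_trans hy _.
  by rewrite mulrDl lerDr mulr_ge0.
have qX k : h^-1 * (X (h + t) 0 k - X t 0 k) @[h --> (0 : R)^'] --> v 0 k.
  by apply/is_derive_quotient.
pose Q h := h^-1 *: (Y (h + t) - Y t).
have E0 l : (\sum_k h^-1 * (X (h + t) 0 k - X t 0 k) * Cm k l
    + \sum_b Q h 0 b * Dm b l) @[h --> (0 : R)^'] --> (0 : R).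
  apply/cvgrPdist_le => e e0.
  have := Ck1_taylor _ _ _ _ oDg (hG l) Dg _ (divr_gt0 e0 K0).
  move=> /nbhs_ballP[r /= r0 Hr].
  have small : \forall h \near (0 : R)^', K * `|h| < r.
    apply: nbhs_dnbhs; apply/nbhs_ballP; exists (r / K); first by rewrite /= divr_gt0.
    move=> h; rewrite -ball_normE /ball_ /= sub0r normrN ltr_pdivlMr //.
    by rewrite mulrC.
  have Gz : \forall h \near (0 : R)^', G l (Z (h + t)) = 0.
    by apply: nbhs_dnbhs; exact: near_translate (G0 l).
  apply: filterS2 (filterI nearZ small) (filterI Gz (nbhs_dnbhs_neq (0 : R))) => h.
  move=> [hz hr] [hG0 h0]; rewrite sub0r normrN.
  have := Hr (Z (h + t) - Z t); rewrite -ball_normE /ball_ /= sub0r normrN.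
  move=> /(_ (le_lt_trans hz hr)).
  rewrite [Z t + _]addrC subrK hG0 (nbhs_singleton (G0 l)) subrr sub0r normrN big_split_ord /=.
  have -> : \sum_k h^-1 * (X (h + t) 0 k - X t 0 k) * Cm k l + \sum_b Q h 0 b * Dm b l =
      h^-1 * (\sum_k (Z (h + t) - Z t) 0 (lshift n k) *
           'D_(delta_mx 0 (lshift n k)) (G l) (Z t) +
         \sum_b (Z (h + t) - Z t) 0 (rshift m b) *
           'D_(delta_mx 0 (rshift m b)) (G l) (Z t)).
    rewrite mulrDr !mulr_sumr; congr (_ + _); apply: eq_bigr => k _.
      rewrite mulrA; congr (_ * _ * _); last by rewrite mxE.
      by rewrite /Z opp_row_mx add_row_mx row_mxEl !mxE.
    rewrite mulrA; congr (_ * _); last by rewrite mxE.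
    by rewrite /Z opp_row_mx add_row_mx row_mxEr /Q mxE.
  move=> hT; rewrite normrM normfV ler_pdivrMl ?normr_gt0 //.
  apply: le_trans hT _; apply: le_trans (_ : e / K * (K * `|h|) <= _).
    by apply: ler_wpM2l hz; rewrite divr_ge0 // ltW.
  by rewrite mulrA divfK ?gt_eqF // mulrC.
have dYP b : is_derive t 1 (fun s => Y s 0 b) (dY 0 b).
  apply/is_derive_quotient.
  have QE h : h^-1 * (Y (h + t) 0 b - Y t 0 b) =
      \sum_l (\sum_c Q h 0 c * Dm c l) * invmx Dm l b.
    have -> : h^-1 * (Y (h + t) 0 b - Y t 0 b) = (Q h *m Dm *m invmx Dm) 0 b.
      by rewrite mulmxK // !mxE.
    by rewrite mxE; apply: eq_bigr => l _; rewrite mxE.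
  have -> : (fun h => h^-1 * (Y (h + t) 0 b - Y t 0 b)) =
      (fun h => \sum_l (\sum_c Q h 0 c * Dm c l) * invmx Dm l b) by exact/funext.
  have -> : dY 0 b = \sum_l (0 - \sum_k v 0 k * Cm k l) * invmx Dm l b.
    rewrite /dY -mulNmx mxE; apply: eq_bigr => l _; congr (_ * _).
    by rewrite sub0r !mxE.
  apply: (@cvg_bigsum _ _ ((0 : R)^') _) => l; apply: cvgM; last exact: cvg_cst.
  have c1 : \sum_k h^-1 * (X (h + t) 0 k - X t 0 k) * Cm k l @[h --> (0 : R)^'] -->
      \sum_k v 0 k * Cm k l.
    apply: (@cvg_bigsum _ _ ((0 : R)^') _) => k.
    by apply: cvgM; [exact: qX|exact: cvg_cst].
  have c2 : (\sum_k h^-1 * (X (h + t) 0 k - X t 0 k) * Cm k l + \sum_c Q h 0 c * Dm c l -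
      \sum_k h^-1 * (X (h + t) 0 k - X t 0 k) * Cm k l) @[h --> (0 : R)^'] -->
      0 - \sum_k v 0 k * Cm k l := cvgB (E0 l) c1.
  have -> : (fun h => \sum_c Q h 0 c * Dm c l) = (fun h =>
      \sum_k h^-1 * (X (h + t) 0 k - X t 0 k) * Cm k l + \sum_c Q h 0 c * Dm c l -
      \sum_k h^-1 * (X (h + t) 0 k - X t 0 k) * Cm k l).
    by apply/funext => h; rewrite addrAC subrr add0r.
  exact: c2.
pose dZ : 'rV[R]_(m + n) := row_mx v dY.
have dZP k : is_derive t 1 (fun s => Z s 0 k) (dZ 0 k).
  rewrite -[k]splitK; case: (fintype.split k) => k' /=.
    have e : (fun s : R => X s 0 k') = (fun s : R => Z s 0 (lshift n k')).
      by apply/funext => s; rewrite /Z row_mxEl.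
    rewrite /dZ row_mxEl; have := dX k'; rewrite e; exact.
  have e : (fun s : R => Y s 0 k') = (fun s : R => Z s 0 (rshift m k')).
    by apply/funext => s; rewrite /Z row_mxEr.
  rewrite /dZ row_mxEr; have := dYP k'; rewrite e; exact.
have dF := chain_curve _ _ fw Z (fun k => dZ 0 k) t oDf (hWf i j) Df dZP.
have nearF : \forall s \near t, (fw \o Z) s = upper_objective f ystar (gamma s).
  apply: filterS2 nearx nearY => s si [sU sj _].
  by rewrite /= /fw /Z /X /Y prod_repl.
apply: is_derive_eq (near_eq_is_derive nearF dF) _.
rewrite big_split_ord /=.
pose fy := \row_l pd j l (f x) y0.
have fyE l : fy 0 l = 'D_(delta_mx 0 (rshift m l)) fw (Z t).
  by rewrite mxE (pd_yE i j).
rewrite /hypergrad -/y0 innerDl innerNl; congr (_ + _).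
  rewrite [RHS]inner_grad; apply: eq_bigr => k _; rewrite /dZ row_mxEl; congr (_ * _).
  by rewrite (pd_xE i j).
have invH : invmx (hess (g x) y0) = gmx j y0 *m invmx Dm.
  have e : hess (g x) y0 *m (gmx j y0 *m invmx Dm) = 1%:M.
    by rewrite mulmxA hessE mulmxV.
  by rewrite -[RHS](mulKmx uH) e mulmx1.
have uE : Gy f x y0 *m invmx (hess (g x) y0) = fy *m invmx Dm.
  by rewrite invH mulmxA /Gy /grad /grad_in mulmxKV // gmx_unit.
rewrite [X in _ = - X](inner_Gxy Ux Uy g g_C2 x y0 _ _ xU yU) uE.
have -> : \sum_a (fy *m invmx Dm) 0 a * (\sum_b (velocity gamma t : 'rV[R]_m) 0 b *
    pd (chart_at y0) a (fun y' => pd (chart_at x) b (g^~ y') x) y0) =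
    (fy *m invmx Dm *m Cm^T *m v^T) 0 0.
  rewrite -[in RHS]mulmxA mxE; apply: eq_bigr => a _; congr (_ * _).
  rewrite mxE; apply: eq_bigr => b _.
  by rewrite pdxyE mulrC; congr (_ * _); [rewrite [RHS]mxE|rewrite /v [RHS]mxE].
have -> : \sum_k dZ 0 (rshift m k) * 'D_(delta_mx 0 (rshift m k)) fw (Z t) =
    (dY *m fy^T) 0 0.
  have e k : fy^T k 0 = fy 0 k by rewrite mxE.
  by rewrite mxE; apply: eq_bigr => k _; rewrite e /dZ row_mxEr -fyE.
(* Two computations of one scalar: the derivative of y* applied to the gradient of f, and the
   adjoint form in [hypergrad]. A scalar equals its transpose, and [Dm] is symmetric. *)
rewrite /dY mulNmx mxE; congr (- _).
have -> : (fy *m invmx Dm *m Cm^T *m v^T) 0 0 = (fy *m invmx Dm *m Cm^T *m v^T)^T 0 0.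
  by rewrite [RHS]mxE.
by rewrite !trmx_mul !trmxK trmx_inv symD !mulmxA.
Qed.

End ImplicitDerivative.

Section Monotone.
Context {R : realType}.

Lemma lipschitz_within_continuous (phi : R -> R) (C : R) :
  (forall s t, 0 <= s <= 1 -> 0 <= t <= 1 -> `|phi s - phi t| <= C * `|s - t|) ->
  {within `[0, 1], continuous phi}.
Proof.
move=> h; apply/subspace_continuousP => t; rewrite /= in_itv /= => t01.
apply/cvgrPdist_le => e e0; rewrite near_withinE.
have C1 : 0 < `|C| + 1 by rewrite ltr_wpDl.
apply/nbhs_ballP; exists (e / (`|C| + 1)); first by rewrite /= divr_gt0.
move=> s; rewrite -ball_normE /ball_ /= in_itv /= ltr_pdivlMr // => st s01.
apply: le_trans (h t s t01 s01) _; apply: le_trans (ltW st).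
by rewrite mulrC ler_wpM2l // (le_trans (ler_norm C)) // lerDl.
Qed.

Lemma derive_le0_le (psi dpsi : R -> R) :
  (forall s : R, 0 < s < 1 -> is_derive s 1 psi (dpsi s)) ->
  (forall s : R, 0 < s < 1 -> dpsi s <= 0) ->
  {within `[0, 1], continuous psi} -> psi 1 <= psi 0.
Proof.
move=> d n c.
have d' (s : R) : s \in `]0, 1[%R -> is_derive s 1 psi (dpsi s) by rewrite in_itv /=; exact: d.
have [t] := MVT ltr01 d' c; rewrite in_itv /= => t01.
by rewrite subr0 mulr1 -subr_le0 => ->; exact: n.
Qed.

End Monotone.

(** * Lipschitz continuity of the hypergradient and descent *)

Section HypergradientBounds.
Context {R : realType} {Mx My : riemannian_manifold R}.
Implicit Types (x : Mx) (y : My).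
Variables (Ux : set Mx) (Uy : set My).
Hypothesis Ux_convex : geodesically_convex Ux.
Hypothesis Uy_convex : geodesically_convex Uy.
Hypothesis Ux_regular : Ux `<=` closure (interior Ux).
Hypothesis Uy_regular : Uy `<=` closure (interior Uy).
Variables (Px : forall p q : Mx, tangent p -> tangent q).
Variables (Py : forall p q : My, tangent p -> tangent q).
Hypothesis Px_transport : is_parallel_transport Ux Px.
Hypothesis Py_transport : is_parallel_transport Uy Py.
Variables (f g : Mx -> My -> R) (ystar : Mx -> My).
Hypothesis ystar_argmin : forall x y, g x (ystar x) <= g x y.
Hypothesis ystar_region : forall x, Ux x -> Uy (ystar x).
Variables (mu lf Lf Lg rho : R).
Hypothesis mu_gt0 : 0 < mu.
Hypothesis lf_gt0 : 0 < lf.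
Hypothesis Lf_gt0 : 0 < Lf.
Hypothesis Lg_gt0 : 0 < Lg.
Hypothesis rho_gt0 : 0 < rho.
Hypothesis f_C1 : Ck_prod 1 (Ux `*` Uy) f.
Hypothesis g_C2 : Ck_prod 2 (Ux `*` Uy) g.
Hypothesis g_convex : forall x, Ux x -> strongly_convex mu Uy (g x).
Hypothesis f_lip : lipschitz_fun Ux Uy lf f.
Hypothesis Gf_lip : lipschitz_grads Ux Uy Px Py Lf f.
Hypothesis Gg_lip : lipschitz_grads Ux Uy Px Py Lg g.
Hypothesis Hyg_lip : lipschitz_Hy Ux Uy Py rho g.
Hypothesis Gxyg_lip : lipschitz_Gxy Ux Uy Px Py rho g.
Local Notation m := (Defs.dim Mx).
Local Notation n := (Defs.dim My).
Local Notation Ghat := (@approx_hypergrad R Mx My f g).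
Local Notation GR := (@gradR R Mx My f g).

Lemma GxyB x y (v w : 'rV[R]_n) :
  @Gxy R Mx My g x y (v - w) = (@Gxy R Mx My g x y v : 'rV[R]_m) - @Gxy R Mx My g x y w.
Proof. exact: mulmxBl. Qed.

(** The vectors are arbitrary, so the same estimate serves the computed iterate in [hypergrad_error]
    and exact solutions in [hypergrad_lipschitz]. *)
Lemma approx_hypergrad_lip_y x y1 y2 (v1 : tangent y1) (v2 : tangent y2) :
  Ux x -> Uy y1 -> Uy y2 ->
  @norm_at R Mx x (Ghat x v1 - Ghat x v2) <=
    (Lf + rho * norm_at v2) * dist y1 y2 +
    Lg * @norm_at R My y1 (Py y2 y1 v2 - v1).
Proof.
move=> xU y1U y2U; set u := Py y2 y1 v2.
have [_ h1] := Gf_lip.1 x y1 y2 xU y1U y2U.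
have h2 := Gxyg_lip.2 x y2 y1 xU y2U y1U v2.
have h3 := norm_Gxy_le Ux Uy Uy_convex Uy_regular Px Py g Lg Lg_gt0 g_C2 Gg_lip x y1
  ((u : 'rV[R]_n) - v1) xU y1U.
rewrite GxyB in h3; rewrite (convex_dist_sym Uy Uy_convex y2 y1 y2U y1U) in h2.
rewrite /approx_hypergrad.
have -> : (Gx f x y1 : 'rV[R]_m) - Gxy g x v1 - (Gx f x y2 - Gxy g x v2 : 'rV[R]_m) =
  (Gx f x y1 - Gx f x y2 : 'rV[R]_m) + (Gxy g x v2 - Gxy g x u : 'rV[R]_m) +
    (Gxy g x u - Gxy g x v1 : 'rV[R]_m).
  move: (Gx f x y1) (Gx f x y2) (Gxy g x v1) (Gxy g x v2) (Gxy g x u) => a b c d e.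
  by apply/rowP => i; rewrite !mxE; move: (a 0 i) (b 0 i) (c 0 i) (d 0 i) (e 0 i) => *; ring.
apply: le_trans (norm_atD x _ _) _; apply: lerD h3.
apply: le_trans (norm_atD x _ _) _; rewrite mulrDl mulrAC; exact: lerD h1 h2.
Qed.

Lemma approx_hypergrad_lip_x x1 x2 y (v : tangent y) : Ux x1 -> Ux x2 -> Uy y ->
  @norm_at R Mx x2 (Px x1 x2 (Ghat x1 v) - Ghat x2 v) <=
    (Lf + rho * norm_at v) * dist x1 x2.
Proof.
move=> x1U x2U yU.
have [h1 _] := Gf_lip.2 x1 x2 y x1U x2U yU.
have h2 := Gxyg_lip.1 x1 x2 y x1U x2U yU v.
rewrite /approx_hypergrad (transportB Ux Ux_convex Px Px_transport) //.
set A := Px x1 x2 (Gx f x1 y) in h1 *; set B := Px x1 x2 (Gxy g x1 v) in h2 *.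
have -> : A - B - (Gx f x2 y - Gxy g x2 v : 'rV[R]_m) =
    (A - Gx f x2 y : 'rV[R]_m) - (B - Gxy g x2 v : 'rV[R]_m).
  clear h1 h2; move: A B (Gx f x2 y) (Gxy g x2 v) => a b c d.
  by apply/rowP => i; rewrite !mxE; move: (a 0 i) (b 0 i) (c 0 i) (d 0 i) => *; ring.
apply: le_trans (norm_atB x2 _ _) _; rewrite mulrDl mulrAC; exact: lerD h1 h2.
Qed.

(** Controls the residual, in the linear system at x1, of a vector that solves the system at x2. *)
Lemma gradR_lip_x x1 x2 y (v : tangent y) : Ux x1 -> Ux x2 -> Uy y ->
  norm_at (GR x1 v) <= norm_at (GR x2 v) + (Lf + rho * norm_at v) * dist x1 x2.
Proof.
move=> x1U x2U yU.
have [_ h1] := Gf_lip.2 x1 x2 y x1U x2U yU.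
have h2 := Hyg_lip.2 x1 x2 y x1U x2U yU v.
have -> : GR x1 v = GR x2 v - (Gy f x1 y - Gy f x2 y : 'rV[R]_n) +
    (Hy g x1 v - Hy g x2 v : 'rV[R]_n).
  rewrite /gradR; move: (Hy g x1 v) (Hy g x2 v) (Gy f x1 y) (Gy f x2 y) => a b c d.
  by apply/rowP => i; rewrite !mxE; move: (a 0 i) (b 0 i) (c 0 i) (d 0 i) => *; ring.
apply: le_trans (norm_atD y _ _) _.
rewrite mulrDl mulrAC addrA; apply: lerD h2.
by apply: le_trans (norm_atB y _ _) _; exact: lerD h1.
Qed.

(* v2 is carried to y1 rather than v1 to y2, which spares the inverse of the transport. *)
Lemma linear_solution_lip x y1 y2 (v1 : tangent y1) (v2 : tangent y2) :
  Ux x -> Uy y1 -> Uy y2 ->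
  mu * @norm_at R My y1 (Py y2 y1 v2 - v1) <=
    (Lf + rho * norm_at v2) * dist y1 y2 + norm_at (GR x v1) + norm_at (GR x v2).
Proof.
move=> xU y1U y2U; set u := Py y2 y1 v2.
have h0 := norm_Hy_ge Ux Uy Uy_convex Uy_regular g mu g_C2 g_convex x y1
  ((u : 'rV[R]_n) - v1) xU y1U.
have [h1 _] := Gf_lip.1 x y1 y2 xU y1U y2U.
have h2 := Hyg_lip.1 x y1 y2 xU y1U y2U v2.
apply: le_trans h0 _.
have -> : @Hy R Mx My g x y1 (u - v1 : 'rV[R]_n) = (Hy g x u - Gy f x y1 : 'rV[R]_n) - GR x v1 :> 'rV[R]_n.
  by rewrite /gradR opprB addrA subrK; exact: mulmxBl.
apply: le_trans (norm_atB y1 _ _) _.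
(* The norm is taken after the isometric transport to y2, since the Lipschitz bound on the Hessian
   compares the conjugated operator in the tangent space at y2. *)
rewrite addrAC lerD2r -(transport_norm Uy Uy_convex Py Py_transport y1 y2) //.
rewrite (transportB Uy Uy_convex Py Py_transport) //.
set A := Py y1 y2 (Hy g x u) in h2 *; set B := Py y1 y2 (Gy f x y1) in h1 *.
have -> : (A : 'rV[R]_n) - B = (A - Hy g x v2 : 'rV[R]_n) - (B - Gy f x y2 : 'rV[R]_n) + GR x v2.
  rewrite /gradR; clear h1 h2; move: A B (Hy g x v2) (Gy f x y2) => a b c d.
  by apply/rowP => i; rewrite !mxE; move: (a 0 i) (b 0 i) (c 0 i) (d 0 i) => *; ring.
apply: le_trans (norm_atD y2 _ _) _; rewrite lerD2r.
apply: le_trans (norm_atB y2 _ _) _; rewrite mulrDl mulrAC addrC; exact: lerD h1 h2.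
Qed.

(** The exact zero of [gradR] at y*(x). With this vector [approx_hypergrad] is [hypergrad] by
    definition, so estimates for the former apply directly to the latter. *)
Definition linear_solution x : tangent (ystar x) :=
  Gy f x (ystar x) *m invmx (hess (g x) (ystar x)).

Lemma gradR_linear_solution x : Ux x -> GR x (linear_solution x) = 0 :> 'rV[R]_n.
Proof.
move=> xU; rewrite /gradR /Hy /linear_solution mulmxKV ?subrr //.
exact: (Hy_unit Ux Uy Uy_convex Uy_regular g mu mu_gt0 g_C2 g_convex x _ xU (ystar_region x xU)).
Qed.

Lemma norm_linear_solution x : Ux x -> norm_at (linear_solution x) <= lf / mu.
Proof.
move=> xU; have yU := ystar_region x xU; rewrite ler_pdivlMr // mulrC.
apply: le_trans (norm_Hy_ge Ux Uy Uy_convex Uy_regular g mu g_C2 g_convex x _ _ xU yU) _.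
have := gradR_linear_solution x xU; rewrite /gradR => /eqP; rewrite subr_eq0 => /eqP ->.
exact: (norm_Gy_le Ux Uy Uy_convex Uy_regular f lf lf_gt0 f_C1 f_lip x _ xU yU).
Qed.

Lemma norm_hypergrad_le x : Ux x ->
  norm_at (hypergrad f g ystar x) <= lf + lf * Lg / mu.
Proof.
move=> xU; have yU := ystar_region x xU.
apply: le_trans (norm_atB x _ _) _; apply: lerD.
  exact: (norm_Gx_le Ux Uy Ux_convex Ux_regular f lf lf_gt0 f_C1 f_lip x _ xU yU).
apply: le_trans (norm_Gxy_le Ux Uy Uy_convex Uy_regular Px Py g Lg Lg_gt0 g_C2 Gg_lip x _
  (linear_solution x) xU yU) _.
rewrite mulrC mulrAC; apply: ler_wpM2r; [exact: ltW|exact: norm_linear_solution].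
Qed.

(** The two parts of [L_1]: moving y with the vector transported costs [Lf + rho * |v*|], where
    [|v*| <= lf / mu]; the error in the vector is amplified by Lg, and by [linear_solution_lip] it
    is at most that same variation plus the residual, divided by mu. *)
Lemma hypergrad_error x y (v : tangent y) : Ux x -> Uy y ->
  @norm_at R Mx x (Ghat x v - hypergrad f g ystar x) <=
    L_1 mu lf Lf Lg rho * dist y (ystar x) + Lg / mu * norm_at (GR x v).
Proof.
move=> xU yU; have y'U := ystar_region x xU.
have v0 := norm_linear_solution x xU.
have h1 := approx_hypergrad_lip_y x y (ystar x) v (linear_solution x) xU yU y'U.
have h2 := linear_solution_lip x y (ystar x) v (linear_solution x) xU yU y'U.
rewrite (gradR_linear_solution x xU) norm_at0 addr0 in h2.
set w := @norm_at R My y _ in h1; rewrite -/w in h2.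
apply: le_trans h1 _; move: w h2 => w h2.
have d0 : 0 <= dist y (ystar x) := dist_ge0 _ _.
move: (norm_at_ge0 y (GR x v)) v0 d0.
move: (norm_at (GR x v))
  (norm_at (linear_solution x)) (dist y (ystar x)) h2 => r V d hw r0 hV d0.
have hc : Lf + rho * V <= Lf + lf * rho / mu.
  by rewrite lerD2l [lf * rho]mulrC -mulrA ler_pM2l.
have hcd := ler_wpM2r d0 hc.
have -> : L_1 mu lf Lf Lg rho * d + Lg / mu * r = (Lf + lf * rho / mu) * d +
    Lg * (((Lf + lf * rho / mu) * d + r) / mu).
  by rewrite /L_1; field; rewrite gt_eqF.
apply: lerD => //; rewrite ler_pM2l // ler_pdivlMr // mulrC.
by apply: le_trans hw _; rewrite lerD2r.
Qed.

Lemma hypergrad_error_sqr x y (v : tangent y) (e : R) : Ux x -> Uy y ->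
  norm_at (Gy g x y) ^+ 2 <= e -> norm_at (GR x v) ^+ 2 <= e ->
  @norm_at R Mx x (Ghat x v - hypergrad f g ystar x) ^+ 2 <=
    2 * Lbar mu lf Lf Lg rho ^+ 2 / mu ^+ 2 * e.
Proof.
move=> xU yU h1 h2; have h := hypergrad_error x y v xU yU.
have hb := error_bound Ux Uy Uy_convex g ystar mu ystar_argmin ystar_region g_C2 g_convex x y xU yU.
have L10 : 0 <= L_1 mu lf Lf Lg rho.
  by rewrite /L_1 ltW // !(addr_gt0, mulr_gt0, invr_gt0, exprn_gt0).
(* [Lbar ^+ 2] dominates both [2 * L_1 ^+ 2] and [2 * Lg ^+ 2], hence their half sum. The factor 2
   of the statement comes instead from squaring a sum of two errors. *)
have LL : L_1 mu lf Lf Lg rho ^+ 2 + Lg ^+ 2 <= Lbar mu lf Lf Lg rho ^+ 2.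
  set L1 := L_1 _ _ _ _ _ in L10 *.
  have s2 : Num.sqrt 2 ^+ 2 = 2 :> R by rewrite sqr_sqrtr.
  have a1 : 2 * L1 ^+ 2 <= Lbar mu lf Lf Lg rho ^+ 2.
    rewrite -s2 -exprMn ler_sqr ?nnegrE ?mulr_ge0 ?sqrtr_ge0 //.
      by rewrite /Lbar -/L1 le_max lexx.
    by rewrite /Lbar le_max mulr_ge0 ?sqrtr_ge0.
  have a2 : 2 * Lg ^+ 2 <= Lbar mu lf Lf Lg rho ^+ 2.
    rewrite -s2 -exprMn ler_sqr ?nnegrE ?mulr_ge0 ?sqrtr_ge0 ?(ltW Lg_gt0) //.
      by rewrite /Lbar -/L1 le_max lexx orbT.
    by rewrite /Lbar le_max mulr_ge0 ?sqrtr_ge0.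
  lra.
move: (norm_at_ge0 x (Ghat x v - hypergrad f g ystar x)) h h1 h2 hb
  (norm_at_ge0 y (Gy g x y)) (norm_at_ge0 y (GR x v)) L10 LL.
move: (@norm_at R Mx x _) (norm_at (Gy g x y)) (norm_at (GR x v))
  (dist y (ystar x)) (L_1 _ _ _ _ _) (Lbar _ _ _ _ _)
  => E a r d L1 LB E0 h h1 h2 hb a0 r0 L10 LL.
have h' : mu * E <= L1 * a + Lg * r.
  have k1 := ler_wpM2l L10 hb; have k2 := ler_wpM2l (ltW mu_gt0) h.
  have k3 : mu * (L1 * d + Lg / mu * r) = L1 * (mu * d) + Lg * r by field; rewrite gt_eqF.
  by rewrite k3 in k2; apply: le_trans k2 _; rewrite lerD2r.
rewrite mulrAC ler_pdivlMr ?exprn_gt0 // mulrC.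
have e0 : 0 <= e by apply: le_trans (sqr_ge0 r) h2.
apply: le_trans (_ : (L1 * a + Lg * r) ^+ 2 <= _).
  by rewrite -exprMn ler_sqr ?nnegrE ?addr_ge0 ?mulr_ge0 // ltW.
have k : (L1 * a + Lg * r) ^+ 2 <= 2 * (L1 ^+ 2 * a ^+ 2 + Lg ^+ 2 * r ^+ 2).
  rewrite -!exprMn; move: (L1 * a) (Lg * r) => b c.
  have := sqr_ge0 (b - c); nra.
apply: le_trans k _.
have k1 := ler_wpM2l (sqr_ge0 L1) h1; have k2 := ler_wpM2l (sqr_ge0 Lg) h2.
have k3 := ler_wpM2r e0 LL.
rewrite -[leRHS]mulrA ler_pM2l //; apply: le_trans k3; rewrite mulrDl; exact: lerD.
Qed.

(** The passage goes through the mixed point (x1, y2, v2): first y and v move at fixed x1, then x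
    moves alone. Since v2 solves the system at x2, its residual at x1 is bounded by
    [gradR_lip_x]. *)
Lemma hypergrad_lipschitz x1 x2 : Ux x1 -> Ux x2 ->
  @norm_at R Mx x2 (Px x1 x2 (hypergrad f g ystar x1) - hypergrad f g ystar x2) <=
    L_F mu lf Lf Lg rho * dist x1 x2.
Proof.
move=> x1U x2U; have y1U := ystar_region x1 x1U; have y2U := ystar_region x2 x2U.
set y1 := ystar x1 in y1U; set y2 := ystar x2 in y2U.
set v1 := linear_solution x1; set v2 := linear_solution x2.
have V2 : norm_at v2 <= lf / mu := norm_linear_solution x2 x2U.
have h1 := approx_hypergrad_lip_y x1 y1 y2 v1 v2 x1U y1U y2U.
have h2 := approx_hypergrad_lip_x x1 x2 y2 v2 x1U x2U y2U.
have h3 := linear_solution_lip x1 y1 y2 v1 v2 x1U y1U y2U.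
have h4 := gradR_lip_x x1 x2 y2 v2 x1U x2U y2U.
rewrite {1}/v1 (gradR_linear_solution x1 x1U) norm_at0 addr0 in h3.
rewrite {1}/v2 (gradR_linear_solution x2 x2U) norm_at0 add0r in h4.
have h5 := ystar_lipschitz Ux Uy Uy_convex Px Py g ystar mu Lg ystar_argmin ystar_region
  mu_gt0 g_C2 g_convex Gg_lip x1 x2 x1U x2U.
rewrite -/y1 -/y2 in h5.
have h0 : @norm_at R Mx x2 (Px x1 x2 (Ghat x1 v1) - Ghat x2 v2) <=
    @norm_at R Mx x1 (Ghat x1 v1 - Ghat x1 v2) +
    @norm_at R Mx x2 (Px x1 x2 (Ghat x1 v2) - Ghat x2 v2).
  rewrite -(transport_norm Ux Ux_convex Px Px_transport x1 x2) //.
  rewrite (transportB Ux Ux_convex Px Px_transport) //.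
  by apply: le_trans (norm_atD x2 _ _); rewrite addrA subrK.
apply: le_trans h0 _; move: h1 h2 h3 h4 h5 V2 (dist_ge0 y1 y2) (dist_ge0 x1 x2).
move: (norm_at _) (norm_at _) (norm_at _) (norm_at (GR x1 v2)) (norm_at v2)
  (dist y1 y2) (dist x1 x2) => B W A r V dy dx hA hB hW hr hdy hV dy0 dx0.
set C := Lf + rho * lf / mu; have C0 : 0 < C by rewrite addr_gt0 ?divr_gt0 ?mulr_gt0.
have hC : Lf + rho * V <= C by rewrite lerD2l -mulrA ler_pM2l.
have hS : dy + dx <= (1 + Lg / mu) * dx by rewrite mulrDl mul1r addrC lerD2l.
have hcS : (Lf + rho * V) * (dy + dx) <= C * ((1 + Lg / mu) * dx).
  apply: le_trans (ler_wpM2r (addr_ge0 dy0 dx0) hC) _.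
  by rewrite ler_pM2l.
have hW' : W <= C * ((1 + Lg / mu) * dx) / mu.
  rewrite ler_pdivlMr // mulrC; apply: le_trans hW _; apply: le_trans hcS.
  by rewrite mulrDr lerD2l.
have -> : L_F mu lf Lf Lg rho * dx =
    C * ((1 + Lg / mu) * dx) + Lg * (C * ((1 + Lg / mu) * dx) / mu).
  by rewrite /L_F -/C; field; rewrite gt_eqF.
apply: le_trans (lerD hA hB) _; rewrite addrAC -mulrDr; apply: lerD => //.
by rewrite ler_pM2l.
Qed.
Local Notation F := (upper_objective f ystar).
Local Notation GF := (hypergrad f g ystar).
Local Notation LF := (L_F mu lf Lf Lg rho).

Lemma L_F_gt0 : 0 < LF.
Proof.
by rewrite /L_F mulr_gt0 ?exprn_gt0 ?addr_gt0 ?divr_gt0 ?mulr_gt0.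
Qed.

(** Supplies continuity of F along a geodesic up to its endpoints, where the derivative formula,
    established at interior times, gives nothing. *)
Lemma upper_objective_lipschitz x1 x2 : Ux x1 -> Ux x2 ->
  `|F x1 - F x2| <= lf * (Lg / mu + 1) * dist x1 x2.
Proof.
move=> x1U x2U; have y1U := ystar_region x1 x1U; have y2U := ystar_region x2 x2U.
have h5 := ystar_lipschitz Ux Uy Uy_convex Px Py g ystar mu Lg ystar_argmin ystar_region
  mu_gt0 g_C2 g_convex Gg_lip x1 x2 x1U x2U.
have h1 := f_lip.1 x1 (ystar x1) (ystar x2) x1U y1U y2U.
have h2 := f_lip.2 x1 x2 (ystar x2) x1U x2U y2U.
rewrite /upper_objective.
have -> : f x1 (ystar x1) - f x2 (ystar x2) = (f x1 (ystar x1) - f x1 (ystar x2)) +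
  (f x1 (ystar x2) - f x2 (ystar x2)) by rewrite addrA subrK.
apply: le_trans (ler_normD _ _) _; apply: le_trans (lerD h1 h2) _.
by rewrite -mulrDr -mulrA ler_pM2l // mulrDl mul1r lerD2r.
Qed.

(** The derivative of F along the geodesic is compared with that of the parabola [q], and the
    difference [psi] is nonincreasing on [0, 1]. *)
Lemma descent x1 x2 : Ux x1 -> Ux x2 ->
  F x2 <= F x1 + inner (GF x1) (Log x1 x2) + LF / 2 * dist x1 x2 ^+ 2.
Proof.
move=> x1U x2U.
(* [Log] is a choice among initial velocities of minimizing geodesics, so the geodesic followed must
   be one that realizes the choice. *)
have [gamma [gm vE]] : exists gamma, minimizing_geodesic x1 x2 gamma /\
    velocity gamma 0 = Log x1 x2 :> 'rV[R]_m.
  have [gamma gm] := convex_geodesic Ux Ux_convex x1 x2 x1U x2U.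
  apply: (xgetPex (0 : 'rV[R]_m) (P := [set v : 'rV[R]_m | exists gamma,
    minimizing_geodesic x1 x2 gamma /\ velocity gamma 0 = v :> 'rV[R]_m])).
  by exists (velocity gamma 0); exists gamma.
have sp := minimizing_speed _ _ _ 0 gm.
have gU (s : R) : 0 <= s <= 1 -> Ux (gamma s).
  by move=> s01; exact: (convex_geodesic_in Ux Ux_convex x1 x2 gamma).
have [_ g0 g1 _] := gm; rewrite -vE -{1}g0 -{1}g1.
have -> : @inner R Mx x1 (GF x1) (velocity gamma 0) = inner (GF (gamma 0)) (velocity gamma 0).
  by rewrite g0.
set d := dist x1 x2 in sp *; set c := inner _ _.
pose phi s := F (gamma s).
pose dphi s := inner (GF (gamma s)) (velocity gamma s).
have der (s : R) : 0 < s < 1 -> is_derive s 1 phi (dphi s).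
  exact: (derive_upper_objective Ux Uy Ux_convex Uy_convex Uy_regular Px Py f g ystar mu Lg
    ystar_argmin ystar_region mu_gt0 Lg_gt0 f_C1 g_C2 g_convex Gg_lip gamma x1 x2 s).
have phic : {within `[0, 1], continuous phi}.
  apply: (lipschitz_within_continuous _ (lf * (Lg / mu + 1) * d)) => s t s01 t01.
  apply: le_trans (upper_objective_lipschitz _ _ (gU s s01) (gU t t01)) _.
  rewrite -[leRHS]mulrA; apply: ler_wpM2l.
    by rewrite mulr_ge0 ?addr_ge0 ?divr_ge0 // ltW.
  rewrite mulrC distrC; exact: dist_minimizing_le.
have dle (s : R) : 0 < s < 1 -> dphi s <= c + LF * s * d ^+ 2.
  move=> /andP[s0 s1]; have s01 : 0 < s <= 1 by rewrite s0 ltW.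
  have s01' : 0 <= s <= 1 by rewrite !ltW.
  (* Transporting the hypergradient back to the start preserves its product with the velocity, so
     that both values can be compared in one tangent space. *)
  have tv := transport_velocity Ux Ux_convex Px Px_transport x1 x2 gamma s (GF (gamma s))
    x1U x2U gm s01.
  rewrite /dphi -tv /c.
  set w := Px _ _ _.
  have -> : inner w (velocity gamma 0) = inner (GF (gamma 0)) (velocity gamma 0) +
      @inner R Mx (gamma 0) (w - GF (gamma 0)) (velocity gamma 0).
    by rewrite -innerDl addrC subrK.
  rewrite lerD2l; apply: le_trans (cauchy_schwarz _ _ _) _.
  rewrite sp expr2 mulrA; apply: ler_wpM2r; first exact: dist_ge0.
  have U0 : Ux (gamma 0) by rewrite g0.
  apply: le_trans (hypergrad_lipschitz _ _ (gU s s01') U0) _.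
  rewrite -mulrA ler_pM2l ?L_F_gt0 //.
  have := dist_minimizing_le _ _ gamma s 0 gm; rewrite sub0r normrN gtr0_norm //; exact.
pose K := LF / 2 * d ^+ 2.
pose q (s : R) : R := (c + K * s) * s.
have dq (s : R) : is_derive s 1 q (c + LF * s * d ^+ 2).
  have e : is_derive s 1 q _ := is_deriveM (is_derive_affine c K s) (is_derive_id s (1 : R)).
  apply: is_derive_eq e _; rewrite /GRing.scale /= mulr1 /K.
  by move: (c) (LF) => a b; field.
pose psi (s : R) : R := phi s - q s.
have dpsi (s : R) : 0 < s < 1 -> is_derive s 1 psi (dphi s - (c + LF * s * d ^+ 2)).
  by move=> s01; exact: (is_deriveB (der s s01) (dq s)).
have psic : {within `[0, 1], continuous psi}.
  have qc : {within `[0, 1], continuous q}.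
    apply: continuous_subspaceT => s; apply: differentiable_continuous.
    by apply/derivable1_diffP; case: (dq s).
  by move=> s; apply: cvgB; [exact: phic|exact: qc].
have := derive_le0_le psi _ dpsi _ psic.
rewrite /psi /q mulr0 subr0 !mulr1 lerBlDr addrA => key.
by apply: key => s s01; rewrite subr_le0 dle.
Qed.

End HypergradientBounds.

(** * Adaptive step sizes *)

Section AdaptiveSteps.
Context {R : realType}.
(** In the application [Fv] holds the values of F at the iterates, [G] and [H] the squared norms of
    the approximate and of the true hypergradient, and [E] bounds the squared error between the
    two. *)
Variables (a Fv G H : nat -> R) (T : nat) (L E C Finf : R).
Hypothesis a_gt0 : 0 < a 0%N.
Hypothesis G_ge0 : forall t, 0 <= G t.
Hypothesis H_ge0 : forall t, 0 <= H t.
Hypothesis L_ge0 : 0 <= L.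
Hypothesis E_ge0 : 0 <= E.
Hypothesis C_ge2L : 2 * L <= C.
Hypothesis C_gea : a 0%N <= C.
Hypothesis a_step : forall t, (t < T)%N -> a t.+1 = Num.sqrt (a t ^+ 2 + G t).
Hypothesis F_step : forall t, (t < T)%N ->
  Fv t.+1 <= Fv t + (E - H t - G t) / (2 * a t.+1) + L / 2 * G t / a t.+1 ^+ 2.
Hypothesis F_inf : Finf <= Fv T.

Lemma step_gt0 t : (t <= T)%N -> 0 < a t.
Proof.
elim: t => [//|t IH tT]; rewrite a_step // sqrtr_gt0.
by rewrite ltr_wpDr ?G_ge0 // exprn_gt0 // IH // ltnW.
Qed.

Lemma step_sqr t : (t < T)%N -> a t.+1 ^+ 2 = a t ^+ 2 + G t.
Proof. by move=> tT; rewrite a_step // sqr_sqrtr // addr_ge0 ?G_ge0 ?sqr_ge0. Qed.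

Lemma step_le s t : (s <= t)%N -> (t <= T)%N -> a s <= a t.
Proof.
elim: t => [|t IH]; first by rewrite leqn0 => /eqP ->.
rewrite leq_eqVlt => /predU1P[-> //|st] tT; apply: le_trans (IH st (ltnW tT)) _.
have a0 := ltW (step_gt0 t (ltnW tT)); have a1 := ltW (step_gt0 t.+1 tT).
by rewrite -ler_sqr ?nnegrE // step_sqr // lerDl.
Qed.

(* Steps with a_(t+1) <= C are charged to the growth of a_t^2 below C^2; for
   the others L / a_(t+1)^2 <= 1 / (2 a_(t+1)), and half of the gradient term
   is left over to bound the growth of a_t itself. *)
Let small t := if a t.+1 <= C then G t else 0.
Let large t := if a t.+1 <= C then 0 else G t / (2 * a t.+1).

(** The induction needs the minimum of [a t ^+ 2] and [C ^+ 2]: a small step raises it by exactly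
    [G t], and any other step does not lower it. *)
Lemma small_steps t : (t <= T)%N -> \sum_(s < t) small s <= C ^+ 2 - a 0%N ^+ 2.
Proof.
have C0 : 0 <= C := le_trans (ltW a_gt0) C_gea.
suff h : (t <= T)%N -> \sum_(s < t) small s <= Num.min (a t ^+ 2) (C ^+ 2) - a 0%N ^+ 2.
  by move=> tT; apply: le_trans (h tT) _; rewrite lerD2r ge_min lexx orbT.
elim: t => [_|t IH tT].
  by rewrite big_ord0 subr_ge0 le_min lexx /= ler_sqr ?nnegrE // ltW.
rewrite big_ord_recr /= /small; case: ifP => [aC|_]; last first.
  rewrite addr0; apply: le_trans (IH (ltnW tT)) _; rewrite lerD2r.
  rewrite le_min ge_min [X in _ && X]ge_min lexx orbT andbT.
  by rewrite step_sqr // lerDl G_ge0.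
have aC2 : a t.+1 ^+ 2 <= C ^+ 2 by rewrite ler_sqr ?nnegrE // ltW // step_gt0.
rewrite (min_idPl aC2) step_sqr //; apply: le_trans (lerD (IH (ltnW tT)) (lexx _)) _.
by rewrite addrAC lerD2r lerD2r ge_min lexx.
Qed.

Lemma large_ge0 t : (t < T)%N -> 0 <= large t.
Proof.
move=> tT; rewrite /large; case: ifP => // _.
by rewrite divr_ge0 // mulr_ge0 // ltW // step_gt0.
Qed.

(** Beyond C a step increases a by at most [G t / a t.+1], because [G t] is the difference of the
    squares and a is nondecreasing. This is twice the half term collected in [large]. *)
Lemma step_growth t : (t <= T)%N -> a t <= C + 2 * \sum_(s < t) large s.
Proof.
elim: t => [_|t IH tT]; first by rewrite big_ord0 mulr0 addr0.
have a0 := step_gt0 t (ltnW tT); have a1 := step_gt0 t.+1 tT.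
have s0 : 0 <= \sum_(s < t.+1) large s.
  by apply: sumr_ge0 => s _; apply: large_ge0; apply: leq_trans (ltn_ord s) tT.
have [aC|aC] := leP (a t.+1) C; first by apply: le_trans aC _; rewrite lerDl mulr_ge0.
rewrite big_ord_recr /= mulrDr addrA {2}/large (lt_geF aC).
apply: le_trans (lerD (IH (ltnW tT)) (lexx _)).
have -> : 2 * (G t / (2 * a t.+1)) = G t / a t.+1 by field; rewrite gt_eqF.
rewrite -lerBlDl ler_pdivlMr // mulrBl -expr2 step_sqr // lerBlDr addrC.
by rewrite lerD2l expr2 ler_pM2l // step_le.
Qed.

Lemma descent_sum t : (t <= T)%N ->
  \sum_(s < t) H s / a s.+1 + \sum_(s < t) large s <=
  2 * (Fv 0%N - Fv t) + t%:R * E / a 0%N + L / a 0%N ^+ 2 * \sum_(s < t) small s.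
Proof.
elim: t => [_|t IH tT]; first by rewrite !big_ord0 subrr !mulr0 !mul0r !addr0.
rewrite !big_ord_recr /= addrACA.
have a1 := step_gt0 t.+1 tT; have le1 := step_le 0 t.+1 (leq0n _) tT.
have key : H t / a t.+1 + large t <=
    2 * (Fv t - Fv t.+1) + E / a 0%N + L / a 0%N ^+ 2 * small t.
  have st : H t / a t.+1 + G t / a t.+1 <=
      2 * (Fv t - Fv t.+1) + E / a t.+1 + L * G t / a t.+1 ^+ 2.
    have := F_step t tT.
    have -> : (E - H t - G t) / (2 * a t.+1) = (E / a t.+1 - H t / a t.+1 - G t / a t.+1) / 2.
      by field; rewrite gt_eqF.
    have -> : L / 2 * G t / a t.+1 ^+ 2 = L * G t / a t.+1 ^+ 2 / 2.
      by field; rewrite gt_eqF.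
    move: (H t / _) (G t / _) (E / _) (L * _ / _) => h k e l; lra.
  have Ele : E / a t.+1 <= E / a 0%N by apply: ler_wpM2l => //; rewrite lef_pV2.
  have Gp : 0 <= G t / a t.+1 by rewrite divr_ge0 // ltW.
  rewrite /large /small; case: (leP (a t.+1) C) => aC.
    have Lle : L * G t / a t.+1 ^+ 2 <= L / a 0%N ^+ 2 * G t.
      rewrite [leRHS]mulrAC; apply: ler_wpM2l; first exact: mulr_ge0.
      by rewrite lef_pV2 ?posrE ?exprn_gt0 // ler_sqr ?nnegrE // ltW.
    move: st Ele Gp Lle; rewrite addr0.
    move: (H t / _) (G t / _) (E / _) (L * _ / _) (E / _) (L / _ * _) => h k e l e' l'; lra.
  have Lle : L * G t / a t.+1 ^+ 2 <= G t / a t.+1 / 2.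
    have -> : L * G t / a t.+1 ^+ 2 = (2 * L) / a t.+1 * (G t / a t.+1 / 2).
      by field; rewrite gt_eqF.
    apply: ler_piMl; first by rewrite divr_ge0.
    by rewrite ler_pdivrMr // mul1r (le_trans C_ge2L) // ltW.
  have -> : G t / (2 * a t.+1) = G t / a t.+1 / 2 by field; rewrite gt_eqF.
  move: st Ele Gp Lle; rewrite mulr0 addr0.
  move: (H t / _) (G t / _) (E / a t.+1) (L * _ / _) (E / _) => h k e l e'; lra.
apply: le_trans (lerD (IH (ltnW tT)) key) _.
by rewrite -natr1 le_eqVlt; apply/orP; left; apply/eqP; ring.
Qed.

(** [descent_sum] bounds the sum of [H s / a s.+1] by A; replacing every denominator by the largest
    one costs the factor [a T], itself at most [C + 2 * A] since A also bounds the sum of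
    [large]. *)
Lemma adaptive_sum :
  let A := 2 * (Fv 0%N - Finf) + L * C ^+ 2 / a 0%N ^+ 2 + T%:R * E / a 0%N in
  \sum_(t < T) H t <= A * (C + 2 * A).
Proof.
cbv zeta; set A := _ + T%:R * E / _; have D := descent_sum T (leqnn T); have S := small_steps T (leqnn T).
have g := step_growth T (leqnn T).
set h := \sum_(s < T) H s / a s.+1 in D.
set l := \sum_(s < T) large s in D g.
have l0 : 0 <= l.
  by apply: sumr_ge0 => s _; exact: large_ge0.
have h0 : 0 <= h.
  by apply: sumr_ge0 => s _; rewrite divr_ge0 // ltW // step_gt0.
have hA : h + l <= A.
  apply: le_trans D _; rewrite /A [leRHS]addrAC; apply: lerD.
    by rewrite lerD2r ler_pM2l // lerD2l lerN2.
  rewrite [leRHS]mulrAC; apply: ler_wpM2l; first by rewrite divr_ge0 // sqr_ge0.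
  by apply: le_trans S _; rewrite lerBlDr lerDl sqr_ge0.
have aT := step_gt0 T (leqnn T).
apply: le_trans (_ : h * a T <= _).
  rewrite mulr_suml; apply: ler_sum => s _.
  have as0 := step_gt0 s.+1 (ltn_ord s).
  rewrite mulrAC ler_pdivlMr //; apply: ler_wpM2l => //; exact: step_le.
apply: ler_pM => //; first exact: ltW.
  by apply: le_trans hA; rewrite lerDl.
apply: le_trans g _; rewrite lerD2l ler_pM2l //.
by apply: le_trans hA; rewrite lerDr.
Qed.

End AdaptiveSteps.

(** * The convergence rate *)

Lemma norm_atB_sqr {R : realType} {M : riemannian_manifold R} (p : M)
    (v w : 'rV[R]_(Defs.dim M)) :
  @norm_at R M p (v - w) ^+ 2 =
  @norm_at R M p v ^+ 2 - 2 * @inner R M p w v + @norm_at R M p w ^+ 2.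
Proof.
rewrite !norm_at_sqr innerDl innerNl !innerDr !innerNr (inner_sym p v w).
by move: (inner w v) (inner v v) (inner w w) => a b c; ring.
Qed.

Theorem theorem3p2 (R : realType) (Mx My : riemannian_manifold R)
  (tau : R)
  (Mx_complete : complete_manifold Mx)
  (My_hadamard : hadamard My)
  (tau_lt0 : tau < 0)
  (My_curvature : sectional_ge My tau)
  (* region and parallel transport *)
  (Ux : set Mx) (Uy : set My)
  (Ux_convex : geodesically_convex Ux)
  (Uy_convex : geodesically_convex Uy)
  (* the gradients on the region are determined by the values there *)
  (Ux_regular : Ux `<=` closure (interior Ux))
  (Uy_regular : Uy `<=` closure (interior Uy))
  (Px : forall p q : Mx, tangent p -> tangent q)
  (Py : forall p q : My, tangent p -> tangent q)
  (Px_transport : is_parallel_transport Ux Px)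
  (Py_transport : is_parallel_transport Uy Py)
  (* bilevel problem *)
  (f g : Mx -> My -> R) (ystar : Mx -> My)
  (ystar_argmin : forall x y, g x (ystar x) <= g x y)
  (ystar_region : forall x, Ux x -> Uy (ystar x))
  (F_bounded : has_lbound (range (upper_objective f ystar)))
  (mu lf Lf Lg rho : R)
  (mu_gt0 : 0 < mu) (lf_gt0 : 0 < lf) (Lf_gt0 : 0 < Lf) (Lg_gt0 : 0 < Lg)
  (rho_gt0 : 0 < rho)
  (f_C1 : Ck_prod 1 (Ux `*` Uy) f)
  (g_C2 : Ck_prod 2 (Ux `*` Uy) g)
  (g_convex : forall x, Ux x -> strongly_convex mu Uy (g x))
  (f_lip : lipschitz_fun Ux Uy lf f)
  (Gf_lip : lipschitz_grads Ux Uy Px Py Lf f)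
  (Gg_lip : lipschitz_grads Ux Uy Px Py Lg g)
  (Hyg_lip : lipschitz_Hy Ux Uy Py rho g)
  (Gxyg_lip : lipschitz_Gxy Ux Uy Px Py rho g)
  (Gyxg_lip : lipschitz_Gyx Ux Uy Px Py rho g)
  (* retractions *)
  (Retrx : forall p : Mx, tangent p -> Mx)
  (Retry : forall p : My, tangent p -> My)
  (Retrx_retraction : is_retraction Retrx)
  (Retry_retraction : is_retraction Retry)
  (cu cR : R) (cu_ge1 : 1 <= cu) (cR_ge0 : 0 <= cR)
  (Retrx_bounds : retraction_bounds Ux Retrx cu cR)
  (Retry_bounds : retraction_bounds Uy Retry cu cR)
  (* a run of AdaRHD-R *)
  (var : variant) (T : nat) (T_ge1 : (1 <= T)%N)
  (x0 : Mx) (y0 : My) (v0 : tangent y0) (a0 b0 c0 : R)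
  (a0_gt0 : 0 < a0) (b0_gt0 : 0 < b0) (c0_gt0 : 0 < c0)
  (x : nat -> Mx) (K : nat -> nat) (y : nat -> nat -> My)
  (N : nat -> nat) (v : forall t, nat -> tangent (y t (K t))) (a : nat -> R)
  (run : AdaRHD_R f g Retrx Retry Py var T x0 v0 a0 b0 c0 x N v a)
  (x_region : forall t, (t <= T)%N -> Ux (x t))
  (y_region : forall t k, (t < T)%N -> (k <= K t)%N -> Uy (y t k))
  (zeta Dbar : R) (Dbar_gt0 : 0 < Dbar)
  (zeta_bound : forall t k, (t < T)%N -> (k <= K t)%N ->
     zeta_curv tau (dist (y t k) (ystar (x t))) <= zeta)
  (y_bounded : forall t k, (t < T)%N -> (k <= K t)%N ->
     dist (y t k) (ystar (x t)) <= Dbar) :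
  let Fstar := inf (range (upper_objective f ystar)) in
  let gap := upper_objective f ystar x0 - Fstar in
  T%:R^-1 * \sum_(t < T) norm_at (hypergrad f g ystar (x t)) ^+ 2
  <= C_retr mu lf Lf Lg rho cu cR a0 gap / T%:R.
Proof.
cbv zeta; set Fstar := inf _; set F := upper_objective f ystar.
set GF := hypergrad f g ystar.
pose h t := approx_hypergrad f g (x t) (v t (N t)).
have xU t : (t < T)%N -> Ux (x t) by move=> /ltnW; exact: x_region.
have yU t : (t < T)%N -> Uy (y t (K t)) by move=> tT; exact: y_region.
have T0 : (0 : R) < T%:R by rewrite ltr0n.
have LF0 : 0 < L_F mu lf Lf Lg rho by exact: L_F_gt0.
pose B := lf + lf * Lg / mu.
have B0 : 0 <= B by rewrite addr_ge0 ?mulr_ge0 ?invr_ge0 // ltW.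
have err t : (t < T)%N -> @norm_at R Mx (x t) (h t - GF (x t)) ^+ 2 <=
    2 * Lbar mu lf Lf Lg rho ^+ 2 / mu ^+ 2 * T%:R^-1.
  move=> tT; have [b [_ _ hy]] := y_loop run tT.
  (* Both inner solvers end on the same residual test, so one bound covers the two variants. *)
  have hv : norm_at (gradR f g (x t) (v t (N t))) ^+ 2 <= T%:R^-1.
    have := v_loop run; case: (var) => [[_ _ l]|l]; have := l t tT.
      by move=> [? []].
    by move=> [? [? []]].
  exact: (hypergrad_error_sqr Ux Uy Uy_convex Uy_regular Px Py Py_transport f g ystar
    ystar_argmin ystar_region mu lf Lf Lg rho mu_gt0 lf_gt0 Lf_gt0 Lg_gt0 rho_gt0 f_C1 g_C2
    g_convex f_lip Gf_lip Gg_lip Hyg_lip Gxyg_lip _ _ _ _ (xU t tT) (yU t tT) hy hv).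
have step t : (t < T)%N -> F (x t.+1) <= F (x t) - (a t.+1)^-1 * inner (GF (x t)) (h t)
    + Lbar_F mu lf Lf Lg rho cu cR / 2 * norm_at (h t) ^+ 2 / a t.+1 ^+ 2.
  move=> tT; have [_ xE] := x_step run tT; have xU' := x_region t.+1 tT.
  set u : tangent (x t) := - (a t.+1)^-1 *: h t in xE.
  have [hd hl] := Retrx_bounds (x t) u (xU t tT); rewrite -xE in hd hl.
  have D := descent Ux Uy Ux_convex Uy_convex Uy_regular Px Py Px_transport Py_transport f g
    ystar ystar_argmin ystar_region mu lf Lf Lg rho mu_gt0 lf_gt0 Lf_gt0 Lg_gt0 rho_gt0 f_C1
    g_C2 g_convex f_lip Gf_lip Gg_lip Hyg_lip Gxyg_lip (x t) (x t.+1) (xU t tT) xU'.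
  have GB : norm_at (GF (x t)) <= B.
    exact: (norm_hypergrad_le Ux Uy Ux_convex Uy_convex Ux_regular Uy_regular Px Py f g ystar
      ystar_region mu lf Lg mu_gt0 lf_gt0 Lg_gt0 f_C1 g_C2 g_convex f_lip Gg_lip _ (xU t tT)).
  have uE : norm_at u ^+ 2 = norm_at (h t) ^+ 2 / a t.+1 ^+ 2.
    by rewrite /u norm_atZ exprMn real_normK ?num_real // sqrrN exprVn mulrC.
  have iu : inner (GF (x t)) u = - (a t.+1)^-1 * inner (GF (x t)) (h t).
    by rewrite /u innerZr.
  (* Replacing the logarithm by the step u costs [B * cR * |u|^2]; together with
     [L_F / 2 * cu * |u|^2] from the distance term this makes [Lbar_F / 2 * |u|^2]. *)
  have iL : inner (GF (x t)) (Log (x t) (x t.+1)) <= inner (GF (x t)) u + B * (cR * norm_at u ^+ 2).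
    have -> : inner (GF (x t)) (Log (x t) (x t.+1)) = inner (GF (x t)) u +
        @inner R Mx (x t) (GF (x t)) ((Log (x t) (x t.+1) : 'rV[R]_(Defs.dim Mx)) - u).
      by rewrite -innerDr addrC subrK.
    rewrite lerD2l; apply: le_trans (cauchy_schwarz _ _ _) _.
    by apply: ler_pM => //; exact: norm_at_ge0.
  apply: le_trans D _; rewrite -mulNr -iu -addrA -/F.
  have LF2 : 0 <= L_F mu lf Lf Lg rho / 2 by rewrite divr_ge0 // ltW.
  rewrite -addrA lerD2l; apply: le_trans (lerD iL (ler_wpM2l LF2 hd)) _.
  rewrite -mulrA -uE -addrA lerD2l /Lbar_F -/B.
  by rewrite le_eqVlt; apply/orP; left; apply/eqP; field.
set E := 2 * Lbar mu lf Lf Lg rho ^+ 2 / mu ^+ 2 * T%:R^-1 in err.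
set L := Lbar_F mu lf Lf Lg rho cu cR in step.
have E0 : 0 <= E by apply: divr_ge0 => //; apply: divr_ge0; rewrite ?sqr_ge0 // mulr_ge0 ?sqr_ge0.
have L0 : 0 <= L.
  rewrite /L /Lbar_F -/B; have cu0 := le_trans ler01 cu_ge1.
  by apply: addr_ge0; apply: mulr_ge0 => //; [exact: ltW|exact: mulr_ge0].
have aT0 : 0 < a 0%N by rewrite (a_init run).
have a_step t : (t < T)%N -> a t.+1 = Num.sqrt (a t ^+ 2 + norm_at (h t) ^+ 2).
  by move=> tT; have [] := x_step run tT.
(* Polarization: p is the product of GF and h, while q and r are the squared norms of h and GF, so
   the error bound turns the product into a negative multiple of both squares. *)
have num (p q r c : R) : 0 < c -> q - 2 * p + r <= E -> - (c^-1 * p) <= (E - r - q) / (2 * c).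
  move=> c_gt0 hE; have -> : (E - r - q) / (2 * c) = c^-1 * ((E - r - q) / 2).
    by field; rewrite gt_eqF.
  rewrite -mulrN ler_pM2l ?invr_gt0 //; lra.
have F_step t : (t < T)%N -> F (x t.+1) <= F (x t) +
    (E - norm_at (GF (x t)) ^+ 2 - norm_at (h t) ^+ 2) / (2 * a t.+1) +
    L / 2 * norm_at (h t) ^+ 2 / a t.+1 ^+ 2.
  move=> tT; apply: le_trans (step t tT) _; rewrite lerD2r lerD2l.
  have a1 : 0 < a t.+1.
    by apply: (step_gt0 a (fun t => norm_at (h t) ^+ 2) T) => // s; exact: sqr_ge0.
  by have := err t tT; rewrite norm_atB_sqr; exact: num.
have F_inf : Fstar <= F (x T) by apply: ge_inf => //; exists (x T).
have S := adaptive_sum a (fun t => F (x t)) (fun t => norm_at (h t) ^+ 2)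
  (fun t => norm_at (GF (x t)) ^+ 2) T L E (C_a mu lf Lf Lg rho cu cR a0) Fstar.
rewrite mulrC ler_pM2r ?invr_gt0 //; apply: le_trans (S _ _ _ _ _ _ _ _ _ _) _ => //.
- by move=> t; exact: sqr_ge0.
- by move=> t; exact: sqr_ge0.
- by rewrite /C_a le_max lexx.
- by rewrite /C_a (a_init run) le_max lexx orbT.
(* The factor T multiplying E cancels the tolerance 1/T inside E, so the bound on the sum is
   [C_retr] exactly. *)
rewrite (x_init run) (a_init run) /C_retr /F_0 -/L.
by rewrite le_eqVlt; apply/orP; left; apply/eqP; rewrite /E; field; rewrite !gt_eqF.
Qed.
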